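(* Under the standing assumptions in the context, let $(u_h^n)_{n=1}^N\subset V_h$ be the solution, with given $u_h^0\in V_h$, of $$(D_\tau^\alpha u_h^n,I_h^*v_h)+a(u_h^n,I_h^*v_h)+(q u_h^n,I_h^*v_h)=(f^n,I_h^*v_h)\qquad\forall v_h\in V_h,\ n=1,\dots,N.$$ (1) There exists a constant $C>0$ independent of $h$ and $\tau$ such that $$\|u_h^n\|\le C\Big(\|u_h^0\|+\sup_{t\in[0,T]}\|f(t)\|\Big).$$ (2) Moreover, let $c_0>0$ be a constant. Then there exist constants $C>0$ and $\tau_0$ $(0<\tau_0<1)$ independent of $h$ and $\tau$ such that, when $h\le c_0\tau\le c_0\tau_0$ and $h\le h_1$, where $h_1=\min\{\mu_6/\mu_5,1\}$, $$\|u_h^n\|_1\le C e^{\frac{c_0T\mu_5}{2\mu_6}}\Big(\|u_h^0\|_1+\sup_{t\in[0,T]}\|f(t)\|\Big).$$ Both bounds are for $n=1,\dots,N$.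
   Context: Data. $\Omega\subset\mathbb R^2$ is a bounded convex polygonal domain, $T\in(0,\infty)$, $0<\alpha<1$. The function $q\ge 0$ on $\bar\Omega$ and the source $f(x,t)$ are smooth enough. $\mathcal A=(a_{ij})_{2\times2}$ is a sufficiently smooth symmetric matrix function with $\xi^T\mathcal A(x)\xi\ge\beta_0\,\xi^T\xi$ for all $\xi\in\mathbb R^2$, $x\in\bar\Omega$, for some constant $\beta_0>0$. $(\cdot,\cdot)$ and $\|\cdot\|$ are the $L^2(\Omega)$ inner product and norm, $\|\cdot\|_1$ is the $H^1(\Omega)$ norm. Meshes. $\mathcal T_h$ is a quasi-uniform triangular mesh of $\Omega$, $h=\max_{K\in\mathcal T_h}\operatorname{diam}K$. $Z_h$ is the set of vertices and $Z_h^0$ the set of interior vertices. Each triangle is split into three quadrilaterals by joining its barycenter to its three edge midpoints; the control volume $K_z^*$ of $z\in Z_h$ is the union, over the triangles having $z$ as a vertex, of the quadrilateral containing $z$. Spaces and operator. $V_h=\{v\in H_0^1(\Omega): v|_K\in P_1(K)\ \forall K\in\mathcal T_h\}$. $V_h^*$ is the space of functions constant on each $K_z^*$ and zero on $K_z^*$ for boundary vertices $z$. $I_h^*v=\sum_{z\in Z_h^0}v(z)\Psi_z$, where $\Psi_z$ is the characteristic function of $K_z^*$. Bilinear form. For $\bar u\in V_h$ and $\bar v\in V_h^*$, $a(\bar u,\bar v)=-\sum_{z\in Z_h}\bar v(z)\int_{\partial K_z^*}\mathcal A\nabla\bar u\cdot\mathbf n\,ds$, with $\mathbf n$ the outward unit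 normal on $\partial K_z^*$ and $\bar v(z)$ the value of $\bar v$ on $K_z^*$. Constants. $\mu_5$ and $\mu_6$ are the positive constants in the following known facts about $a(\cdot,I_h^*\cdot)$: (i) for all $v_h,w_h\in V_h$, $|a(v_h,I_h^*w_h)-a(w_h,I_h^*v_h)|\le\mu_5h\|v_h\|_1\|w_h\|_1$ and $|a(v_h,I_h^*w_h)-\sum_{K\in\mathcal T_h}|K|\,\mathcal A(Q_K)\nabla v_h|_K\cdot\nabla w_h|_K|\le\mu_5h\|v_h\|_1\|w_h\|_1$, where $Q_K$ is the barycenter of $K$; (ii) there is $h_0>0$ such that for $0<h\le h_0$, $a(v_h,I_h^*v_h)\ge\mu_6\|v_h\|_1^2$ for all $v_h\in V_h$. Time discretization. $N$ is a positive integer, $\tau=T/N$, $t_n=n\tau$, $f^n=f(\cdot,t_n)$, $b_k=(k+1)^{1-\alpha}-k^{1-\alpha}$. For $n\ge1$: $\tilde b_n^n=1$, $\tilde b_0^n=(n-1)^{1-\alpha}-n^{1-\alpha}$, $\tilde b_k^n=b_{n-k}-b_{n-k-1}$ for $0<k<n$. The $L1$ operator is $D_\tau^\alpha\varphi^n=\frac{\tau^{-\alpha}}{\Gamma(2-\alpha)}\sum_{k=0}^n\tilde b_k^n\varphi^k$. *)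

(* Defs.v *)
From HB Require Import structures.
From mathcomp Require Import all_boot all_order all_algebra.
From mathcomp Require Import all_classical all_reals all_analysis.
Import Order.TTheory GRing.Theory Num.Theory.
Import numFieldNormedType.Exports.
Set Implicit Arguments.
Unset Strict Implicit.
Unset Printing Implicit Defensive.
Local Open Scope classical_set_scope.
Local Open Scope ring_scope.

(* Functions on Omega are represented by total functions R * R -> R. *)

Section Plane.
Context {R : realType}.
Implicit Types (x y p : R * R) (v w : R * R -> R).

Definition mu2 := (@lebesgue_measure R \x @lebesgue_measure R)%E.

Definition eucl_dist x y : R :=
  Num.sqrt ((x.1 - y.1) ^+ 2 + (x.2 - y.2) ^+ 2).

Definition diam (E : set (R * R)) : R :=
  sup [set eucl_dist x y | x in E & y in E].

Definition conv (s : seq (R * R)) : set (R * R) :=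
  [set x | exists l : 'I_(size s) -> R,
    [/\ forall i, 0 <= l i, \sum_i l i = 1,
        x.1 = \sum_i l i * (s`_i).1 & x.2 = \sum_i l i * (s`_i).2]].

Definition convex_polygonal_domain (Om : set (R * R)) : Prop :=
  [/\ Om !=set0, open Om,
      forall x y t, Om x -> Om y -> 0 <= t <= 1 ->
        Om (t * x.1 + (1 - t) * y.1, t * x.2 + (1 - t) * y.2)
    & exists s, closure Om = conv s].

Definition d1 v x : R := derive1 (fun s => v (s, x.2)) x.1.
Definition d2 v x : R := derive1 (fun s => v (x.1, s)) x.2.

Definition col2 (a b : R) : 'cV[R]_2 := \col_i (if i == 0 then a else b).
Definition dot (a b : 'cV[R]_2) : R := (a^T *m b) 0 0.
Definition grad v x : 'cV[R]_2 := col2 (d1 v x) (d2 v x).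

Definition ip (Om : set (R * R)) v w : R := \int[mu2]_(x in Om) (v x * w x).
Definition L2norm Om v : R := Num.sqrt (ip Om v v).

(* The gradient is the classical one. On finite element functions it exists
   off the edges of the mesh, hence almost everywhere, and is the weak
   gradient. *)
Definition H1norm Om v : R :=
  Num.sqrt (ip Om v v + ip Om (d1 v) (d1 v) + ip Om (d2 v) (d2 v)).

Definition in_L2 (Om : set (R * R)) v : Prop :=
  measurable_fun Om v /\ (\int[mu2]_(x in Om) ((v x) ^+ 2)%:E < +oo)%E.

Definition cvg_L2 (Om : set (R * R)) (w : nat -> R * R -> R) v : Prop :=
  (\int[mu2]_(x in Om) ((w n x - v x) ^+ 2)%:E)%E @[n --> \oo] --> 0%E.

(* All iterated partial derivatives exist and are continuous. *)
Definition smooth v : Prop :=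
  forall s : seq bool,
    let w := foldr (fun b g => if b then d1 g else d2 g) v s in
    [/\ continuous w,
        forall x, derivable (fun t => w (t, x.2)) x.1 1
      & forall x, derivable (fun t => w (x.1, t)) x.2 1].

Definition test_function (Om : set (R * R)) v : Prop :=
  smooth v /\
  exists E, [/\ compact E, E `<=` Om & forall x, ~ E x -> v x = 0].

Definition H10 (Om : set (R * R)) v : Prop :=
  in_L2 Om v /\
  exists g1 g2 (phi : nat -> R * R -> R),
    [/\ in_L2 Om g1 /\ in_L2 Om g2,
        forall n, test_function Om (phi n),
        cvg_L2 Om phi v,
        cvg_L2 Om (fun n => d1 (phi n)) g1
      & cvg_L2 Om (fun n => d2 (phi n)) g2].

Definition segment_integral x y v : R :=
  eucl_dist x y *
  \int[lebesgue_measure]_(t in `[0, 1])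
    v (x.1 + t * (y.1 - x.1), x.2 + t * (y.2 - x.2)).

(* Unit normal to the segment [x, y] pointing away from p; zero if the three
   points are collinear. *)
Definition normal_away x y p : 'cV[R]_2 :=
  let r := col2 (y.2 - x.2) (x.1 - y.1) in
  (- Num.sg (dot r (col2 (p.1 - x.1) (p.2 - x.2))) / eucl_dist x y) *: r.

Definition midpoint x y : R * R := ((x.1 + y.1) / 2, (x.2 + y.2) / 2).

End Plane.

(* A triangle is the set of the indices of its vertices. *)
Record mesh (R : realType) := Mesh {
  nv : nat;
  vtx : 'I_nv -> R * R;
  tri : {set {set 'I_nv}} }.

Section FiniteVolumes.
Context {R : realType}.
Variables (Om : set (R * R)) (M : mesh R).
Local Notation node := 'I_(nv M).
Implicit Types (K L : {set node}) (z : node) (v w : R * R -> R).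

Definition cell K : set (R * R) := conv [seq vtx z | z <- enum K].

Definition area K : R := fine (mu2 (cell K)).

Definition meshsize : R := \big[Num.max/0]_(K in tri M) diam (cell K).

Definition triangulation : Prop :=
  [/\ injective (@vtx R M),
      forall z, exists2 K, K \in tri M & z \in K,
      forall K, K \in tri M -> #|K| = 3 /\
        (forall x y z : node, K = [set x; y; z]%SET ->
          ((vtx y).1 - (vtx x).1) * ((vtx z).2 - (vtx x).2) !=
          ((vtx y).2 - (vtx x).2) * ((vtx z).1 - (vtx x).1)),
      closure Om = \bigcup_(K in [set K | K \in tri M]) cell K
    & forall K L, K \in tri M -> L \in tri M ->
        cell K `&` cell L = cell (K :&: L)].

Definition bary K : R * R :=
  ((\sum_(z in K) (vtx z).1) / 3, (\sum_(z in K) (vtx z).2) / 3).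

Definition quadrilateral K z : set (R * R) :=
  conv ([:: vtx z; bary K] ++
        [seq midpoint (vtx z) (vtx y) | y <- enum (K :\ z)]).

(* Closed control volumes overlap along their sides only, a null set. *)
Definition control_volume z : set (R * R) :=
  \bigcup_(K in [set K | (K \in tri M) && (z \in K)]) quadrilateral K z.

Definition interior_node : {set node} := [set z | vtx z \in Om]%SET.

Definition boundary_edge z y : bool :=
  (z != y) && (#|[set K in tri M | (z \in K) && (y \in K)]%SET| == 1%N).

Definition P1_on K v : Prop :=
  exists a b c, forall x, cell K x -> v x = a + b * x.1 + c * x.2.

(* Vanishing off Omega selects the representative that is zero on the boundary,
   the extension by zero. Being affine on closed triangles, it is continuous. *)
Definition Vh v : Prop :=
  [/\ H10 Om v, forall x, ~ Om x -> v x = 0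
    & forall K, K \in tri M -> P1_on K v].

(* For v affine on K, the constant gradient of v|_K. *)
Definition gradK K v : 'cV[R]_2 := grad v (bary K).

Definition Ihs v : R * R -> R :=
  fun x => \sum_(z in interior_node) v (vtx z) * \1_(control_volume z) x.

Variable A : R * R -> 'M[R]_2.

Definition flux_on_segment K v x y p : R :=
  segment_integral x y (fun s => dot (A s *m gradK K v) (normal_away x y p)).

(* Integral of A grad v . n over the boundary of the control volume of z. The
   sides of this polygon are, in each triangle K having z as a vertex, the two
   segments from an edge midpoint to the barycenter and, when an edge at z lies
   on the boundary of Omega, the half of that edge next to z. *)
Definition flux z v : R :=
  \sum_(K in tri M | z \in K) \sum_(y in K :\ z)
    let m := midpoint (vtx z) (vtx y) in
    (flux_on_segment K v m (bary K) (vtx z) +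
     (if boundary_edge z y
      then flux_on_segment K v (vtx z) m (bary K) else 0)).

(* The vertex z lies in no other control volume than its own, so the value of
   wbar on this control volume is wbar (vtx z). *)
Definition bilin v wbar : R := - \sum_(z : node) wbar (vtx z) * flux z v.

Definition bilin_symmetry_bound (mu5 : R) : Prop :=
  forall v w, Vh v -> Vh w ->
    `|bilin v (Ihs w) - bilin w (Ihs v)|
      <= mu5 * meshsize * H1norm Om v * H1norm Om w.

Definition bilin_consistency_bound (mu5 : R) : Prop :=
  forall v w, Vh v -> Vh w ->
    `|bilin v (Ihs w) -
      \sum_(K in tri M) area K * dot (A (bary K) *m gradK K v) (gradK K w)|
      <= mu5 * meshsize * H1norm Om v * H1norm Om w.

Definition bilin_coercive (mu6 : R) : Prop :=
  forall v, Vh v -> mu6 * H1norm Om v ^+ 2 <= bilin v (Ihs v).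

End FiniteVolumes.

Definition quasi_uniform {R : realType} (Th : nat -> mesh R) : Prop :=
  exists2 kappa : R, 0 < kappa &
    forall i K, K \in tri (Th i) ->
      exists c, forall x, eucl_dist c x <= kappa * meshsize (Th i) -> cell K x.

Definition symmetric_elliptic {R : realType} (Om : set (R * R))
    (A : R * R -> 'M[R]_2) (beta0 : R) : Prop :=
  [/\ forall i j, {within closure Om, continuous (fun x => A x i j)},
      forall x, closure Om x -> (A x)^T = A x
    & forall x (xi : 'cV[R]_2), closure Om x ->
        beta0 * dot xi xi <= dot xi (A x *m xi)].

Section L1Scheme.
Context {R : realType}.

Definition Gamma (s : R) : R :=
  \int[lebesgue_measure]_(t in `]0, +oo[) (t `^ (s - 1) * expR (- t)).

Variables (alpha tau : R).

Definition bcoef (k : nat) : R :=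
  k.+1%:R `^ (1 - alpha) - k%:R `^ (1 - alpha).

Definition btilde (n k : nat) : R :=
  if k == n then 1
  else if k == 0%N then n.-1%:R `^ (1 - alpha) - n%:R `^ (1 - alpha)
  else bcoef (n - k) - bcoef (n - k).-1.

Definition Dtau (u : nat -> R * R -> R) (n : nat) : R * R -> R :=
  fun x => tau `^ (- alpha) / Gamma (2 - alpha) *
    \sum_(0 <= k < n.+1) btilde n k * u k x.

Definition scheme (Om : set (R * R)) (M : mesh R) (A : R * R -> 'M[R]_2)
    (q : R * R -> R) (f : R -> R * R -> R) (N : nat)
    (u : nat -> R * R -> R) : Prop :=
  (forall n, (n <= N)%N -> Vh Om M (u n)) /\
  forall n, (0 < n <= N)%N -> forall v, Vh Om M v ->
    ip Om (Dtau u n) (Ihs Om M v) + bilin M A (u n) (Ihs Om M v)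
      + ip Om (fun x => q x * u n x) (Ihs Om M v)
    = ip Om (f (n%:R * tau)) (Ihs Om M v).

(* u is the solution with initial value u 0, i.e. the only one. *)
Definition is_the_solution Om M A q f N u : Prop :=
  scheme Om M A q f N u /\
  forall w, scheme Om M A q f N w -> w 0%N = u 0%N ->
    forall n, (n <= N)%N -> w n = u n.

End L1Scheme.

Definition supL2 {R : realType} (Om : set (R * R)) (T : R)
    (f : R -> R * R -> R) : R :=
  sup [set L2norm Om (f t) | t in `[0, T]].

(* Main.v *)
(* On every triangle the mass form (u, I_h^* v) is one fixed positive definite
   symmetric matrix scaled by the area, so its norm |||.||| is equivalent to the
   L2 norm with absolute constants. The weights -btilde_k^n of the L1 operator
   are nonnegative with sum 1; testing with u^n therefore gives
   |||u^n||| <= sum_k w_k |||u^k||| + (lam |||u^n||| + C F) / c with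
   c = tau^-alpha / Gamma(2 - alpha), and a discrete fractional Gronwall argument
   closes the estimate.
   On fine meshes lam = 0: the form a(v, I_h^* v) dominates the possibly negative
   part of (q v, I_h^* v). Since h tends to 0, only finitely many meshes are
   coarse. On a coarse mesh all forms are bounded with respect to |||.|||, which
   settles small tau; for the remaining finitely many N the assumed uniqueness of
   the solution makes each time step nonsingular on the finite-dimensional space.
   For the H1 bound, test with D_tau u^n. By coercivity on u^n - u^k and the
   approximate symmetry, a(u^n, I_h^* u^k) <= (a_n + a_k) / 2 + O(h) max_j a_j for
   a_k = a(u^k, I_h^* u^k); as c h = O(tau^(1 - alpha)) stays bounded when
   h <= c0 tau, the defect is absorbed by the same Gronwall argument. *)
From HB Require Import structures.
Require Import Defs.
From mathcomp Require Import all_boot all_order all_algebra.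
From mathcomp Require Import all_classical all_reals all_analysis.
From mathcomp Require Import measurable_realfun ring lra.
Import Order.TTheory GRing.Theory Num.Theory.
Import numFieldNormedType.Exports.
Set Implicit Arguments.
Unset Strict Implicit.
Unset Printing Implicit Defensive.
Local Open Scope classical_set_scope.
Local Open Scope ring_scope.

(** * Weights of the L1 operator and discrete Gronwall inequalities *)

(** The Gronwall constants depend on physical time alone: over [m] steps [bcoef a m.-1] decays like
    m^-a, and the factor tau^-a in c compensates, so c times this coefficient is at least (1 - a) /
    (Gamma(2 - a) t^a) once m tau <= t. A perturbation lam is absorbed when t is small, and the time
    interval is covered by about 2 T / t pieces of that length. The reaction term can lose its sign
    because u is paired with I_h^* u; the defect (q u, u - I_h^* u) is O(h) in the gradient, which
    the elliptic form controls. In the H1 estimate the reaction counts as data through part (1), and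
    |||D_tau u^n|||^2, produced by the mass form, absorbs the right-hand side. The mass matrix of a
    triangle has entries 22/108 and 7/108 times the area. They stay unevaluated as ratios of
    integrals over a reference corner, since only symmetry and signs matter. The H1 norm integrates
    classical derivatives that take a default value where they do not exist. It is compared with the
    constant gradients on the triangles in one direction only, which monotonicity of the integral of
    nonnegative functions allows. *)

Lemma bcoef0 (R : realType) (a : R) : a < 1 -> bcoef a 0 = 1.
Proof.
move=> a1; rewrite /bcoef powR0 ?subr0 ?powR1//.
by rewrite subr_eq0 eq_sym lt_eqF.
Qed.

(** The index starts at 1 because the power is not differentiable at 0. *)
Lemma bcoefS_mvt (R : realType) (a : R) (k : nat) : 0 < a < 1 ->
  exists2 x : R, (k.+1%:R < x < k.+2%:R) & bcoef a k.+1 = (1 - a) * x `^ (- a).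
Proof.
move=> /andP[a0 a1].
have k12 : k.+1%:R < k.+2%:R :> R by rewrite ltr_nat.
have [||x] := @MVT R (fun x : R => x `^ (1 - a)) (fun x => (1 - a) * x `^ (1 - a - 1)) _ _ k12.
- move=> x; rewrite in_itv/= => /andP[kx _]; apply: (@is_derive1_powR R).
  by apply: lt_trans kx; rewrite ltr0n.
- apply: derivable_within_continuous => x; rewrite in_itv/= => /andP[kx _].
  apply: (@derivable_powR R); rewrite in_itv/= andbT.
  by apply: lt_le_trans kx; rewrite ltr0n.
rewrite in_itv/= => kx; rewrite /bcoef => ->; exists x => //.
have -> : (k.+2%:R - k.+1%:R : R) = 1 by rewrite -natrB // subSnn.
by rewrite mulr1; congr (_ * _ `^ _); ring.
Qed.

(** The derivative of the power at [k.+1] separates [bcoef a k.+1] from [bcoef a k]: this lower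
    bound also yields the monotonicity in [bcoef_decr]. *)
Lemma bcoef_ge (R : realType) (a : R) (k : nat) : 0 < a < 1 ->
  (1 - a) * k.+1%:R `^ (- a) <= bcoef a k.
Proof.
move=> a01; have /andP[a0 a1] := a01; case: k => [|k].
  by rewrite bcoef0 // powR1 mulr1 gerBl ltW.
have [x /andP[kx xk] ->] := bcoefS_mvt k a01.
have x0 : 0 < x by apply: lt_trans kx; rewrite ltr0n.
rewrite ler_wpM2l ?subr_ge0 ?(ltW a1)// !powRN lef_pV2 ?posrE ?powR_gt0 ?ltr0n//.
by apply: ge0_ler_powR; rewrite ?nnegrE ltW.
Qed.

Lemma bcoef_gt0 (R : realType) (a : R) (k : nat) : 0 < a < 1 -> 0 < bcoef a k.
Proof.
move=> a01; apply: lt_le_trans (bcoef_ge k a01); have /andP[a0 a1] := a01.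
by rewrite mulr_gt0 ?subr_gt0 ?powR_gt0 ?ltr0n.
Qed.

Lemma bcoef_decr (R : realType) (a : R) (k : nat) : 0 < a < 1 ->
  bcoef a k.+1 <= bcoef a k.
Proof.
move=> a01; apply: le_trans (bcoef_ge k a01); have /andP[a0 a1] := a01.
have [x /andP[kx xk] ->] := bcoefS_mvt k a01.
have k0 : 0 < k.+1%:R :> R by rewrite ltr0n.
have x0 : 0 < x := lt_trans k0 kx.
rewrite ler_wpM2l ?subr_ge0 ?(ltW a1)// !powRN lef_pV2 ?posrE ?powR_gt0 ?ltr0n//.
by apply: ge0_ler_powR; rewrite ?nnegrE ltW.
Qed.

Lemma bcoef_anti (R : realType) (a : R) (m n : nat) : 0 < a < 1 ->
  (m <= n)%N -> bcoef a n <= bcoef a m.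
Proof.
move=> a01 mn; rewrite -(subnK mn); elim: (n - m)%N => [|d IH]; rewrite ?add0n//.
by rewrite addSn (le_trans (bcoef_decr _ a01)).
Qed.

Definition l1weight (R : realType) (a : R) (n k : nat) : R := - btilde a n k.

Lemma l1weight0 (R : realType) (a : R) (n : nat) : l1weight a n.+1 0 = bcoef a n.
Proof. by rewrite /l1weight /btilde /bcoef /= opprB. Qed.

Lemma l1weightE (R : realType) (a : R) (n k : nat) : (0 < k < n)%N ->
  l1weight a n k = bcoef a (n - k).-1 - bcoef a (n - k).
Proof.
move=> /andP[k0 kn]; rewrite /l1weight /btilde ltn_eqF// gtn_eqF//.
by rewrite opprB.
Qed.

Lemma l1weight_ge0 (R : realType) (a : R) (n k : nat) : 0 < a < 1 ->
  (k < n)%N -> 0 <= l1weight a n k.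
Proof.
move=> a01; case: n => // n; case: k => [_|k kn].
  by rewrite l1weight0 ltW ?bcoef_gt0.
rewrite l1weightE// subSS subr_ge0; apply: bcoef_anti => //.
by rewrite leq_pred.
Qed.

(** The sum telescopes. It measures how much of the average at step [n] is taken over the steps up
    to [j], the quantity on which the Gronwall argument rests. *)
Lemma sum_l1weight (R : realType) (a : R) (n j : nat) : (j < n)%N ->
  \sum_(k < j.+1) l1weight a n k = bcoef a (n - j.+1).
Proof.
case: n => // n; elim: j => [_|j IH jn].
  by rewrite big_ord1 l1weight0 subSS subn0.
rewrite big_ord_recr/= IH; last exact: ltn_trans jn.
rewrite l1weightE ?jn// !subSS.
by rewrite subnS addrC subrK.
Qed.

Lemma sum_l1weight_all (R : realType) (a : R) (n : nat) : a < 1 -> (0 < n)%N ->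
  \sum_(k < n) l1weight a n k = 1.
Proof. by case: n => // n a1 _; rewrite sum_l1weight// subnn bcoef0. Qed.

(* Split the steps into windows of length [m]: the weights of the steps before
   the current window add up to at least [bcoef a m.-1], which absorbs the term
   [lam * Q]; each window multiplies the bound by at most 4. *)
Lemma l1_gronwall (R : realType) (a c lam F : R) (m N : nat) (phi : nat -> R) :
  0 < a < 1 -> 0 < c -> 0 <= lam -> 0 <= F -> (0 < m)%N ->
  2 * lam <= c * bcoef a m.-1 ->
  (forall n, 0 <= phi n) ->
  (forall n Q, (0 < n <= N)%N -> (forall k, (k <= n)%N -> phi k <= Q) ->
    phi n <= \sum_(k < n) l1weight a n k * phi k + (lam * Q + F) / c) ->
  forall j n, (n <= N)%N -> (n <= j * m)%N ->
    phi n <= 4 ^+ j * (phi 0%N + F / (c * bcoef a m.-1)).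
Proof.
move=> a01 c0 lam0 F0 m0 hlam phi0 hphi; have /andP[a0 a1] := a01.
have bm0 := bcoef_gt0 m.-1 a01.
set X := phi 0%N + _.
have FX : F / (c * bcoef a m.-1) <= X by rewrite lerDr.
have cb0 : 0 < c * bcoef a m.-1 by rewrite mulr_gt0.
have X0 : 0 <= X by apply: addr_ge0 => //; rewrite divr_ge0// ltW.
elim=> [n _|j IH].
  by rewrite mul0n leqn0 => /eqP->; rewrite expr0 mul1r lerDl divr_ge0// ltW.
set P := 4 ^+ j * X; have XP : X <= P by apply: ler_peMl => //; rewrite exprn_ege1// ler1n.
have -> : 4 ^+ j.+1 * X = 4 * P by rewrite exprS mulrA.
have P0 : 0 <= P by apply: le_trans XP.
elim/ltn_ind => n IHn nN njm.
have [njm'|jmn] := leqP n (j * m)%N.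
  by apply: le_trans (IH n nN njm') _; rewrite ler_peMl ?ler1n.
have n0 : (0 < n)%N by apply: leq_ltn_trans jmn.
(* If [phi n] exceeded [4 * P], it would be the largest value so far, and the recursion could be
   used with [Q := phi n]. *)
apply/negP => /negP; rewrite -ltNge => Qphi.
have small k : (k < n)%N -> phi k <= 4 * P.
  by move=> kn; apply: IHn => //; [exact: leq_trans (ltnW kn) nN|exact: leq_trans (ltnW kn) njm].
have jn : (j * m <= n.-1)%N by rewrite -ltnS prednK.
pose b := bcoef a (n - (j * m).+1).
have bmb : bcoef a m.-1 <= b.
  apply: bcoef_anti => //; rewrite subnS.
  rewrite -!subn1 leq_sub2r// leq_subLR (leq_trans njm)// mulSn addnC//.
have b0 : 0 < b by apply: lt_le_trans bmb.
have b1 : b <= 1 by rewrite -(bcoef0 a1); apply: bcoef_anti.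
(* Steps up to [j * m] have total weight [b] and are bounded by [P]; those inside the window are
   bounded by [4 * P]. *)
have sumw : \sum_(k < n) l1weight a n k * phi k <= b * P + (1 - b) * (4 * P).
  have -> : b * P + (1 - b) * (4 * P) =
     \sum_(k < n) l1weight a n k * (if (k <= j * m)%N then P else 4 * P).
    transitivity (\sum_(k < n) l1weight a n k * (4 * P) -
        \sum_(k < n | (k < (j * m).+1)%N) l1weight a n k * (3 * P)).
      rewrite -!mulr_suml (sum_l1weight_all a1 n0).
      rewrite -(big_ord_widen n (l1weight a n)) // sum_l1weight// -/b; ring.
    rewrite [X in _ - X]big_mkcond/= -sumrB; apply: eq_bigr => k _.
    by rewrite ltnS; case: ifP => _; ring.
  apply: ler_sum => k _; rewrite ler_wpM2l ?l1weight_ge0//.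
  case: ifP => kjm; last exact: small.
  by apply: IH => //; exact: leq_trans (ltnW (ltn_ord k)) nN.
have := hphi n (phi n); rewrite n0 nN => /(_ isT).
have -> : (lam * phi n + F) / c = (lam * phi n) / c + F / c by rewrite mulrDl.
move=> H; have {}H : phi n <= b * P + (1 - b) * (4 * P) + (lam * phi n / c + F / c).
  apply: le_trans (H _) _; last by rewrite lerD2r.
  move=> k; rewrite leq_eqVlt => /predU1P[->//|/small kn].
  exact: le_trans kn (ltW Qphi).
have lc : lam / c <= b / 2.
  rewrite ler_pdivrMr// mulrAC ler_pdivlMr// mulrC (le_trans hlam)// mulrC.
  by rewrite ler_pM2r.
have h1 : lam * phi n / c <= b / 2 * phi n.
  by rewrite mulrAC ler_wpM2r.
have h2 : F / c <= b * P.
  apply: le_trans (_ : b * X <= _); last by rewrite ler_wpM2l ?(ltW b0).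
  apply: le_trans (_ : b * (F / (c * bcoef a m.-1)) <= _); last first.
    by rewrite ler_wpM2l ?(ltW b0).
  have -> : b * (F / (c * bcoef a m.-1)) = (F / c) * (b / bcoef a m.-1).
    by rewrite invfM; ring.
  by rewrite ler_peMr ?divr_ge0 ?(ltW c0)// ler_pdivlMr// mul1r.
(* The bounds add up to [phi n * (1 - b / 2) <= 4 * P * (1 - b / 2)] with [b <= 1]; this balance
   dictates the factor 4. *)
nra.
Qed.

(** The right-hand side is a multiple of the exponential density of rate 1/2, whose integrability is
    known. *)
Lemma Gamma_integrand_bound (R : realType) (a t : R) : 0 < a < 1 -> 0 < t ->
  t `^ (2 - a - 1) * expR (- t) <= 4 * (2^-1 * expR (- (2^-1 * t))).
Proof.
move=> /andP[a0 a1] t0.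
have tp : t `^ (2 - a - 1) <= 1 + t.
  have [t1|t1] := leP 1 t.
    apply: le_trans (ler_powR t1 (_ : _ <= 1)) _; first by lra.
    by rewrite powRr1 ?ltW//; lra.
  apply: le_trans (_ : 1 <= _); last by lra.
  rewrite -[leRHS](powRr0 t); apply: ger_powR; last by lra.
  by rewrite t0 ltW.
have te : 1 + t / 2 <= expR (t / 2) by apply: expR_ge1Dx.
have -> : expR (- t) = expR (- (t / 2)) * expR (- (t / 2)).
  by rewrite -expRD; congr expR; lra.
have -> : - (2^-1 * t) = - (t / 2) by lra.
have e0 : 0 < expR (- (t / 2)) := expR_gt0 _.
have ee : expR (t / 2) * expR (- (t / 2)) = 1 by rewrite expRN divff// expR_eq0.
have h1 : t `^ (2 - a - 1) * expR (- (t / 2)) <= 2.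
  apply: le_trans (_ : 2 * (expR (t / 2) * expR (- (t / 2))) <= _); last by rewrite ee mulr1.
  by rewrite mulrA ler_wpM2r ?(ltW e0)//; lra.
by rewrite mulrA; nra.
Qed.

(** The real-valued integral sends an infinite value to 0, so positivity requires integrability
    besides a lower bound, here taken on the interval from 1 to 2. *)
Lemma Gamma_gt0 (R : realType) (a : R) : 0 < a < 1 -> 0 < Gamma (2 - a).
Proof.
move=> a01; have /andP[a0 a1] := a01.
pose g (t : R) : R := t `^ (2 - a - 1) * expR (- t).
have mg : measurable_fun [set: R] g.
  apply: measurable_funM; first exact: measurable_powR.
  by apply: measurableT_comp => //; exact: oppr_measurable.
have g0 t : 0 <= g t by rewrite mulr_ge0 ?powR_ge0 ?expR_ge0.
have ig : lebesgue_measure.-integrable `]0, +oo[ (EFin \o g).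
  have ie := @integrable_exponential_pdf R 2^-1 ltac:(by rewrite invr_gt0).
  have ie' : lebesgue_measure.-integrable `]0, +oo[
      (EFin \o (fun t => 4 * exponential_pdf (2^-1 : R) t)).
    rewrite (_ : _ \o _ = (fun t => 4%:E * (EFin \o exponential_pdf 2^-1) t)%E); last first.
      by apply/funext => t /=; rewrite EFinM.
    apply: integrableZl => //.
    exact: integrableS ie.
  apply: le_integrable ie' => //.
    by apply/measurable_EFinP; exact: measurable_funS mg.
  move=> t /=; rewrite in_itv/= andbT => t0.
  rewrite lee_fin ger0_norm// ger0_norm; last first.
    by rewrite mulr_ge0// exponential_pdf_ge0// invr_ge0.
  rewrite exponential_pdfE ?(ltW t0)//= mulNr.
  exact: Gamma_integrand_bound.
have fg : (\int[lebesgue_measure]_(t in `]0%R, +oo[) (g t)%:E)%E \is a fin_num.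
  exact: integrable_fin_num ig.
rewrite /Gamma /Rintegral; apply: fine_gt0; apply/andP; split; last first.
  by move: fg; rewrite ge0_fin_numE//; apply: integral_ge0 => t _; rewrite lee_fin.
have e0 : 0 < expR (- 2) :> R := expR_gt0 _.
apply: (@lt_le_trans _ _ (\int[lebesgue_measure]_(t in `[1%R, 2%R]) (cst (expR (- 2))%:E t))%E).
  rewrite integral_cst//= lebesgue_measure_itv/= lte_fin ltr1n -EFinD -EFinM lte_fin.
  by rewrite mulr_gt0// subr_gt0 ltr1n.
apply: (@le_trans _ _ (\int[lebesgue_measure]_(t in `[1%R, 2%R]) (g t)%:E)%E); last first.
  apply: ge0_subset_integral => //=.
  - by apply/measurable_EFinP; exact: measurable_funS mg.
  - by move=> t _; rewrite lee_fin.
  - by move=> t /=; rewrite !in_itv/= andbT => /andP[t1 _]; apply: lt_le_trans t1.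
apply: ge0_le_integral => //=.
- by apply/measurable_EFinP; exact: measurable_funS mg.
- move=> t; rewrite in_itv/= => /andP[t1 t2]; rewrite lee_fin /g.
  rewrite -[leLHS]mul1r ler_pM ?expR_ge0 ?ler_expR ?lerN2//.
  rewrite -[leLHS](powRr0 t); apply: ler_powR => //; lra.
Qed.

(** The decay [m^-a] of the coefficient and the factor [tau^-a] combine into [(m * tau)^-a]: only
    the duration of the window enters. *)
Lemma l1_window (R : realType) (a G tau t : R) (m : nat) :
  0 < a < 1 -> 0 < G -> 0 < tau -> (0 < m)%N -> m%:R * tau <= t ->
  (tau `^ (- a) / G * bcoef a m.-1)^-1 <= G * t `^ a / (1 - a).
Proof.
move=> a01 G0 tau0; case: m => // m _ mt /=; have /andP[a0 a1] := a01.
have m0 : 0 < m.+1%:R :> R by rewrite ltr0n.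
have t0 : 0 < t by apply: lt_le_trans mt; rewrite mulr_gt0.
have ta := powR_gt0 a tau0; have tta := powR_gt0 a t0; have ma := powR_gt0 a m0.
have a10 : 0 < 1 - a by lra.
have b0 := bcoef_gt0 m a01.
rewrite powRN; set b := bcoef a m.
have hb : (1 - a) <= m.+1%:R `^ a * b.
  by have := bcoef_ge m a01; rewrite powRN ler_pdivrMr// mulrC.
have htt : m.+1%:R `^ a * tau `^ a <= t `^ a.
  rewrite -powRM ?(ltW m0) ?(ltW tau0)//; apply: ge0_ler_powR.
  all: rewrite ?nnegrE ?(ltW a0) ?(ltW t0)//.
  by rewrite ltW// mulr_gt0.
rewrite ler_pdivlMr// invfM invf_div invrK mulrAC ler_pdivrMr// mulrC mulrCA.
rewrite -mulrA ler_pM2l// mulrC.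
apply: le_trans (_ : tau `^ a * (m.+1%:R `^ a * b) <= _); first by rewrite ler_pM2l.
by rewrite mulrA ler_pM2r// mulrC.
Qed.

(** Without the perturbation [lam] a single window contains all the steps, whence the factor 4. *)
Lemma l1_stability (R : realType) (a G T F : R) (N : nat) (phi : nat -> R) :
  0 < a < 1 -> 0 < G -> 0 < T -> (0 < N)%N -> 0 <= F ->
  (forall n, 0 <= phi n) ->
  (forall n, (0 < n <= N)%N ->
    phi n <= \sum_(k < n) l1weight a n k * phi k + F / ((T / N%:R) `^ (- a) / G)) ->
  forall n, (n <= N)%N -> phi n <= 4 * (phi 0%N + F * (G * T `^ a / (1 - a))).
Proof.
move=> a01 G0 T0 N0 F0 phi0 hphi n nN.
have tau0 : 0 < T / N%:R by rewrite divr_gt0// ltr0n.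
have c0 : 0 < (T / N%:R) `^ (- a) / G by rewrite divr_gt0 ?powR_gt0.
apply: le_trans (l1_gronwall (j := 1) a01 c0 (lexx 0) F0 N0 _ phi0 _ nN _) _.
- by rewrite mulr0 mulr_ge0 ?(ltW c0) ?ltW ?bcoef_gt0.
- by move=> k Q kN _; rewrite mul0r add0r; exact: hphi.
- by rewrite mul1n.
rewrite expr1 ler_pM2l// lerD2l ler_wpM2l//; apply: l1_window => //.
by rewrite mulrC divfK// pnatr_eq0 -lt0n.
Qed.

Lemma l1_gronwall_uniform (R : realType) (a G T lam : R) :
  0 < a < 1 -> 0 < G -> 0 < T -> 0 < lam ->
  exists C ts : R, [/\ 0 < C, 0 < ts & forall (N : nat) (F : R) (phi : nat -> R),
    (0 < N)%N -> T / N%:R <= ts -> 0 <= F -> (forall n, 0 <= phi n) ->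
    (forall n Q, (0 < n <= N)%N -> (forall k, (k <= n)%N -> phi k <= Q) ->
      phi n <= \sum_(k < n) l1weight a n k * phi k +
        (lam * Q + F) / ((T / N%:R) `^ (- a) / G)) ->
    forall n, (n <= N)%N -> phi n <= C * (phi 0%N + F)].
Proof.
move=> a01 G0 T0 lam0; have /andP[a0 a1] := a01.
have a10 : 0 < 1 - a by lra.
pose x := (1 - a) / (2 * lam * G).
have x0 : 0 < x by rewrite divr_gt0// !mulr_gt0.
pose ts := x `^ a^-1.
have ts0 : 0 < ts by rewrite powR_gt0.
have tsa : ts `^ a = x by rewrite -powRrM mulVf ?gt_eqF// powRr1// ltW.
pose K := G * ts `^ a / (1 - a).
have KE : K = (2 * lam)^-1.
  by rewrite /K tsa /x; field; rewrite ?gt_eqF.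
have K0 : 0 < K by rewrite KE invr_gt0 mulr_gt0.
(* A window of [m] steps lasts more than [ts / 2], because [m >= 1] is the integer part of
   [ts / tau]; hence [j] windows suffice for every [N]. *)
pose j := (Num.truncn (2 * T / ts)).+1.
exists (4 ^+ j * (1 + K)), ts; split=> //.
  by rewrite mulr_gt0 ?exprn_gt0// addr_gt0.
move=> N F phi N0 tauts F0 phi0 hphi n nN.
set tau := T / N%:R in tauts hphi.
have N0' : 0 < N%:R :> R by rewrite ltr0n.
have tau0 : 0 < tau by rewrite divr_gt0.
pose m := Num.truncn (ts / tau).
have /andP[m1 m2] : (m%:R <= ts / tau < m.+1%:R).
  by apply: truncn_itv; rewrite divr_ge0// ltW.
have m0 : (0 < m)%N.
  rewrite -ltnS -(@ltr_nat R); apply: le_lt_trans m2.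
  by rewrite ler_pdivlMr// mul1r.
have c0 : 0 < tau `^ (- a) / G by rewrite divr_gt0 ?powR_gt0.
have w : (tau `^ (- a) / G * bcoef a m.-1)^-1 <= K.
  by apply: l1_window => //; rewrite -ler_pdivlMr.
have cb0 : 0 < tau `^ (- a) / G * bcoef a m.-1 by rewrite mulr_gt0 ?bcoef_gt0.
have Njm : (N <= j * m)%N.
  have /andP[_ j2] : ((Num.truncn (2 * T / ts))%:R <= 2 * T / ts < j%:R).
    by apply: truncn_itv; rewrite divr_ge0 ?mulr_ge0// ltW.
  rewrite -(@ler_nat R) natrM.
  have m1' : 1 <= m%:R :> R by rewrite ler1n.
  have NE : N%:R = T / tau by rewrite /tau; field; rewrite !gt_eqF.
  have tsm : ts / tau < 2 * m%:R by move: m2; rewrite -addn1 natrD; lra.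
  have h : 2 * T < j%:R * ts by rewrite -ltr_pdivrMr.
  have h2 : ts < 2 * m%:R * tau by rewrite -ltr_pdivrMr.
  rewrite NE ler_pdivrMr//.
  have j0 : 0 < j%:R :> R by rewrite ltr0n.
  have : j%:R * ts < j%:R * (2 * m%:R * tau) by rewrite ltr_pM2l.
  nra.
apply: le_trans (l1_gronwall a01 c0 (ltW lam0) F0 m0 _ phi0 hphi nN (leq_trans nN Njm)) _.
  have l2 : 0 < 2 * lam by rewrite mulr_gt0.
  by move: w; rewrite KE lef_pV2.
rewrite -[leRHS]mulrA ler_wpM2l ?exprn_ge0//.
have p0 := phi0 0%N.
have FK : F / (tau `^ (- a) / G * bcoef a m.-1) <= F * K by rewrite ler_wpM2l.
nra.
Qed.

(** * Planar Lebesgue measure under affine maps *)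

(** The scaled image measure agrees with Lebesgue measure on half-open intervals, which determine
    it. A negative slope moves the closed end to the other side. *)
Lemma lebesgue_measure_affine (R : realType) (d e : R) (A : set (measurableTypeR R)) :
  d != 0 -> measurable A ->
  (`|d|%:E * lebesgue_measure
     ((fun y : measurableTypeR R => ((d * y + e)%R : measurableTypeR R)) @^-1` A) =
   lebesgue_measure A)%E.
Proof.
move=> d0 mA; pose g (y : measurableTypeR R) : measurableTypeR R := (d * y + e)%R.
rewrite -[X in (_ * lebesgue_measure (X @^-1` A))%E]/g.
have mg : measurable_fun [set: measurableTypeR R] g.
  by apply: measurable_funD => //; apply: measurable_funM.
pose m' : {measure set (measurableTypeR R) -> \bar R} :=
  mscale (NngNum (normr_ge0 d))
    (measure_function_pushforward__canonical__measure_function_Measure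
      (@lebesgue_measure R) mg).
have -> : (`|d|%:E * lebesgue_measure (g @^-1` A) = m' A)%E by [].
apply/esym/lebesgue_measure_unique => // X [[a b] _ <-].
rewrite /m' /= /mscale/= /pushforward/= lebesgue_measure_itv/= lte_fin.
have [dp|dn|/eqP] := ltgtP 0 d; last by rewrite eq_sym (negPf d0).
- have -> : g @^-1` `]a, b] = `](a - e) / d, (b - e) / d]%classic.
    apply/seteqP; split => y; rewrite /= !in_itv/= /g.
      by rewrite ltr_pdivrMr// ler_pdivlMr// mulrC ltrBlDr lerBrDr.
    by rewrite ltr_pdivrMr// ler_pdivlMr// mulrC ltrBlDr lerBrDr.
  rewrite lebesgue_measure_itv/= lte_fin ltr_pM2r ?invr_gt0// ltrD2r.
  case: ifPn => _; last by rewrite mule0.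
  rewrite -EFinD -EFinD -EFinM gtr0_norm//; congr EFin; field.
  by rewrite gt_eqF.
- have -> : g @^-1` `]a, b] = `[(b - e) / d, (a - e) / d[%classic.
    apply/seteqP; split => y; rewrite /= !in_itv/= /g.
      by rewrite ltr_ndivlMr// ler_ndivrMr// mulrC ltrBlDr lerBrDr andbC.
    by rewrite ltr_ndivlMr// ler_ndivrMr// mulrC ltrBlDr lerBrDr andbC.
  rewrite lebesgue_measure_itv/= lte_fin ltr_nM2r ?invr_lt0// ltrD2r.
  case: ifPn => _; last by rewrite mule0.
  rewrite -EFinD -EFinD -EFinM ltr0_norm//; congr EFin; field.
  by rewrite lt_eqF.
Qed.

Section PlaneMeasure.
Context {R : realType}.
Local Notation P := (measurableTypeR R * measurableTypeR R)%type.

HB.instance Definition _ := Measure.copy (@mu2 R)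
  ((@lebesgue_measure R) \x (@lebesgue_measure R))%E.

Definition affine_map (a b e c d e' : R) (x : P) : P :=
  (a * x.1 + b * x.2 + e, c * x.1 + d * x.2 + e').

Lemma measurable_affine_form (a b e : R) :
  measurable_fun [set: P] (fun x : P => a * x.1 + b * x.2 + e : measurableTypeR R).
Proof.
apply: measurable_funD => //; apply: measurable_funD.
  by apply: measurable_funM => //; exact: measurable_fst.
by apply: measurable_funM => //; exact: measurable_snd.
Qed.

Lemma measurable_affine_map a b e c d e' :
  measurable_fun [set: P] (affine_map a b e c d e').
Proof. by apply: measurable_fun_pair; exact: measurable_affine_form. Qed.

Lemma measurable_affine_preimage a b e c d e' (A : set P) : measurable A ->
  measurable (affine_map a b e c d e' @^-1` A).
Proof. by move=> mA; rewrite -[X in measurable X]setTI; exact: measurable_affine_map. Qed.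

Lemma mu2_shear (a d e : R) (A : set P) : d != 0 -> measurable A ->
  (`|d|%:E * mu2 (affine_map 1 0 0 a d e @^-1` A) = mu2 A)%E.
Proof.
move=> d0 mA; rewrite /mu2 /product_measure1 -ge0_integralZl//; last first.
  by apply: measurable_fun_xsection; exact: measurable_affine_preimage.
apply: eq_integral => x _ /=.
have -> : xsection (affine_map 1 0 0 a d e @^-1` A) x =
    (fun y : measurableTypeR R => d * y + (a * x + e) : measurableTypeR R)
      @^-1` (xsection A x).
  apply/seteqP; split => y; rewrite /xsection/= !inE /affine_map/= mul1r mul0r !addr0;
  by rewrite [_ * y + _]addrC addrAC.
by rewrite lebesgue_measure_affine//; exact: measurable_xsection.
Qed.

Lemma mu2_swap (A : set P) : measurable A ->
  mu2 (affine_map 0 1 0 1 0 0 @^-1` A) = mu2 A.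
Proof.
move=> mA; rewrite /mu2 [RHS](@product_measure_unique _ _ _ _ _ _ _
  (lebesgue_measure \x^ lebesgue_measure)%E)//; last first.
  by move=> B C mB mC; exact: (@product_measure2E _ _ _ _ R lebesgue_measure lebesgue_measure B C).
rewrite /product_measure1 /product_measure2; apply: eq_integral => x _ /=.
congr lebesgue_measure; apply/seteqP; split => y;
by rewrite /xsection /ysection/= !inE /affine_map/= !mul1r !mul0r !addr0 add0r.
Qed.

(* Factor the map into a shear, the swap of the coordinates and a shear. *)
Lemma mu2_affine_neq0 (a b e c d e' : R) (A : set P) : b != 0 -> a * d - b * c != 0 ->
  measurable A ->
  (`|a * d - b * c|%:E * mu2 (affine_map a b e c d e' @^-1` A) = mu2 A)%E.
Proof.
move=> b0 D0 mA.
pose q := (b * c - a * d) / b.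
have q0 : q != 0 by rewrite mulf_neq0 ?invr_eq0// -oppr_eq0 opprB.
pose g2 := affine_map 1 0 0 (d / b) q (e' - d * e / b).
have -> : affine_map a b e c d e' @^-1` A =
   affine_map 1 0 0 a b e @^-1` (affine_map 0 1 0 1 0 0 @^-1` (g2 @^-1` A)).
  have E : affine_map a b e c d e' =
      g2 \o (affine_map 0 1 0 1 0 0 \o affine_map 1 0 0 a b e).
    by apply/funext => x; rewrite /g2 /affine_map /q/=; congr pair; [ring|field].
  by rewrite E.
have -> : `|a * d - b * c| = `|q| * `|b|.
  by rewrite -normrM /q divfK// distrC.
rewrite EFinM -muleA mu2_shear//; last first.
  by apply: measurable_affine_preimage; exact: measurable_affine_preimage.
rewrite mu2_swap; last exact: measurable_affine_preimage.
exact: mu2_shear.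
Qed.

(** If [b = 0] then [a != 0], and the swap of the coordinates exchanges the columns of the
    matrix. *)
Lemma mu2_affine (a b e c d e' : R) (A : set P) : a * d - b * c != 0 -> measurable A ->
  (`|a * d - b * c|%:E * mu2 (affine_map a b e c d e' @^-1` A) = mu2 A)%E.
Proof.
move=> D0 mA; have [b0|] := eqVneq b 0; last by move=> b0; exact: mu2_affine_neq0.
have a0 : a != 0 by apply: contraNneq D0 => ->; rewrite b0 !mul0r subr0.
rewrite -(@mu2_affine_neq0 b a e d c e' A)//; last first.
  by rewrite -oppr_eq0 opprB.
rewrite [in RHS]distrC; congr (_ * _)%E.
rewrite -[LHS]mu2_swap; last exact: measurable_affine_preimage.
have E : affine_map b a e d c e' = affine_map a b e c d e' \o affine_map 0 1 0 1 0 0.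
  by apply/funext => x; rewrite /affine_map/=; congr pair; ring.
by rewrite E.
Qed.

Lemma integral_affine (a b e c d e' : R) (D : set P) (f : P -> \bar R) :
  a * d - b * c != 0 -> measurable D -> measurable_fun D f ->
  (forall x, D x -> 0 <= f x)%E ->
  (`|a * d - b * c|%:E *
    \int[mu2]_(x in affine_map a b e c d e' @^-1` D) f (affine_map a b e c d e' x) =
    \int[mu2]_(x in D) f x)%E.
Proof.
move=> D0 mD mf f0; set T := affine_map _ _ _ _ _ _.
have mT := measurable_affine_map a b e c d e'.
rewrite -(@ge0_integral_pushforward _ _ _ _ R T mT mu2 D f)//; last first.
  by move=> x; rewrite inE; exact: f0.
rewrite -(@ge0_integral_mscale _ _ R
  (measure_function_pushforward__canonical__measure_function_Measure (@mu2 R) mT)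
  D mD (NngNum (normr_ge0 (a * d - b * c))) f)//.
by apply: eq_measure_integral => A mA _; exact: mu2_affine.
Qed.

Lemma mu2_line (a b c : R) : (a != 0) || (b != 0) ->
  mu2 [set x : P | a * x.1 + b * x.2 = c] = 0.
Proof.
move=> ab.
(* The map with rows [(a, b)] and [(- b, a)] has determinant a^2 + b^2 and carries the line to the
   vertical axis. *)
have D0 : a * a - b * - b != 0.
  by rewrite mulrN opprK -!expr2 paddr_eq0 ?sqr_ge0// !sqrf_eq0 negb_and.
have -> : [set x : P | a * x.1 + b * x.2 = c] =
    affine_map a b (- c) (- b) a 0 @^-1` ([set 0] `*` setT).
  apply/seteqP; split => x; rewrite /affine_map/=.
    by move=> ->; rewrite subrr.
  by case=> /eqP; rewrite subr_eq0 => /eqP.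
have m0 : measurable ([set 0] `*` setT : set P) by exact: measurableX.
have := @mu2_affine a b (- c) (- b) a 0 _ D0 m0.
have -> : mu2 ([set 0] `*` setT : set P) = 0%E.
  transitivity (lebesgue_measure ([set (0 : R)%R]) *
      lebesgue_measure [set: measurableTypeR R])%E; first exact: product_measure1E.
  by rewrite lebesgue_measure_set1 mul0e.
move=> /eqP.
by rewrite mule_eq0 eqe normr_eq0 (negPf D0) => /eqP.
Qed.

(** Measurability refers to the product sigma-algebra, so an open set is written as a countable
    union of boxes with rational centre and radius [n.+1%:R^-1]. *)
Lemma open_measurable_plane (A : set P) : open (A : set (R * R)) -> measurable A.
Proof.
move=> oA.
pose box (k : rat * rat * nat) : set P :=
  [set x : P | ball (ratr k.1.1 : R) k.2.+1%:R^-1 x.1 /\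
               ball (ratr k.1.2 : R) k.2.+1%:R^-1 x.2].
have mbox k : measurable (box k).
  rewrite (_ : box k = ball (ratr k.1.1 : R) k.2.+1%:R^-1 `*`
    ball (ratr k.1.2 : R) k.2.+1%:R^-1)//.
  by apply: measurableX; exact: measurable_ball.
have -> : A = \bigcup_k (if `[< box k `<=` A >] then box k else set0).
  apply/seteqP; split => x; last first.
    by move=> [k _]; case: asboolP => // h; exact: h.
  move=> Ax; have /nbhs_ballP[r /= r0 rA] : nbhs (x : R * R) A by exact: open_nbhs_nbhs.
  have [n n2] : exists n : nat, n.+1%:R^-1 < r / 2.
    pose n := Num.truncn (2 / r); exists n.
    have /andP[_ n2] : (n%:R <= 2 / r < n.+1%:R).
      by apply: truncn_itv; rewrite divr_ge0// ltW.
    rewrite -[ltRHS]invrK ltf_pV2 ?posrE ?invr_gt0 ?divr_gt0// ?ltr0n//.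
    by rewrite invf_div.
  have n0 : 0 < n.+1%:R^-1 :> R by rewrite invr_gt0 ltr0n.
  have n3 : n.+1%:R^-1 + n.+1%:R^-1 <= r by rewrite [leRHS]splitr lerD// ltW.
  have hq (y : R) : exists q : rat, ball (ratr q : R) n.+1%:R^-1 y.
    have [|q] := @rat_in_itvoo R (y - n.+1%:R^-1) (y + n.+1%:R^-1).
      by rewrite ltrBlDr -addrA ltrDl addr_gt0.
    rewrite in_itv/= => /andP[h1 h2]; exists q.
    by rewrite /ball/= ltr_distl h1 h2.
  have [q1 hq1] := hq x.1; have [q2 hq2] := hq x.2.
  exists (q1, q2, n) => //=; case: asboolP => [_|]; first by split.
  case=> y [/= y1 y2]; apply: rA; split => /=.
    exact: le_ball n3 _ (ball_triangle (ball_sym hq1) y1).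
  exact: le_ball n3 _ (ball_triangle (ball_sym hq2) y2).
apply: countable_bigcupT_measurable => // k; case: asboolP => // _; exact: measurable0.
Qed.

Lemma continuous_measurable_plane (D : set P) (f : P -> R) :
  open (D : set (R * R)) -> {in D, continuous (f : R * R -> R)} ->
  measurable_fun D f.
Proof.
move=> oD cf; apply: (measurability _ (RGenOpens.measurableE R)).
move=> _ [_ [a [b ->] <-]]; apply: open_measurable_plane.
have [/(_ cf) H _] := @continuous_inP (R * R)%type R D f oD.
by apply: H; exact: interval_open.
Qed.

End PlaneMeasure.

(** * Linear structure of the trial space *)

Section LinearStructure.
Context {R : realType}.
Implicit Types (v w : R * R -> R) (Om : set (R * R)).

Definition lin (a b : R) v w : R * R -> R := fun x => a * v x + b * w x.

Lemma derive1_lin (a b : R) (f g : R -> R) (t : R) :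
  derivable f t 1 -> derivable g t 1 ->
  derivable (fun s => a * f s + b * g s) t 1 /\
  derive1 (fun s => a * f s + b * g s) t = a * derive1 f t + b * derive1 g t.
Proof.
move=> df dg.
have Hf : is_derive t 1 f (derive1 f t) by rewrite derive1E; exact: derivableP.
have Hg : is_derive t 1 g (derive1 g t) by rewrite derive1E; exact: derivableP.
have H : is_derive t 1 (a \*: f + b \*: g) (a *: derive1 f t + b *: derive1 g t).
  exact: is_deriveD.
have E : (fun s => a * f s + b * g s) = a \*: f + b \*: g by apply/funext.
by rewrite E; split; [exact: ex_derive|rewrite [LHS]derive1E; exact: derive_val].
Qed.

Lemma smooth_lin (a b : R) v w : smooth v -> smooth w -> smooth (lin a b v w).
Proof.
move=> sv sw s /=.
pose F (u : R * R -> R) s := foldr (fun (b : bool) g => if b then d1 g else d2 g) u s.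
have E : F (lin a b v w) s = lin a b (F v s) (F w s).
  elim: s => // c s IH; rewrite /F /= -!/(F _ _) IH.
  have [cv dv1 dv2] := sv s; have [cw dw1 dw2] := sw s.
  apply/funext => x; case: c.
    by have [_] := derive1_lin a b (dv1 x) (dw1 x).
  by have [_] := derive1_lin a b (dv2 x) (dw2 x).
rewrite -/(F _ _) E; have [cv dv1 dv2] := sv s; have [cw dw1 dw2] := sw s; split.
- move=> x; apply: cvgD; apply: cvgM; [exact: cvg_cst|exact: cv|exact: cvg_cst|exact: cw].
- by move=> x; have [] := derive1_lin a b (dv1 x) (dw1 x).
- by move=> x; have [] := derive1_lin a b (dv2 x) (dw2 x).
Qed.

Lemma test_function_lin (a b : R) Om v w :
  test_function Om v -> test_function Om w -> test_function Om (lin a b v w).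
Proof.
move=> [sv [E [cE EO Ev]]] [sw [F [cF FO Fw]]]; split; first exact: smooth_lin.
exists (E `|` F); split; first exact: compactU.
  by move=> x [/EO|/FO].
by move=> x /not_orP[nE nF]; rewrite /lin Ev// Fw// !mulr0 addr0.
Qed.

(** From (x + y)^2 <= 2 x^2 + 2 y^2. This crude bound is enough to make square integrability and L2
    convergence stable under linear combinations. *)
Lemma integral_sqr_lin (a b : R) Om v w : measurable Om ->
  measurable_fun Om v -> measurable_fun Om w ->
  (\int[mu2]_(x in Om) ((a * v x + b * w x) ^+ 2)%:E <=
   (2 * a ^+ 2)%:E * \int[mu2]_(x in Om) ((v x) ^+ 2)%:E +
   (2 * b ^+ 2)%:E * \int[mu2]_(x in Om) ((w x) ^+ 2)%:E)%E.
Proof.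
move=> mO mv mw.
have m2 (u : R * R -> R) : measurable_fun Om u ->
    measurable_fun Om (fun x => ((u x) ^+ 2)%:E).
  by move=> mu; apply/measurable_EFinP; exact: measurable_funX.
have k0 (c : R) : 0 <= 2 * c ^+ 2 by rewrite mulr_ge0 ?sqr_ge0.
rewrite -!ge0_integralZl//; try (by move=> *; rewrite lee_fin sqr_ge0);
  try exact: m2.
have mm (c : R) (u : R * R -> R) : measurable_fun Om u ->
    measurable_fun Om (fun x => (2 * c ^+ 2)%:E * ((u x) ^+ 2)%:E)%E.
  by move=> mu; apply: measurable_funeM; exact: m2.
rewrite -ge0_integralD//; try exact: mm;
  try (by move=> *; rewrite mule_ge0// lee_fin ?sqr_ge0 ?k0).
apply: ge0_le_integral => //.
- by move=> x _; rewrite lee_fin sqr_ge0.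
- by apply: m2; apply: measurable_funD; apply: measurable_funM.
- by apply: emeasurable_funD; exact: mm.
move=> x _; rewrite -!EFinM -EFinD lee_fin.
by have := sqr_ge0 (a * v x - b * w x); nra.
all: by rewrite lee_fin k0.
Qed.

Lemma in_L2_lin (a b : R) Om v w : measurable Om ->
  in_L2 Om v -> in_L2 Om w -> in_L2 Om (lin a b v w).
Proof.
move=> mO [mv fv] [mw fw]; split.
  by apply: measurable_funD; apply: measurable_funM.
apply: le_lt_trans (integral_sqr_lin _ _ mO mv mw) _.
have k0 (c : R) : 0 <= 2 * c ^+ 2 by rewrite mulr_ge0 ?sqr_ge0.
by apply: lte_add_pinfty; rewrite lte_mul_pinfty ?lee_fin ?k0.
Qed.

Lemma cvg_L2_lin (a b : R) Om (p q : nat -> R * R -> R) v w : measurable Om ->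
  (forall n, measurable_fun Om (p n)) -> (forall n, measurable_fun Om (q n)) ->
  measurable_fun Om v -> measurable_fun Om w ->
  cvg_L2 Om p v -> cvg_L2 Om q w ->
  cvg_L2 Om (fun n => lin a b (p n) (q n)) (lin a b v w).
Proof.
move=> mO mp mq mv mw cv cw.
have H : ((2 * a ^+ 2)%:E * \int[mu2]_(x in Om) ((p n x - v x) ^+ 2)%:E +
    (2 * b ^+ 2)%:E * \int[mu2]_(x in Om) ((q n x - w x) ^+ 2)%:E)%E
    @[n --> \oo] --> (0 : \bar R)%E.
  rewrite -[X in _ --> X](_ : (2 * a ^+ 2)%:E * 0 + (2 * b ^+ 2)%:E * 0 = 0)%E.
    by apply: cvgeD; [rewrite !mule0|exact: cvgeZl|exact: cvgeZl].
  by rewrite !mule0 adde0.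
apply: squeeze_cvge (cvg_cst 0%E) H.
near=> n; apply/andP; split; first by apply: integral_ge0 => x _; rewrite lee_fin sqr_ge0.
have := @integral_sqr_lin a b Om (p n \- v) (q n \- w) mO
  (measurable_funB (mp n) mv) (measurable_funB (mq n) mw).
apply: le_trans; rewrite le_eqVlt; apply/orP; left; apply/eqP.
by apply: eq_integral => x _; rewrite /lin/=; congr (_ ^+ 2)%:E; ring.
Unshelve. all: by end_near. Qed.

Lemma smooth_measurable Om v s : open Om -> smooth v ->
  measurable_fun Om (foldr (fun (b : bool) g => if b then d1 g else d2 g) v s).
Proof.
move=> oO sv; have [cv _ _] := sv s.
by apply: continuous_measurable_plane => // x _; exact: cv.
Qed.

Lemma H10_lin (a b : R) Om v w : open Om -> H10 Om v -> H10 Om w -> H10 Om (lin a b v w).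
Proof.
move=> oO [Lv [g1 [g2 [p [[Lg1 Lg2] tp cp cp1 cp2]]]]].
move=> [Lw [h1 [h2 [q [[Lh1 Lh2] tq cq cq1 cq2]]]]].
have mO : measurable (Om : set (measurableTypeR R * measurableTypeR R)).
  exact: open_measurable_plane.
have mp n := smooth_measurable [::] oO (proj1 (tp n)).
have mp1 n := smooth_measurable [:: true] oO (proj1 (tp n)).
have mp2 n := smooth_measurable [:: false] oO (proj1 (tp n)).
have mq n := smooth_measurable [::] oO (proj1 (tq n)).
have mq1 n := smooth_measurable [:: true] oO (proj1 (tq n)).
have mq2 n := smooth_measurable [:: false] oO (proj1 (tq n)).
split; first exact: in_L2_lin.
exists (lin a b g1 h1), (lin a b g2 h2), (fun n => lin a b (p n) (q n)); split.
- by split; exact: in_L2_lin.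
- by move=> n; exact: test_function_lin.
- by apply: cvg_L2_lin => //; [exact: (proj1 Lv)|exact: (proj1 Lw)].
- rewrite (_ : (fun n => d1 _) = fun n => lin a b (d1 (p n)) (d1 (q n))).
    by apply: cvg_L2_lin => //; [exact: (proj1 Lg1)|exact: (proj1 Lh1)].
  apply/funext => n; apply/funext => x.
  have [_ dp _] := proj1 (tp n) [::]; have [_ dq _] := proj1 (tq n) [::].
  by have [_] := derive1_lin a b (dp x) (dq x).
- rewrite (_ : (fun n => d2 _) = fun n => lin a b (d2 (p n)) (d2 (q n))).
    by apply: cvg_L2_lin => //; [exact: (proj1 Lg2)|exact: (proj1 Lh2)].
  apply/funext => n; apply/funext => x.
  have [_ _ dp] := proj1 (tp n) [::]; have [_ _ dq] := proj1 (tq n) [::].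
  by have [_] := derive1_lin a b (dp x) (dq x).
Qed.

Lemma Vh_lin (a b : R) Om M v w : open Om -> Vh Om M v -> Vh Om M w ->
  Vh Om M (lin a b v w).
Proof.
move=> oO [Hv v0 Pv] [Hw w0 Pw]; split; first exact: H10_lin.
  by move=> x xO; rewrite /lin v0// w0// !mulr0 addr0.
move=> K KM; have [a1 [b1 [c1 E1]]] := Pv K KM; have [a2 [b2 [c2 E2]]] := Pw K KM.
exists (a * a1 + b * a2), (a * b1 + b * b2), (a * c1 + b * c2) => x xK.
by rewrite /lin E1// E2//; ring.
Qed.

End LinearStructure.

(** * Geometry of triangulations and control volumes *)

Section ConvexHulls.
Context {R : realType}.
Implicit Types (p x : R * R).

Lemma convP (s : seq (R * R)) x : Defs.conv s x <->
  exists l : nat -> R, [/\ forall i, (i < size s)%N -> 0 <= l i,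
    \sum_(0 <= i < size s) l i = 1,
    x.1 = \sum_(0 <= i < size s) l i * (s`_i).1 &
    x.2 = \sum_(0 <= i < size s) l i * (s`_i).2].
Proof.
split=> [[l [l0 l1 x1 x2]]|[l [l0 l1 x1 x2]]].
  pose l' i := if insub i is Some j then l j else 0.
  have l'E (i : 'I_(size s)) : l' i = l i by rewrite /l' valK.
  exists l'; split.
  - by move=> i si; rewrite /l' insubT.
  - by rewrite big_mkord (eq_bigr l) // => i _; rewrite l'E.
  - by rewrite big_mkord x1; apply: eq_bigr => i _; rewrite l'E.
  - by rewrite big_mkord x2; apply: eq_bigr => i _; rewrite l'E.
exists (fun i => l (val i)); split.
- by move=> i; apply: l0; exact: ltn_ord.
- by move: l1; rewrite big_mkord.
- by move: x1; rewrite big_mkord.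
- by move: x2; rewrite big_mkord.
Qed.

Lemma conv_bounded (s : seq (R * R)) :
  exists B : R, forall x, Defs.conv s x -> `|x.1| <= B /\ `|x.2| <= B.
Proof.
exists (\sum_(i < size s) (`|(s`_i).1| + `|(s`_i).2|)) => x [l [l0 s1 x1 x2]].
have l1 i : l i <= 1 by rewrite -s1 (bigD1 i)//= lerDl sumr_ge0.
split; [rewrite x1|rewrite x2]; apply: le_trans (ler_norm_sum _ _ _) _;
  apply: ler_sum => v _; rewrite normrM (ger0_norm (l0 v));
  apply: le_trans (ler_wpM2r _ (l1 v)) _; rewrite // mul1r ?lerDl ?lerDr//.
Qed.

Lemma conv4P p0 p1 p2 p3 x : Defs.conv [:: p0; p1; p2; p3] x <->
  exists a b c d : R, [/\ [/\ 0 <= a, 0 <= b, 0 <= c & 0 <= d], a + b + c + d = 1,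
    x.1 = a * p0.1 + b * p1.1 + c * p2.1 + d * p3.1 &
    x.2 = a * p0.2 + b * p1.2 + c * p2.2 + d * p3.2].
Proof.
split=> [/convP[l [l0 l1 x1 x2]]|[a [b [c [d [[a0 b0 c0 d0] s1 x1 x2]]]]]].
  exists (l 0%N), (l 1%N), (l 2%N), (l 3%N); split.
  - by split; exact: l0.
  - by move: l1; rewrite /= !big_nat_recr//= big_geq// add0r.
  - by move: x1; rewrite /= !big_nat_recr//= big_geq// add0r.
  - by move: x2; rewrite /= !big_nat_recr//= big_geq// add0r.
apply/convP; exists (nth 0 [:: a; b; c; d]); split.
- by move=> [|[|[|[|]]]].
- by rewrite /= !big_nat_recr//= big_geq// add0r.
- by rewrite /= !big_nat_recr//= big_geq// add0r.
- by rewrite /= !big_nat_recr//= big_geq// add0r.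
Qed.

(** Twice the signed area of the triangle. *)
Definition tri_det (p0 p1 p2 : R * R) : R :=
  (p1.1 - p0.1) * (p2.2 - p0.2) - (p1.2 - p0.2) * (p2.1 - p0.1).

(* The barycentric coordinates of [p1] and [p2]; that of [p0] is 1 minus their sum. *)
Definition bcoord (p0 p1 p2 : R * R) :
    measurableTypeR R * measurableTypeR R -> measurableTypeR R * measurableTypeR R :=
  let D := tri_det p0 p1 p2 in
  let a := (p2.2 - p0.2) / D in let b := - (p2.1 - p0.1) / D in
  let c := - (p1.2 - p0.2) / D in let d := (p1.1 - p0.1) / D in
  affine_map a b (- (a * p0.1 + b * p0.2)) c d (- (c * p0.1 + d * p0.2)).

Lemma bcoordK p0 p1 p2 x : tri_det p0 p1 p2 != 0 ->
  x.1 = p0.1 + (bcoord p0 p1 p2 x).1 * (p1.1 - p0.1) +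
        (bcoord p0 p1 p2 x).2 * (p2.1 - p0.1) /\
  x.2 = p0.2 + (bcoord p0 p1 p2 x).1 * (p1.2 - p0.2) +
        (bcoord p0 p1 p2 x).2 * (p2.2 - p0.2).
Proof.
move=> D0; rewrite /bcoord /affine_map/=; move: D0; rewrite /tri_det => D0.
by split; field.
Qed.

Lemma bcoordE p0 p1 p2 x (s t : R) : tri_det p0 p1 p2 != 0 ->
  x.1 = p0.1 + s * (p1.1 - p0.1) + t * (p2.1 - p0.1) ->
  x.2 = p0.2 + s * (p1.2 - p0.2) + t * (p2.2 - p0.2) ->
  bcoord p0 p1 p2 x = (s, t).
Proof.
move=> D0; rewrite /bcoord /affine_map/=; move: D0; rewrite /tri_det => D0 -> ->.
by congr pair; field.
Qed.

Lemma continuous_affine_form (a b e : R) :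
  continuous (fun x : R * R => a * x.1 + b * x.2 + e : R).
Proof.
move=> x; apply: cvgD; last exact: cvg_cst.
by apply: cvgD; apply: cvgM; [exact: cvg_cst|exact: cvg_fst|exact: cvg_cst|exact: cvg_snd].
Qed.

(* In barycentric coordinates: the triangle, the quadrilateral at [p0] and its
   interior. The interiors are pairwise disjoint and miss a null set only. *)
Definition ref_tri : set (measurableTypeR R * measurableTypeR R) :=
  [set y | [/\ 0 <= y.1 :> R, 0 <= y.2 :> R & y.1 + y.2 <= 1 :> R]].
Definition ref_quad : set (measurableTypeR R * measurableTypeR R) :=
  [set y | [/\ 0 <= y.1 :> R, 0 <= y.2 :> R, y.1 <= 1 - y.1 - y.2 :> R
             & y.2 <= 1 - y.1 - y.2 :> R]].
Definition ref_corner : set (measurableTypeR R * measurableTypeR R) :=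
  [set y | [/\ 0 < y.1 :> R, 0 < y.2 :> R, y.1 < 1 - y.1 - y.2 :> R
             & y.2 < 1 - y.1 - y.2 :> R]].

Lemma open_affine_gt0 (a b e : R) : open [set x : R * R | 0 < a * x.1 + b * x.2 + e].
Proof.
have /continuousP/(_ _ (@rray_open _ R 0)) := @continuous_affine_form a b e.
by congr open; apply/seteqP; split => x; rewrite /= in_itv/= andbT.
Qed.

Lemma open_preimage_ref_corner (a b e c d e' : R) :
  open (affine_map a b e c d e' @^-1` ref_corner : set (R * R)).
Proof.
have -> : affine_map a b e c d e' @^-1` ref_corner =
    [set x : R * R | 0 < a * x.1 + b * x.2 + e] `&`
    [set x : R * R | 0 < c * x.1 + d * x.2 + e'] `&`
    [set x : R * R | 0 < (- (2 * a + c)) * x.1 + (- (2 * b + d)) * x.2 + (1 - 2 * e - e')] `&`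
    [set x : R * R | 0 < (- (2 * c + a)) * x.1 + (- (2 * d + b)) * x.2 + (1 - 2 * e' - e)].
  apply/seteqP; split => x; rewrite /affine_map /ref_corner/=.
    by case=> ? ? h1 h2; split; [split; [split|]|] => //; lra.
  by case=> -[[? ?] h1] h2; split => //; lra.
by do 3 (apply: openI; last exact: open_affine_gt0); exact: open_affine_gt0.
Qed.

Lemma measurable_affine_ge0 (a b e : R) :
  measurable [set x : measurableTypeR R * measurableTypeR R | 0 <= a * x.1 + b * x.2 + e].
Proof.
rewrite -[X in measurable X]setCK; apply: measurableC.
have -> : ~` [set x : measurableTypeR R * measurableTypeR R | 0 <= a * x.1 + b * x.2 + e] =
    [set x | 0 < (- a) * x.1 + (- b) * x.2 + (- e)].
  apply/seteqP; split => x/=.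
    by move=> /negP; rewrite -ltNge => h; lra.
  by move=> h1 h2; lra.
by apply: open_measurable_plane; exact: open_affine_gt0.
Qed.

Lemma measurable_ref_tri : measurable ref_tri.
Proof.
have -> : ref_tri = [set x | 0 <= 1 * x.1 + 0 * x.2 + 0] `&`
   [set x | 0 <= 0 * x.1 + 1 * x.2 + 0] `&` [set x | 0 <= (-1) * x.1 + (-1) * x.2 + 1].
  apply/seteqP; split => x; rewrite /ref_tri/=.
    by case=> ? ? ?; split; [split|]; lra.
  by case=> -[? ?] ?; split; lra.
by apply: measurableI; [apply: measurableI|]; exact: measurable_affine_ge0.
Qed.

Lemma measurable_ref_quad : measurable ref_quad.
Proof.
have -> : ref_quad = [set x | 0 <= 1 * x.1 + 0 * x.2 + 0] `&`
   [set x | 0 <= 0 * x.1 + 1 * x.2 + 0] `&` [set x | 0 <= (-2) * x.1 + (-1) * x.2 + 1] `&`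
   [set x | 0 <= (-1) * x.1 + (-2) * x.2 + 1].
  apply/seteqP; split => x; rewrite /ref_quad/=.
    by case=> ? ? ? ?; split; [split; [split|]|]; lra.
  by case=> -[[? ?] ?] ?; split; lra.
by do 3 (apply: measurableI; last exact: measurable_affine_ge0); exact: measurable_affine_ge0.
Qed.

Lemma measurable_ref_corner : measurable ref_corner.
Proof.
apply: open_measurable_plane; have := @open_preimage_ref_corner 1 0 0 0 1 0.
congr open; apply/seteqP; split => x; rewrite /= /affine_map !mul1r !mul0r !addr0 !add0r;
by case: x.
Qed.

Lemma mu2_setX (A B : set (measurableTypeR R)) : measurable A -> measurable B ->
  mu2 (A `*` B) = (lebesgue_measure A * lebesgue_measure B)%E.
Proof. exact: product_measure1E. Qed.

Lemma mu2_ref_tri_lty : (mu2 ref_tri < +oo)%E.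
Proof.
apply: le_lt_trans (_ : mu2 (`[0%R, 1%R] `*` `[0%R, 1%R]) < +oo)%E.
  apply: le_measure; rewrite ?inE//.
  - exact: measurable_ref_tri.
  - exact: measurableX.
  by move=> x [] ? ? ?; split; rewrite /= in_itv/=; lra.
rewrite mu2_setX// !lebesgue_measure_itv/= lte_fin ltr01.
by rewrite -!EFinD -EFinM ltry.
Qed.

Lemma mu2_ref_corner_gt0 : (0 < mu2 ref_corner)%E.
Proof.
apply: lt_le_trans (_ : mu2 (`]0%R, 4^-1%R] `*` `]0%R, 4^-1%R]) <= _)%E; last first.
  apply: le_measure; rewrite ?inE//.
  - exact: measurableX.
  - exact: measurable_ref_corner.
  by move=> x [] /=; rewrite !in_itv/= => /andP[? ?] /andP[? ?]; split; lra.
rewrite mu2_setX// !lebesgue_measure_itv/= lte_fin invr_gt0 ltr0n/=.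
by rewrite -!EFinD -EFinM lte_fin subr0 mulr_gt0 ?invr_gt0.
Qed.

Lemma det_bcoord p0 p1 p2 : tri_det p0 p1 p2 != 0 ->
  (p2.2 - p0.2) / tri_det p0 p1 p2 * ((p1.1 - p0.1) / tri_det p0 p1 p2) -
  - (p2.1 - p0.1) / tri_det p0 p1 p2 * (- (p1.2 - p0.2) / tri_det p0 p1 p2) =
  (tri_det p0 p1 p2)^-1.
Proof. by rewrite /tri_det => D0; field. Qed.

Lemma integral_bcoord p0 p1 p2 D (f : measurableTypeR R * measurableTypeR R -> \bar R) :
  tri_det p0 p1 p2 != 0 -> measurable D -> measurable_fun D f ->
  (forall x, D x -> 0 <= f x)%E ->
  (\int[mu2]_(x in bcoord p0 p1 p2 @^-1` D) f (bcoord p0 p1 p2 x) =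
   `|tri_det p0 p1 p2|%:E * \int[mu2]_(x in D) f x)%E.
Proof.
move=> D0 mD mf f0; have Dv0 := det_bcoord D0.
have D1 := invr_neq0 D0; rewrite -Dv0 in D1.
have H e e' := @integral_affine R _ _ e _ _ e' D f D1 mD mf f0.
have {}H : (`|(tri_det p0 p1 p2)^-1|%:E *
    \int[mu2]_(x in bcoord p0 p1 p2 @^-1` D) f (bcoord p0 p1 p2 x) =
    \int[mu2]_(x in D) f x)%E by rewrite -Dv0; exact: H.
by rewrite -H normfV muleA -EFinM divff ?normr_eq0// mul1e.
Qed.

Lemma mu2_bcoord p0 p1 p2 D : tri_det p0 p1 p2 != 0 -> measurable D ->
  mu2 (bcoord p0 p1 p2 @^-1` D) = (`|tri_det p0 p1 p2|%:E * mu2 D)%E.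
Proof.
move=> D0 mD; have Dv0 := det_bcoord D0.
have D1 := invr_neq0 D0; rewrite -Dv0 in D1.
have H e e' := @mu2_affine R _ _ e _ _ e' D D1 mD.
have {}H : (`|(tri_det p0 p1 p2)^-1|%:E * mu2 (bcoord p0 p1 p2 @^-1` D) = mu2 D)%E.
  by rewrite -Dv0; exact: H.
by rewrite -H normfV muleA -EFinM divff ?normr_eq0// mul1e.
Qed.

Lemma mu2_ref_quad_corner : mu2 (ref_quad `\` ref_corner) = 0%E.
Proof.
pose ln (a b c : R) := [set x : measurableTypeR R * measurableTypeR R | a * x.1 + b * x.2 = c].
have m0 a b c : (a != 0) || (b != 0) -> mu2.-negligible (ln a b c).
  move=> ab; exists (ln a b c); split => //; last exact: mu2_line.
  have -> : ln a b c = [set x | 0 <= a * x.1 + b * x.2 + - c] `&`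
     [set x | 0 <= (- a) * x.1 + (- b) * x.2 + c].
    by apply/seteqP; split => x; rewrite /ln/=; [move=> h; split; lra|case=> h1 h2; lra].
  by apply: measurableI; exact: measurable_affine_ge0.
have H : mu2.-negligible (ln 1 0 0 `|` ln 0 1 0 `|` ln 2 1 1 `|` ln 1 2 1).
  by do 3 (apply: negligibleU; last by apply: m0; rewrite ?oner_eq0 ?pnatr_eq0 ?orbT);
    apply: m0; rewrite oner_eq0.
apply/eqP; rewrite -measure_le0.
case: H => N [mN N0 HN]; rewrite -N0; apply: le_measure; rewrite ?inE//.
  by apply: measurableD; [exact: measurable_ref_quad|exact: measurable_ref_corner].
move=> x [[h1 h2 h3 h4] nh]; apply: HN; apply: contrapT => nx; apply: nh.
have n1 : ~ x.1 = 0 :> R by move=> h; apply: nx; left; left; left; rewrite /ln/=; lra.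
have n2 : ~ x.2 = 0 :> R by move=> h; apply: nx; left; left; right; rewrite /ln/=; lra.
have n3 : ~ x.1 = 1 - x.1 - x.2 :> R.
  by move=> h; apply: nx; left; right; rewrite /ln/=; lra.
have n4 : ~ x.2 = 1 - x.1 - x.2 :> R by move=> h; apply: nx; right; rewrite /ln/=; lra.
by split; rewrite lt_neqAle ?h1 ?h2 ?h3 ?h4 andbT; apply/eqP => // /esym.
Qed.

End ConvexHulls.

(** * Barycentric coordinates, open triangles and open corners of a mesh *)

Section Mesh.
Context {R : realType}.
Variables (Om : set (R * R)) (M : mesh R).
Local Notation node := 'I_(nv M).
Implicit Types (K L : {set node}) (x : R * R) (m : node -> R).

Definition rep K m x : Prop :=
  [/\ \sum_(v in K) m v = 1, x.1 = \sum_(v in K) m v * (vtx v).1 &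
      x.2 = \sum_(v in K) m v * (vtx v).2].

(** An ordering of the vertices of [K] that starts at [z]. The enumeration is recorded because
    [quadrilateral] lists its edge midpoints in that order. *)
Definition corner K (z y w : node) : Prop :=
  [/\ K = [set z; y; w]%SET, [/\ z != y, z != w & y != w],
      enum (K :\ z)%SET = [:: y; w] & tri_det (vtx z) (vtx y) (vtx w) != 0].

Definition icell K : set (R * R) := [set x | exists2 m, rep K m x & forall v, v \in K -> 0 < m v].

(** The interior of the quadrilateral at [z]: inside the open triangle, the coordinate belonging to
    [z] is strictly the largest. *)
Definition ocorner K z : set (R * R) :=
  [set x | exists2 m, rep K m x & forall v, v \in K -> 0 < m v /\ (v != z -> m v < m z)].

Lemma cellP K x : cell K x <-> exists2 m, rep K m x & forall v, v \in K -> 0 <= m v.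
Proof.
have sumE (z0 : node) (F : node -> R) : \sum_(v in K) F v =
    \sum_(0 <= i < size (enum K)) F (nth z0 (enum K) i).
  by rewrite -big_enum/= (big_nth z0).
have nthE (z0 : node) i : (i < size (enum K))%N ->
    [seq vtx z | z <- enum K]`_i = vtx (nth z0 (enum K) i).
  by move=> iK; rewrite (nth_map z0).
split=> [/convP[l []]|[m [s1 x1 x2] m0]].
  rewrite size_map => l0 s1 x1 x2.
  have [z0 z0K] : exists z0, z0 \in enum K.
    case E : (enum K) s1 => [|z0 s]; last by move=> _; exists z0; rewrite mem_head.
    by rewrite big_geq// => /esym/eqP; rewrite oner_eq0.
  have idx i : (i < size (enum K))%N -> index (nth z0 (enum K) i) (enum K) = i.
    by move=> iK; rewrite index_uniq ?enum_uniq.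
  exists (fun v => l (index v (enum K))).
    split; rewrite (sumE z0).
    - by rewrite -[RHS]s1; apply: eq_big_nat => i /andP[_ iK]; rewrite idx.
    - by rewrite x1; apply: eq_big_nat => i /andP[_ iK]; rewrite idx// (nthE z0).
    - by rewrite x2; apply: eq_big_nat => i /andP[_ iK]; rewrite idx// (nthE z0).
  by move=> v vK; apply: l0; rewrite index_mem mem_enum.
have [z0 z0K] : exists z0, z0 \in K.
  apply: contrapT => nK; move: s1; rewrite big_pred0.
    by move=> /esym/eqP; rewrite oner_eq0.
  by move=> v; apply/negP => vK; apply: nK; exists v.
apply/convP; rewrite size_map; exists (fun i => m (nth z0 (enum K) i)); split.
- by move=> i iK; apply: m0; rewrite -mem_enum mem_nth.
- by rewrite -(sumE z0 m).
- rewrite x1 (sumE z0); apply: eq_big_nat => i /andP[_ iK]; by rewrite (nthE z0).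
- rewrite x2 (sumE z0); apply: eq_big_nat => i /andP[_ iK]; by rewrite (nthE z0).
Qed.

Lemma corner_sum K z y w (F : node -> R) : corner K z y w ->
  \sum_(v in K) F v = F z + F y + F w.
Proof.
case=> -> [zy zw yw] _ _; rewrite -finset.setUA big_setU1/= ?inE ?negb_or ?zy//.
by rewrite big_setU1/= ?inE// big_set1 addrA.
Qed.

Lemma corner_mem K z y w : corner K z y w ->
  [/\ z \in K, y \in K, w \in K & forall v, v \in K -> [\/ v = z, v = y | v = w]].
Proof.
case=> -> _ _ _; split; rewrite ?inE ?eqxx ?orbT//.
move=> v; rewrite !inE => /orP[/orP[]|] /eqP->; [exact: Or31|exact: Or32|exact: Or33].
Qed.

Lemma corner_rep K z y w m x : corner K z y w -> rep K m x ->
  bcoord (vtx z) (vtx y) (vtx w) x = (m y, m w) /\ m z = 1 - m y - m w.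
Proof.
move=> c [s1 x1 x2]; have [_ _ _ D0] := c.
rewrite (corner_sum _ c) in s1; rewrite (corner_sum _ c) in x1.
rewrite (corner_sum _ c) in x2.
have mz : m z = 1 - m y - m w by rewrite -s1; ring.
by split=> //; apply: bcoordE; rewrite // ?x1 ?x2 mz; ring.
Qed.

Lemma corner_rep_ex K z y w x : corner K z y w ->
  exists m, [/\ rep K m x, m y = (bcoord (vtx z) (vtx y) (vtx w) x).1,
    m w = (bcoord (vtx z) (vtx y) (vtx w) x).2 & m z = 1 - m y - m w].
Proof.
move=> c; have [_ [zy zw yw] _ D0] := c.
have [x1 x2] := bcoordK x D0.
move: x1 x2; set s := (bcoord _ _ _ _).1; set t := (bcoord _ _ _ _).2 => x1 x2.
exists (fun v => if v == z then 1 - s - t else if v == y then s else t).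
have yz : (y == z) = false by rewrite eq_sym; exact: negPf.
have wz : (w == z) = false by rewrite eq_sym; exact: negPf.
have wy : (w == y) = false by rewrite eq_sym; exact: negPf.
rewrite !eqxx yz wz wy; split=> //.
split; rewrite (corner_sum _ c) !eqxx yz wz wy.
- ring.
- by rewrite x1; ring.
- by rewrite x2; ring.
Qed.

Lemma rep_uniq K z y w m m' x : corner K z y w -> rep K m x -> rep K m' x ->
  forall v, v \in K -> m v = m' v.
Proof.
move=> c r r'; have [E mz] := corner_rep c r; have [E' mz'] := corner_rep c r'.
have [e1 e2] : m y = m' y /\ m w = m' w by move: E; rewrite E' => -[-> ->].
have [_ _ _ h] := corner_mem c.
by move=> v /h[] ->; rewrite ?mz ?mz' ?e1 ?e2.
Qed.

Lemma corner_cell K z y w x : corner K z y w ->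
  cell K x <-> ref_tri (bcoord (vtx z) (vtx y) (vtx w) x).
Proof.
move=> c; have [zK yK wK inK] := corner_mem c; split.
  move=> /cellP[m r m0]; have [-> mz] := corner_rep c r.
  have := m0 _ zK; have := m0 _ yK; have := m0 _ wK; rewrite mz => ? ? ?.
  by split => //=; lra.
move=> [h1 h2 h3]; apply/cellP; have [m [r my mw mz]] := corner_rep_ex x c.
by exists m => // v /inK[] ->; rewrite ?mz ?my ?mw//; lra.
Qed.

Lemma corner_icell K z y w x : corner K z y w ->
  icell K x <-> [/\ 0 < (bcoord (vtx z) (vtx y) (vtx w) x).1 :> R,
    0 < (bcoord (vtx z) (vtx y) (vtx w) x).2 :> R &
    (bcoord (vtx z) (vtx y) (vtx w) x).1 + (bcoord (vtx z) (vtx y) (vtx w) x).2 < 1 :> R].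
Proof.
move=> c; have [zK yK wK inK] := corner_mem c; split.
  move=> [m r m0]; have [-> mz] := corner_rep c r.
  have := m0 _ zK; have := m0 _ yK; have := m0 _ wK; rewrite mz => ? ? ?.
  by split => //=; lra.
move=> [h1 h2 h3]; have [m [r my mw mz]] := corner_rep_ex x c.
by exists m => // v /inK[] ->; rewrite ?mz ?my ?mw//; lra.
Qed.

Lemma corner_ocorner K z y w : corner K z y w ->
  ocorner K z = bcoord (vtx z) (vtx y) (vtx w) @^-1` ref_corner.
Proof.
move=> c; have [zK yK wK inK] := corner_mem c; have [_ [zy zw yw] _ _] := c.
apply/seteqP; split => x.
  move=> [m r m0]; rewrite /preimage/=; have [-> mz] := corner_rep c r.
  have [_ _] := m0 _ zK; have [? h1] := m0 _ yK; have [? h2] := m0 _ wK.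
  by split => //=; rewrite -mz; [apply: h1|apply: h2]; rewrite eq_sym.
move=> [h1 h2 h3 h4]; have [m [r my mw mz]] := corner_rep_ex x c.
exists m => // v /inK[] ->; rewrite ?eqxx ?mz ?my ?mw//.
by split=> //; lra.
Qed.

Lemma corner_quad K z y w x : corner K z y w ->
  quadrilateral K z x <-> ref_quad (bcoord (vtx z) (vtx y) (vtx w) x).
Proof.
move=> c; have [_ _ en D0] := c.
have [x1 x2] := bcoordK x D0.
rewrite /quadrilateral en/=; split.
  move=> /conv4P[a [b [e [d [[a0 b0 e0 d0] s1 X1 X2]]]]].
  (* The barycenter contributes 1/3 to each coordinate, an edge midpoint 1/2 to one of them. *)
  have -> : bcoord (vtx z) (vtx y) (vtx w) x = (b / 3 + e / 2, b / 3 + d / 2).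
    apply: bcoordE => //; rewrite ?X1 ?X2 /bary/= !(corner_sum _ c) /midpoint/=;
    have -> : a = 1 - b - e - d by lra.
    - by field.
    - by field.
  by split => /=; lra.
move: x1 x2; set s := (bcoord _ _ _ _).1; set t := (bcoord _ _ _ _).2 => x1 x2.
move=> [h1 h2 h3 h4]; rewrite -/s -/t in h1 h2 h3 h4; apply/conv4P.
(* The segment from the vertex to the barycenter cuts the quadrilateral into two triangles; on each
   of them one midpoint gets weight 0. *)
have [st|/ltW ts] := leP s t.
  exists (1 - s - t - t), (3 * s), 0, (2 * (t - s)); split.
  - by split; lra.
  - by ring.
  - by rewrite x1 /bary/= !(corner_sum _ c) /midpoint/=; field.
  - by rewrite x2 /bary/= !(corner_sum _ c) /midpoint/=; field.
exists (1 - s - t - s), (3 * t), (2 * (s - t)), 0; split.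
- by split; lra.
- by ring.
- by rewrite x1 /bary/= !(corner_sum _ c) /midpoint/=; field.
- by rewrite x2 /bary/= !(corner_sum _ c) /midpoint/=; field.
Qed.

Lemma ref_corner_quad : ref_corner `<=` (ref_quad : set (measurableTypeR R * _)).
Proof. by move=> y [h1 h2 h3 h4]; split; exact: ltW. Qed.

Lemma ref_quad_tri : ref_quad `<=` (ref_tri : set (measurableTypeR R * _)).
Proof. by move=> y [h1 h2 h3 h4]; split => //; lra. Qed.

Hypotheses (hOm : convex_polygonal_domain Om) (hM : triangulation Om M).

Lemma tri_corner K z : K \in tri M -> z \in K -> exists y w, corner K z y w.
Proof.
move=> KM zK; have [_ _ h _ _] := hM; have [K3 nd] := h K KM.
have := cardsD1 z K; rewrite K3 zK => -[] /esym; rewrite cardE.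
case E : (enum (K :\ z)%SET) => [|y [|w [|? ?]]]// _.
have u := enum_uniq (K :\ z)%SET; rewrite E/= inE andbT in u.
have mE v : (v \in (K :\ z)%SET) = (v == y) || (v == w) by rewrite -mem_enum E !inE.
have yz : y \in (K :\ z)%SET by rewrite mE eqxx.
have wz : w \in (K :\ z)%SET by rewrite mE eqxx orbT.
have KE : K = [set z; y; w]%SET.
  rewrite -(finset.setD1K zK); apply/setP => v; rewrite finset.in_setU1 mE !inE; by case: (v == z).
exists y, w; split=> //.
  by move: yz wz; rewrite !inE => /andP[? _] /andP[? _]; split; rewrite // eq_sym.
by have := nd z y w KE; rewrite -subr_eq0.
Qed.

Lemma tri_nonempty K : K \in tri M -> exists z, z \in K.
Proof.
move=> KM; have [_ _ h _ _] := hM; have [K3 _] := h K KM.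
by apply/card_gt0P; rewrite K3.
Qed.

(** This description is symmetric in the vertices. Choosing a largest coordinate then shows that the
    quadrilaterals cover, and comparing two of them that the open corners are disjoint. *)
Lemma quadP K z x : K \in tri M -> z \in K -> quadrilateral K z x <->
  exists2 m, rep K m x & forall v, v \in K -> 0 <= m v <= m z.
Proof.
move=> KM zK; have [y [w c]] := tri_corner KM zK.
have [_ yK wK inK] := corner_mem c; split.
  move=> /(corner_quad _ c)[h1 h2 h3 h4]; have [m [r my mw mz]] := corner_rep_ex x c.
  by exists m => // v /inK[] ->; rewrite ?mz ?my ?mw//; lra.
move=> [m r m0]; apply/(corner_quad _ c); have [-> mz] := corner_rep c r.
have /andP[? ?] := m0 _ zK; have /andP[? ?] := m0 _ yK; have /andP[? ?] := m0 _ wK.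
by split => //=; rewrite -mz.
Qed.

Lemma quad_cell K z : K \in tri M -> z \in K -> quadrilateral K z `<=` cell K.
Proof.
move=> KM zK x /(quadP _ KM zK)[m r m0]; apply/cellP; exists m => // v vK.
by have /andP[] := m0 v vK.
Qed.

Lemma ocorner_icell K z : ocorner K z `<=` icell K.
Proof. by move=> x [m r m0]; exists m => // v /m0[]. Qed.

Lemma icell_cell K : icell K `<=` cell K.
Proof. by move=> x [m r m0]; apply/cellP; exists m => // v /m0/ltW. Qed.

Lemma ocorner_quad K z : K \in tri M -> z \in K -> ocorner K z `<=` quadrilateral K z.
Proof.
move=> KM zK x [m r m0]; apply/(quadP _ KM zK); exists m => // v vK.
have [v0 vz] := m0 v vK; rewrite ltW//=; have [->//|/vz/ltW//] := eqVneq v z.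
Qed.

Lemma tri_sub_eq K L : K \in tri M -> L \in tri M -> K \subset L -> K = L.
Proof.
move=> KM LM KL; have [_ _ h _ _] := hM.
by apply/eqP; rewrite eqEcard KL (proj1 (h K KM)) (proj1 (h L LM)).
Qed.

(** If a vertex [v] of [K] is missing in [L], conformity puts [x] in the common face. Its
    coordinates there, extended by 0, represent [x] on [K] with value 0 at [v], against uniqueness
    and the positivity in [icell]. *)
Lemma icell_disjoint K L x : K \in tri M -> L \in tri M -> icell K x -> cell L x -> L = K.
Proof.
move=> KM LM iK cL; have [_ _ _ _ hI] := hM.
have [[v vK vL]|] := pselect (exists2 v, v \in K & v \notin L); last first.
  move=> nv; apply/esym/tri_sub_eq => //; apply/fintype.subsetP => v vK.
  by apply: contrapT => /negP vL; apply: nv; exists v.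
have : cell (K :&: L)%SET x by rewrite -hI//; split => //; exact: icell_cell.
move=> /cellP[m [s1 x1 x2] _].
pose m' v := if v \in L then m v else 0.
have E (F : node -> R) : \sum_(u in K) m' u * F u = \sum_(u in (K :&: L)%SET) m u * F u.
  rewrite big_mkcond [RHS]big_mkcond; apply: eq_bigr => u _.
  by rewrite inE /m'; case: (u \in K) (u \in L) => -[]//=; rewrite mul0r.
have r' : rep K m' x.
  split; rewrite ?E//.
  have := E (fun=> 1); under eq_bigr do rewrite mulr1; move=> ->.
  by rewrite -[RHS]s1; apply: eq_bigr => u _; rewrite mulr1.
case: iK => n r n0; have [y [w c]] := tri_corner KM vK.
have := rep_uniq c r r' vK; rewrite /m' (negPf vL) => nv.
by have := n0 v vK; rewrite nv ltxx.
Qed.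

Lemma ocorner_disjoint K L z z' x : K \in tri M -> z \in K -> L \in tri M -> z' \in L ->
  ocorner K z x -> quadrilateral L z' x -> L = K /\ z' = z.
Proof.
move=> KM zK LM z'L oK qL.
have LK : L = K by apply: icell_disjoint KM LM (ocorner_icell oK) (quad_cell LM z'L qL).
subst L; split => //; move/(quadP _ KM z'L): qL => [m r m0]; case: oK => n r' n0.
have [y [w c]] := tri_corner KM zK.
apply: contrapT => /eqP zz'; have [_ /(_ zz')] := n0 z' z'L.
rewrite -(rep_uniq c r r')// -(rep_uniq c r r')// ltNge.
by have /andP[_ ->] := m0 z zK.
Qed.

Lemma quad_cover x : closure Om x ->
  exists K z, [/\ K \in tri M, z \in K & quadrilateral K z x].
Proof.
have [_ _ _ -> _] := hM => -[K /= KM /cellP[m r m0]].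
have [z0 z0K] := tri_nonempty KM.
have [z zK zmax] := @arg_maxP _ _ _ z0 (fun v => v \in K) m z0K.
exists K, z; split=> //; apply/quadP => //; exists m => // v vK.
by rewrite m0//=; exact: zmax.
Qed.

Lemma cell_closure K : K \in tri M -> cell K `<=` closure Om.
Proof. by move=> KM x cx; have [_ _ _ -> _] := hM; exists K. Qed.

Lemma vtx_cell K z : z \in K -> cell K (vtx z).
Proof.
move=> zK; apply/cellP; exists (fun v => (v == z)%:R); last by move=> v _; exact: ler0n.
have E (F : node -> R) : \sum_(v in K) (v == z)%:R * F v = F z.
  rewrite (bigD1 z)//= eqxx mul1r big1 ?addr0// => v /andP[_ /negPf->].
  by rewrite mul0r.
split; rewrite ?E//; have := E (fun=> 1); under eq_bigr do rewrite mulr1.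
by [].
Qed.

Lemma open_icell K : K \in tri M -> open (icell K).
Proof.
move=> KM; have [z zK] := tri_nonempty KM; have [y [w c]] := tri_corner KM zK.
have -> : icell K = [set x | [/\ 0 < (bcoord (vtx z) (vtx y) (vtx w) x).1 :> R,
    0 < (bcoord (vtx z) (vtx y) (vtx w) x).2 :> R &
    (bcoord (vtx z) (vtx y) (vtx w) x).1 + (bcoord (vtx z) (vtx y) (vtx w) x).2 < 1 :> R]].
  by apply/seteqP; split=> x /(corner_icell x c).
rewrite /bcoord /affine_map/=.
set a := _ / _; set b := _ / tri_det _ _ _; set e := - (_ + _).
set a' := _ / tri_det _ _ _; set b' := _ / tri_det _ _ _; set e' := - (_ + _).
have -> : [set x : R * R | [/\ 0 < a * x.1 + b * x.2 + e, 0 < a' * x.1 + b' * x.2 + e' &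
     a * x.1 + b * x.2 + e + (a' * x.1 + b' * x.2 + e') < 1]] =
    [set x : R * R | 0 < a * x.1 + b * x.2 + e] `&`
    [set x : R * R | 0 < a' * x.1 + b' * x.2 + e'] `&`
    [set x : R * R | 0 < (- a - a') * x.1 + (- b - b') * x.2 + (1 - e - e')].
  apply/seteqP; split => x/=.
    by case=> ? ? ?; split; [split|] => //; lra.
  by case=> -[? ?] ?; split => //; lra.
by do 2 (apply: openI; last exact: open_affine_gt0); exact: open_affine_gt0.
Qed.

(** A convex open set contains every open subset of its closure. Move [x] slightly away from a point
    [y] of the domain to [z], still in [U], and approximate [z] by [z'] in the domain; the line from
    [z'] through [x] then meets the domain near [y]. *)
Lemma open_in_closure (U : set (R * R)) : open U -> U `<=` closure Om -> U `<=` Om.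
Proof.
have [[y Omy] oOm cvx _] := hOm.
move=> oU UO x Ux.
have /nbhs_ballP[r /= r0 rU] : nbhs x U by exact: open_nbhs_nbhs.
have /nbhs_ballP[r' /= r'0 r'O] : nbhs y Om by exact: open_nbhs_nbhs.
pose d := 1 + `|x.1 - y.1| + `|x.2 - y.2|.
have d1 : `|x.1 - y.1| < d by rewrite /d; have := normr_ge0 (x.2 - y.2); lra.
have d2 : `|x.2 - y.2| < d by rewrite /d; have := normr_ge0 (x.1 - y.1); lra.
have d0 : 0 < d by apply: le_lt_trans d1.
pose e := r / d; have e0 : 0 < e by rewrite divr_gt0.
pose z := (x.1 + e * (x.1 - y.1), x.2 + e * (x.2 - y.2)).
have ed (a : R) : `|a| < d -> `|e * a| < r.
  move=> ad; rewrite normrM (gtr0_norm e0) /e mulrAC ltr_pdivrMr//.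
  by rewrite ltr_pM2l.
have Uz : U z.
  apply: rU; split; rewrite /ball/= opprD addrA subrr add0r normrN; exact: ed.
have [z' [Oz' [z1 z2]]] : Om `&` ball z (e * r') !=set0.
  by apply: (UO z Uz); apply: nbhsx_ballx; rewrite mulr_gt0.
(* Solves [x = e / (1 + e) * y' + 1 / (1 + e) * z']; its distance to [y] is that of [z'] to [z]
   divided by [e], whence the radius [e * r']. *)
pose y' := ((1 + e) / e * x.1 - z'.1 / e, (1 + e) / e * x.2 - z'.2 / e).
have Oy' : Om y'.
  apply: r'O; split; rewrite /ball/=.
    have -> : y.1 - ((1 + e) / e * x.1 - z'.1 / e) = - ((z.1 - z'.1) / e).
      by rewrite /z/=; field; rewrite gt_eqF.
    by rewrite normrN normrM normfV (gtr0_norm e0) ltr_pdivrMr// mulrC; exact: z1.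
  have -> : y.2 - ((1 + e) / e * x.2 - z'.2 / e) = - ((z.2 - z'.2) / e).
    by rewrite /z/=; field; rewrite gt_eqF.
  by rewrite normrN normrM normfV (gtr0_norm e0) ltr_pdivrMr// mulrC; exact: z2.
have := cvx y' z' (e / (1 + e)) Oy' Oz'; rewrite divr_ge0 ?addr_ge0 ?(ltW e0)//.
rewrite ler_pdivrMr ?addr_gt0// mul1r lerDr ler01 => /(_ isT).
have -> // : (e / (1 + e) * y'.1 + (1 - e / (1 + e)) * z'.1,
  e / (1 + e) * y'.2 + (1 - e / (1 + e)) * z'.2) = x.
rewrite [RHS]surjective_pairing /y'/=; have e1 : 1 + e != 0 by rewrite gt_eqF ?addr_gt0.
by congr pair; field; rewrite e1 gt_eqF.
Qed.

Lemma icell_Om K : K \in tri M -> icell K `<=` Om.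
Proof.
move=> KM; apply: open_in_closure; first exact: open_icell.
by move=> x /icell_cell; exact: cell_closure.
Qed.

Lemma P1_rep K (v : R * R -> R) m x : P1_on K v -> cell K x -> rep K m x ->
  v x = \sum_(u in K) m u * v (vtx u).
Proof.
move=> [a [b [c E]]] cx [s1 x1 x2]; rewrite E// x1 x2.
have -> : a = \sum_(u in K) m u * a by rewrite -mulr_suml s1 mul1r.
rewrite !mulr_sumr -!big_split/=; apply: eq_bigr => u uK.
rewrite E; last exact: vtx_cell.
ring.
Qed.

Lemma bary_icell K : K \in tri M -> icell K (bary K).
Proof.
move=> KM; have [z zK] := tri_nonempty KM; have [y [w c]] := tri_corner KM zK.
exists (fun=> 3^-1); last by move=> *; rewrite invr_gt0.
by split; rewrite /bary/= !(corner_sum _ c); field.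
Qed.

Lemma d12_icell K (v : R * R -> R) (a b c : R) x : K \in tri M -> icell K x ->
  (forall x, cell K x -> v x = a + b * x.1 + c * x.2) -> d1 v x = b /\ d2 v x = c.
Proof.
move=> KM iK E.
have /nbhs_ballP[r /= r0 rK] : nbhs x (icell K).
  by apply: open_nbhs_nbhs; split => //; exact: open_icell.
have aff (p q t : R) : is_derive t 1 (fun s : R => p + q * s) q.
  have H : is_derive t 1 (cst p + q \*: id) (0 + q *: (1 : R)).
    exact: is_deriveD.
  by move: H; rewrite add0r scaler1.
split.
  have H : is_derive x.1 1 (fun s => v (s, x.2)) b.
    apply: near_eq_is_derive (aff (a + c * x.2) b x.1).
    apply/nbhs_ballP; exists r => //= s xs.
    rewrite E; first by rewrite /=; ring.
    by apply: icell_cell; apply: rK; split => //=; exact: ballxx.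
  by rewrite /d1 derive1E; exact: derive_val.
have H : is_derive x.2 1 (fun s => v (x.1, s)) c.
  apply: near_eq_is_derive (aff (a + b * x.1) c x.2).
  apply/nbhs_ballP; exists r => //= s xs.
  rewrite E//; last first.
  by apply: icell_cell; apply: rK; split => //=; exact: ballxx.
by rewrite /d2 derive1E; exact: derive_val.
Qed.

Lemma eucl_dist_le x y : eucl_dist x y <= `|x.1 - y.1| + `|x.2 - y.2|.
Proof.
rewrite /eucl_dist -[leRHS]ger0_norm ?addr_ge0// -sqrtr_sqr ler_wsqrtr//.
have sqn (a : R) : `|a| ^+ 2 = a ^+ 2 by rewrite real_normK ?num_real.
have h := mulr_ge0 (normr_ge0 (x.1 - y.1)) (normr_ge0 (x.2 - y.2)).
rewrite -(sqn (x.1 - y.1)) -(sqn (x.2 - y.2)); nra.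
Qed.

Lemma dist_meshsize K x y : K \in tri M -> cell K x -> cell K y ->
  eucl_dist x y <= meshsize M.
Proof.
move=> KM cx cy; apply: le_trans (_ : diam (cell K) <= _); last first.
  by rewrite /meshsize (le_bigmax_cond 0 (fun K => diam (cell K))).
apply: ub_le_sup; last by exists x => //; exists y.
have [B bd] := conv_bounded [seq vtx z | z <- enum K].
exists (4 * B) => _ [p cp [q cq <-]].
apply: le_trans (eucl_dist_le _ _) _.
have [p1 p2] := bd p cp; have [q1 q2] := bd q cq.
have := ler_normB p.1 q.1; have := ler_normB p.2 q.2; lra.
Qed.

Lemma meshsize_gt0 : 0 < meshsize M.
Proof.
have [[x Ox] _ _ _] := hOm; have [_ _ _ E _] := hM.
have : closure Om x by exact: subset_closure.
rewrite E => -[K /= KM _]; have [z zK] := tri_nonempty KM.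
have [y [w c]] := tri_corner KM zK; have [_ yK wK _] := corner_mem c.
apply: lt_le_trans (dist_meshsize KM (vtx_cell zK) (vtx_cell yK)).
rewrite /eucl_dist sqrtr_gt0 lt0r addr_ge0 ?sqr_ge0// andbT.
rewrite paddr_eq0 ?sqr_ge0// !sqrf_eq0 !subr_eq0; apply/negP => /andP[/eqP e1 /eqP e2].
by have [_ _ _] := c; rewrite /tri_det e1 e2 !subrr !mul0r subr0 eqxx.
Qed.

End Mesh.

(** Discriminant of a nonnegative quadratic polynomial, the common source of the Cauchy-Schwarz
    inequalities for integrals and for the mass form. If [c = 0], a nonnegative affine function
    forces [b = 0]. *)
Lemma sqr_le_mul (R : realFieldType) (a b c : R) : 0 <= a -> 0 <= c ->
  (forall t, 0 <= a + 2 * t * b + t ^+ 2 * c) -> b ^+ 2 <= a * c.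
Proof.
move=> a0; rewrite le_eqVlt => /predU1P[<- H|c0 H].
  rewrite mulr0; have [->|b0] := eqVneq b 0; first by rewrite expr0n.
  have := H (- (a + 1) / (2 * b)).
  have -> : a + 2 * (- (a + 1) / (2 * b)) * b + (- (a + 1) / (2 * b)) ^+ 2 * 0 = -1.
    by field.
  by rewrite ler0N1.
have := H (- b / c).
have -> : a + 2 * (- b / c) * b + (- b / c) ^+ 2 * c = (a * c - b ^+ 2) / c.
  by field; rewrite gt_eqF.
by rewrite pmulr_lge0 ?invr_gt0// subr_ge0.
Qed.

Lemma compact_fun_bounded (R : realType) (T : topologicalType) (A : set T) (f : T -> R) :
  compact A -> {within A, continuous f} -> exists2 B : R, 0 < B & forall x, A x -> `|f x| <= B.
Proof.
move=> cA cf; have /compact_bounded := continuous_compact cf cA.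
move=> [B [_ HB]]; exists (`|B| + 1); first by rewrite ltr_wpDl.
move=> x Ax; apply: (HB (`|B| + 1)); last by exists x.
by rewrite (le_lt_trans (ler_norm B))// ltrDl.
Qed.

(** * Integrals of bounded functions over the domain *)

Section DomainIntegrals.
Context {R : realType}.
Local Notation P := (measurableTypeR R * measurableTypeR R)%type.
Variable Om : set P.
Hypothesis hOm : convex_polygonal_domain (Om : set (R * R)).

Lemma dom_open : open (Om : set (R * R)).
Proof. by case: hOm. Qed.

Lemma dom_measurable : measurable Om.
Proof. exact: open_measurable_plane dom_open. Qed.

Lemma dom_sub_closure : Om `<=` closure (Om : set (R * R)).
Proof. exact: (@subset_closure (R * R)%type). Qed.

Lemma dom_box : exists B : R,
  closure (Om : set (R * R)) `<=` `[- B, B] `*` `[- B, B].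
Proof.
have [_ _ _ [s ->]] := hOm; have [B HB] := conv_bounded s; exists B => x /HB[h1 h2].
by split; rewrite /= in_itv/= -ler_norml.
Qed.

Lemma dom_compact : compact (closure (Om : set (R * R))).
Proof.
have [B HB] := dom_box.
apply: subclosed_compact HB; first exact: closed_closure.
by apply: compact_setX; exact: segment_compact.
Qed.

Lemma dom_lty : (mu2 Om < +oo)%E.
Proof.
have [B HB] := dom_box.
apply: (@le_lt_trans _ _
  (mu2 ((`[- B, B]%classic : set (measurableTypeR R)) `*` `[- B, B]%classic))).
  apply: le_measure; rewrite ?inE//; [exact: dom_measurable|exact: measurableX|].
  by move=> x /dom_sub_closure/HB.
rewrite mu2_setX// !lebesgue_measure_itv/= lte_fin.
by case: ifP => _; rewrite ?mule0 ?ltry// -!EFinD -EFinM ltry.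
Qed.

(** This class is closed under products, and its members are integrable because the domain has
    finite measure; on it the form [ip] is therefore bilinear. *)
Definition bm (f : P -> R) : Prop :=
  measurable_fun Om f /\ exists B : R, forall x, Om x -> `|f x| <= B.

Lemma bm_cst (a : R) : bm (fun=> a).
Proof. by split; [exact: measurable_cst|exists `|a|]. Qed.

Lemma bmD f g : bm f -> bm g -> bm (fun x => f x + g x).
Proof.
move=> [mf [B HB]] [mg [C HC]]; split; first exact: measurable_funD.
exists (B + C) => x Ox; apply: le_trans (ler_normD _ _) _.
by rewrite lerD ?HB ?HC.
Qed.

Lemma bmM f g : bm f -> bm g -> bm (fun x => f x * g x).
Proof.
move=> [mf [B HB]] [mg [C HC]]; split; first exact: measurable_funM.
by exists (B * C) => x Ox; rewrite normrM ler_pM ?HB ?HC.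
Qed.

Lemma bmZ (a : R) f : bm f -> bm (fun x => a * f x).
Proof. by move=> bf; apply: bmM => //; exact: bm_cst. Qed.

Lemma bmB f g : bm f -> bm g -> bm (fun x => f x - g x).
Proof.
move=> bf bg; have := bmD bf (bmZ (-1) bg).
by congr bm; apply/funext => x; rewrite mulN1r.
Qed.

Lemma bm_sum (I : Type) (s : seq I) (Q : pred I) (F : I -> P -> R) :
  (forall i, Q i -> bm (F i)) -> bm (fun x => \sum_(i <- s | Q i) F i x).
Proof.
move=> bF; elim: s => [|i s IH].
  have := bm_cst 0; congr bm; by apply/funext => x; rewrite big_nil.
have [Qi|Qi] := boolP (Q i).
  have := bmD (bF i Qi) IH; congr bm; by apply/funext => x; rewrite big_cons Qi.
by move: IH; congr bm; apply/funext => x; rewrite big_cons (negPf Qi).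
Qed.

Lemma bm_integrable (D : set P) f : measurable D -> D `<=` Om -> bm f ->
  mu2.-integrable D (EFin \o f).
Proof.
move=> mD DO [mf [B HB]]; apply: measurable_bounded_integrable => //.
- by apply: le_lt_trans dom_lty; apply: le_measure; rewrite ?inE//; exact: dom_measurable.
- by apply: measurable_funS mf => //; exact: dom_measurable.
exists B; split; first exact: num_real.
by move=> C BC x /= Dx; apply: le_trans (HB x (DO x Dx)) (ltW BC).
Qed.

Lemma bm_integrable_dom f : bm f -> mu2.-integrable Om (EFin \o f).
Proof. by move=> bf; apply: bm_integrable => //; exact: dom_measurable. Qed.

Lemma ipC (v w : P -> R) : ip Om v w = ip Om w v.
Proof. by rewrite /ip; congr Rintegral; apply/funext => x; rewrite mulrC. Qed.

Lemma ip_lin (a b : R) (u v w : P -> R) : bm u -> bm v -> bm w ->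
  ip Om (fun x => a * u x + b * v x) w = a * ip Om u w + b * ip Om v w.
Proof.
move=> bu bv bw; have mO := dom_measurable; rewrite /ip.
have -> : (fun x => (a * u x + b * v x) * w x) =
    (fun x => a * (u x * w x) + b * (v x * w x)) by apply/funext => x; ring.
rewrite RintegralD//; last 2 first.
- by apply: bm_integrable_dom; apply: bmZ; exact: bmM.
- by apply: bm_integrable_dom; apply: bmZ; exact: bmM.
by rewrite !RintegralZl//; apply: bm_integrable_dom; exact: bmM.
Qed.

Lemma ip_linr (a b : R) (u v w : P -> R) : bm u -> bm v -> bm w ->
  ip Om w (fun x => a * u x + b * v x) = a * ip Om w u + b * ip Om w v.
Proof. by move=> *; rewrite ipC ip_lin// ipC (ipC v). Qed.

Lemma ip_sum (n : nat) (c : nat -> R) (u : nat -> P -> R) (w : P -> R) :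
  (forall k, (k < n)%N -> bm (u k)) -> bm w ->
  ip Om (fun x => \sum_(k < n) c k * u k x) w = \sum_(k < n) c k * ip Om (u k) w.
Proof.
move=> bu bw; elim: n bu => [|n IH] bu.
  rewrite big_ord0 /ip (_ : (fun x => _) = fun=> 0); last first.
    by apply/funext => x; rewrite big_ord0 mul0r.
  by rewrite Rintegral_cst ?mul0r//; exact: dom_measurable.
rewrite big_ord_recr/= -IH; last by move=> k kn; apply: bu; exact: ltnW.
rewrite -[X in X + _]mul1r -ip_lin//.
- by congr ip; apply/funext => x; rewrite big_ord_recr/= mul1r.
- by apply: bm_sum => k _; apply: bmZ; apply: bu; rewrite ltnS ltnW.
- exact: bu.
Qed.

Lemma ip_ge0 (v : P -> R) : 0 <= ip Om v v.
Proof. by apply: Rintegral_ge0 => x _; rewrite -expr2 sqr_ge0. Qed.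

Lemma le_ip_sqr (v w : P -> R) : bm v -> bm w ->
  (forall x, Om x -> `|v x| <= `|w x|) -> ip Om v v <= ip Om w w.
Proof.
move=> bv bw vw; apply: le_Rintegral; first exact: dom_measurable.
- by apply: bm_integrable_dom; exact: bmM.
- by apply: bm_integrable_dom; exact: bmM.
move=> x Ox; rewrite -!expr2 -(real_normK (num_real (v x))) -(real_normK (num_real (w x))).
by rewrite lerXn2r ?nnegrE ?vw.
Qed.

Lemma ip_cauchy (v w : P -> R) : bm v -> bm w ->
  ip Om v w ^+ 2 <= ip Om v v * ip Om w w.
Proof.
move=> bv bw; apply: sqr_le_mul; rewrite ?ip_ge0// => t.
suff -> : ip Om v v + 2 * t * ip Om v w + t ^+ 2 * ip Om w w =
    ip Om (fun x => 1 * v x + t * w x) (fun x => 1 * v x + t * w x) by exact: ip_ge0.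
have bl : bm (fun x => 1 * v x + t * w x) by apply: bmD; exact: bmZ.
by rewrite ip_lin// !ip_linr// (ipC w v); ring.
Qed.

Lemma L2norm_sqr (v : P -> R) : L2norm Om v ^+ 2 = ip Om v v.
Proof. by rewrite /L2norm sqr_sqrtr// ip_ge0. Qed.

Lemma L2norm_ge0 (v : P -> R) : 0 <= L2norm Om v.
Proof. exact: sqrtr_ge0. Qed.

Lemma ip_le_L2norm (v w : P -> R) : bm v -> bm w ->
  `|ip Om v w| <= L2norm Om v * L2norm Om w.
Proof.
move=> bv bw; rewrite -(@ler_pXn2r _ 2)// ?nnegrE ?mulr_ge0 ?L2norm_ge0//.
by rewrite real_normK ?num_real// exprMn !L2norm_sqr; exact: ip_cauchy.
Qed.

Lemma ip_young (s : R) (v w : P -> R) : 0 < s -> bm v -> bm w ->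
  `|ip Om v w| <= (s * ip Om v v + ip Om w w / s) / 2.
Proof.
move=> s0 bv bw; apply: le_trans (ip_le_L2norm bv bw) _; rewrite -!L2norm_sqr.
set a := L2norm Om v; set b := L2norm Om w.
rewrite ler_pdivlMr// -subr_ge0.
have -> : s * a ^+ 2 + b ^+ 2 / s - a * b * 2 = (s * a - b) ^+ 2 / s.
  by field; rewrite gt_eqF.
by rewrite divr_ge0 ?sqr_ge0// ltW.
Qed.

Lemma bm_within (f : R * R -> R) :
  {within closure (Om : set (R * R)), continuous f} -> bm f.
Proof.
move=> cf; split.
  apply: continuous_measurable_plane; first exact: dom_open.
  rewrite -continuous_open_subspace; last exact: dom_open.
  exact: continuous_subspaceW dom_sub_closure cf.
have [B _ HB] := compact_fun_bounded dom_compact cf.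
by exists B => x /dom_sub_closure; exact: HB.
Qed.

(** The supremum is an upper bound only when the set of norms is bounded, which compactness of the
    space-time cylinder provides. *)
Lemma L2norm_le_sup (T t : R) (f : R -> R * R -> R) : 0 <= T -> 0 <= t <= T ->
  {within `[0, T] `*` closure (Om : set (R * R)), continuous (fun p => f p.1 p.2)} ->
  bm (f t) /\ L2norm Om (f t) <= supL2 Om T f.
Proof.
move=> T0 t0T cf.
have [B B0 HB] : exists2 B : R, 0 < B & forall s x, 0 <= s <= T -> Om x -> `|f s x| <= B.
  have cK : compact (`[0, T] `*` closure (Om : set (R * R))).
    by apply: compact_setX; [exact: segment_compact|exact: dom_compact].
  have [B B0 HB] := compact_fun_bounded cK cf.
  exists B => // s x sT Ox; apply: (HB (s, x)); split => /=; first by rewrite in_itv.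
  exact: dom_sub_closure.
have bmf s : 0 <= s <= T -> bm (f s).
  move=> sT; split; last by exists B => x; exact: HB.
  apply: continuous_measurable_plane; first exact: dom_open.
  move=> x /set_mem Ox; apply/(@cvgrPdist_lt R R^o) => e e0.
  have AOx : (`[0, T] `*` closure (Om : set (R * R))) (s, x).
    by split => /=; [rewrite in_itv|exact: dom_sub_closure].
  move/subspace_continuousP : cf => /(_ _ AOx)/(@cvgrPdist_lt R R^o)/(_ e e0).
  rewrite /within/= => -[[U V] /= [Us Vx] UV].
  have nO : nbhs x Om by apply: open_nbhs_nbhs; split => //; exact: dom_open.
  apply: filterS (filterI Vx nO) => y [Vy Oy]; apply: (UV (s, y)).
    by split => //=; exact: nbhs_singleton.
  by split => /=; [rewrite in_itv|exact: dom_sub_closure].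
split; first exact: bmf.
rewrite /supL2; apply: ub_le_sup; last by exists t => //=; rewrite in_itv.
exists (L2norm Om (fun=> B)) => _ [s /= sT <-]; rewrite in_itv/= in sT.
rewrite /L2norm ler_wsqrtr//; apply: le_ip_sqr; [exact: bmf|exact: bm_cst|].
by move=> x Ox; rewrite (ger0_norm (ltW B0)); exact: HB.
Qed.

End DomainIntegrals.

(** * The lumped mass form *)

Section ReferenceConstants.
Context {R : realType}.
Local Notation P := (measurableTypeR R * measurableTypeR R)%type.
Let rc : set P := @ref_corner R.

Definition tri_area : R := fine (mu2 (@ref_tri R)).
Definition corner_area : R := fine (mu2 rc).
Definition ref_moment (a b e : R) : R := \int[mu2]_(y in rc) (a * y.1 + b * y.2 + e).

Lemma mu2_ref_corner_lty : (mu2 rc < +oo)%E.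
Proof.
apply: le_lt_trans mu2_ref_tri_lty; apply: le_measure; rewrite ?inE.
- exact: measurable_ref_corner.
- exact: measurable_ref_tri.
by apply: subset_trans ref_quad_tri; exact: ref_corner_quad.
Qed.

Lemma integrable_ref_affine (a b e : R) :
  mu2.-integrable rc (EFin \o (fun y : P => a * y.1 + b * y.2 + e : R)).
Proof.
apply: measurable_bounded_integrable.
- exact: measurable_ref_corner.
- exact: mu2_ref_corner_lty.
- by apply: measurable_funS (measurable_affine_form a b e).
exists (`|a| + `|b| + `|e|); split; first exact: num_real.
move=> C BC x /= [h1 h2 h3 h4]; apply: le_trans (ltW BC).
apply: le_trans (ler_normD _ _) _; rewrite lerD2r.
apply: le_trans (ler_normD _ _) _; rewrite !normrM.
have n1 : `|x.1 : R| <= 1 by rewrite ler_norml; lra.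
have n2 : `|x.2 : R| <= 1 by rewrite ler_norml; lra.
by rewrite lerD// -[leRHS]mulr1 ler_wpM2l.
Qed.

Lemma tri_area_gt0 : 0 < tri_area.
Proof.
rewrite fine_gt0// mu2_ref_tri_lty andbT; apply: lt_le_trans mu2_ref_corner_gt0 _.
apply: le_measure; rewrite ?inE.
- exact: measurable_ref_corner.
- exact: measurable_ref_tri.
by apply: subset_trans ref_quad_tri; exact: ref_corner_quad.
Qed.

Lemma corner_area_gt0 : 0 < corner_area.
Proof. by rewrite fine_gt0// mu2_ref_corner_lty mu2_ref_corner_gt0. Qed.

Lemma ref_moment_lin (k l a b e a' b' e' : R) :
  ref_moment (k * a + l * a') (k * b + l * b') (k * e + l * e') =
  k * ref_moment a b e + l * ref_moment a' b' e'.
Proof.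
have m := @measurable_ref_corner R.
rewrite /ref_moment -!RintegralZl//; try exact: integrable_ref_affine.
have i c a1 b1 e1 :
    mu2.-integrable rc (EFin \o (fun y : P => c * (a1 * y.1 + b1 * y.2 + e1) : R)).
  have := integrable_ref_affine (c * a1) (c * b1) (c * e1).
  by congr integrable; apply/funext => y /=; congr EFin; ring.
rewrite -RintegralD//; try exact: i.
by congr Rintegral; apply/funext => y; ring.
Qed.

Lemma ref_moment_ge0 (a b e : R) : (forall y, rc y -> 0 <= a * y.1 + b * y.2 + e) ->
  0 <= ref_moment a b e.
Proof. by move=> h; exact: Rintegral_ge0. Qed.

(** The reference corner is invariant under exchange of the coordinates, so both other vertices get
    the same mass entry. Substitution is used for one nonnegative coordinate; linearity in the
    coefficients does the rest. *)
Lemma ref_moment_swap (a b e : R) : ref_moment a b e = ref_moment b a e.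
Proof.
have H (f : P -> R) : measurable_fun rc f -> (forall x, rc x -> 0 <= f x) ->
    \int[mu2]_(x in rc) f (affine_map 0 1 0 1 0 0 x) = \int[mu2]_(x in rc) f x.
  move=> mf f0; rewrite /Rintegral -[in RHS](@integral_affine R 0 1 0 1 0 0 rc (EFin \o f))//.
  - rewrite mul0r mulr1 sub0r normrN1 mul1e; congr (fine (integral _ _ _)).
    apply/seteqP; split => x; rewrite /preimage/= /affine_map !mul1r !mul0r !addr0 !add0r;
      by case=> h1 h2 h3 h4; split => //=; lra.
  - exact: measurable_ref_corner.
  - exact/measurable_EFinP.
have sw1 : ref_moment 0 1 0 = ref_moment 1 0 0.
  rewrite -[RHS](H (fun y : P => 1 * y.1 + 0 * y.2 + 0 : R)).
  - by congr Rintegral; apply/funext => y; rewrite /affine_map/=; ring.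
  - exact: measurable_funS (measurable_affine_form _ _ _).
  - by move=> x [h1 h2 _ _]; lra.
have E a1 b1 e1 : ref_moment a1 b1 e1 = a1 * ref_moment 1 0 0 +
    1 * (b1 * ref_moment 0 1 0 + e1 * ref_moment 0 0 1).
  by rewrite -!ref_moment_lin; congr ref_moment; ring.
by rewrite (E a b e) (E b a e) sw1; ring.
Qed.

(** The integrand is the barycentric coordinate of the corner vertex minus another one: positive on
    the corner and at least 1/4 on a small square. *)
Lemma ref_moment_gt0 : 0 < ref_moment (-2) (-1) 1.
Proof.
pose B : set P := `]0%R, 4^-1%R] `*` `]0%R, 4^-1%R].
have mB : measurable B by exact: measurableX.
have Brc : B `<=` rc.
  by move=> x [] /=; rewrite !in_itv/= => /andP[? ?] /andP[? ?]; split; lra.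
have muB : mu2 B = (4^-1 * 4^-1)%:E.
  rewrite mu2_setX// !lebesgue_measure_itv/= lte_fin invr_gt0 ltr0n/=.
  by rewrite -!EFinD -EFinM subr0.
rewrite /ref_moment /Rintegral fine_gt0//; apply/andP; split; last first.
  have := integrable_fin_num (measurable_ref_corner) (integrable_ref_affine (-2) (-1) 1).
  by rewrite fin_numE ltey => /andP[_ ->].
apply: (@lt_le_trans _ _ (\int[mu2]_(x in B) (cst (4^-1)%:E x))%E).
  have -> : (\int[mu2]_(x in B) (cst (4^-1)%:E x) = (4^-1)%:E * (4^-1 * 4^-1)%:E :> \bar R)%E.
    by rewrite -muB; exact: integral_cst.
  by rewrite -EFinM lte_fin !mulr_gt0 ?invr_gt0.
apply: (@le_trans _ _ (\int[mu2]_(x in B) (-2 * x.1 + -1 * x.2 + 1)%:E)%E); last first.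
  apply: ge0_subset_integral => //.
  - exact: measurable_ref_corner.
  - by apply/measurable_EFinP; exact: measurable_funS (measurable_affine_form _ _ _).
  - by move=> x [h1 h2 h3 h4]; rewrite lee_fin; lra.
apply: ge0_le_integral => //.
- by move=> x _; rewrite lee_fin invr_ge0.
- by apply/measurable_EFinP; exact: measurable_funS (measurable_affine_form _ _ _).
- move=> x [] /=; rewrite !in_itv/= => /andP[? ?] /andP[? ?]; rewrite lee_fin; lra.
Qed.

(* Integrals over the quadrilateral of a vertex, relative to the area of the
   triangle: of its barycentric coordinate minus another one, of another one, of 1. *)
Definition mass_diag : R := ref_moment (-2) (-1) 1 / tri_area.
Definition mass_off : R := ref_moment 1 0 0 / tri_area.
Definition mass_lump : R := corner_area / tri_area.

Lemma mass_diag_gt0 : 0 < mass_diag.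
Proof. by rewrite divr_gt0 ?ref_moment_gt0 ?tri_area_gt0. Qed.

Lemma mass_off_ge0 : 0 <= mass_off.
Proof.
rewrite divr_ge0 ?(ltW tri_area_gt0)//; apply: ref_moment_ge0 => y [h1 h2 _ _]; lra.
Qed.

Lemma mass_lump_gt0 : 0 < mass_lump.
Proof. by rewrite divr_gt0 ?corner_area_gt0 ?tri_area_gt0. Qed.

End ReferenceConstants.

Section MassForm.
Context {R : realType}.
Local Notation P := (measurableTypeR R * measurableTypeR R)%type.
Variables (Om : set P) (M : mesh R).
Local Notation node := 'I_(nv M).
Implicit Types (K L : {set node}) (z : node).
Hypotheses (hOm : convex_polygonal_domain (Om : set (R * R))) (hM : triangulation Om M).

Lemma bm_affine (a b e : R) : bm Om (fun x => a * x.1 + b * x.2 + e : R).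
Proof.
split; first exact: measurable_funS (measurable_affine_form _ _ _).
have [B HB] := dom_box hOm; exists (`|a| * B + `|b| * B + `|e|) => x Ox.
have [/= h1 h2] := HB x (dom_sub_closure Ox); rewrite in_itv/= -ler_norml in h1.
rewrite in_itv/= -ler_norml in h2.
apply: le_trans (ler_normD _ _) _; rewrite lerD2r.
by apply: le_trans (ler_normD _ _) _; rewrite !normrM lerD// ler_wpM2l.
Qed.

Lemma measurable_ocorner K z : K \in tri M -> z \in K -> measurable (ocorner K z : set P).
Proof.
move=> KM zK; have [y [w c]] := tri_corner hM KM zK; rewrite (corner_ocorner c).
exact: measurable_affine_preimage measurable_ref_corner.
Qed.

Lemma measurable_quad K z : K \in tri M -> z \in K ->
  measurable (quadrilateral K z : set P).
Proof.
move=> KM zK; have [y [w c]] := tri_corner hM KM zK.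
have -> : quadrilateral K z = bcoord (vtx z) (vtx y) (vtx w) @^-1` ref_quad.
  by apply/seteqP; split => x /(corner_quad x c).
exact: measurable_affine_preimage measurable_ref_quad.
Qed.

Lemma mu2_quad_ocorner K z : K \in tri M -> z \in K ->
  mu2 (quadrilateral K z `\` ocorner K z) = 0%E.
Proof.
move=> KM zK; have [y [w c]] := tri_corner hM KM zK; have [_ _ _ D0] := c.
have -> : quadrilateral K z `\` ocorner K z =
    bcoord (vtx z) (vtx y) (vtx w) @^-1` (ref_quad `\` ref_corner).
  rewrite (corner_ocorner c).
  by apply/seteqP; split => x [/(corner_quad x c) h1 h2]; split.
rewrite mu2_bcoord// ?mu2_ref_quad_corner ?mule0//.
by apply: measurableD; [exact: measurable_ref_quad|exact: measurable_ref_corner].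
Qed.

Lemma corner_areaE K z y w : corner K z y w -> K \in tri M ->
  area K = `|tri_det (vtx z) (vtx y) (vtx w)| * tri_area.
Proof.
move=> c KM; have [_ _ _ D0] := c; rewrite /area.
have -> : cell K = bcoord (vtx z) (vtx y) (vtx w) @^-1` ref_tri.
  by apply/seteqP; split => x /(corner_cell x c).
rewrite mu2_bcoord//; last exact: measurable_ref_tri.
by rewrite fineM// ge0_fin_numE// mu2_ref_tri_lty.
Qed.

Lemma area_gt0 K : K \in tri M -> 0 < area K.
Proof.
move=> KM; have [z zK] := tri_nonempty hM KM; have [y [w c]] := tri_corner hM KM zK.
have [_ _ _ D0] := c.
by rewrite (corner_areaE c KM) mulr_gt0 ?tri_area_gt0// normr_gt0.
Qed.

Lemma ocorner_Om K z : K \in tri M -> ocorner K z `<=` Om.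
Proof. by move=> KM x /ocorner_icell; exact: icell_Om. Qed.

(** The closed quadrilaterals cover the domain, the open corners are disjoint subsets of it, and the
    difference between the two families is a null set. *)
Lemma integral_partition (f : P -> R) : bm Om f ->
  \int[mu2]_(x in Om) f x =
  \sum_(K in tri M) \sum_(z in K) \int[mu2]_(x in (ocorner K z : set P)) f x.
Proof.
move=> bf.
(* Pairs that are not a triangle with one of its vertices contribute the empty set, so that unions
   run over a whole finite type. *)
pose valid (p : {set node} * node) := (p.1 \in tri M) && (p.2 \in p.1).
pose F p : set P := if valid p then ocorner p.1 p.2 else set0.
pose G p : set P := if valid p then quadrilateral p.1 p.2 `\` ocorner p.1 p.2 else set0.
have mF p : measurable (F p).
  by rewrite /F; case: ifP => [/andP[? ?]|_]; [exact: measurable_ocorner|exact: measurable0].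
have mG p : measurable (G p).
  rewrite /G; case: ifP => [/andP[? ?]|_]; last exact: measurable0.
  by apply: measurableD; [exact: measurable_quad|exact: measurable_ocorner].
have G0 p : mu2 (G p) = 0%E.
  by rewrite /G; case: ifP => [/andP[? ?]|_]; [exact: mu2_quad_ocorner|exact: measure0].
pose s := enum {: {set node} * node}.
pose U : set P := \big[setU/set0]_(p <- s) F p.
have UE x : U x <-> exists2 p, valid p & ocorner p.1 p.2 x.
  rewrite /U -bigcup_seq; split=> [[p _]|[p vp px]].
    by rewrite /F; case: ifP => // vp px; exists p.
  by exists p; rewrite /= ?mem_enum// /F vp.
pose N : set P := \big[setU/set0]_(p <- s) G p.
have mN : measurable N by apply: bigsetU_measurable => p _.
have N0 : mu2 N = 0%E.
  rewrite /N; elim: s {U UE N mN} => [|p t IH]; first by rewrite big_nil measure0.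
  rewrite big_cons; apply/eqP; rewrite -measure_le0.
  have mt : measurable (\big[setU/set0]_(q <- t) G q) by apply: bigsetU_measurable => q _.
  apply: le_trans (measureU2 _ _ _) _ => //.
  have h1 : (mu2 (G p) <= 0)%E by rewrite G0.
  have h2 : (mu2 (\big[setU/set0]_(q <- t) G q) <= 0)%E by rewrite IH.
  by apply: le_trans (leeD h1 h2) _; rewrite adde0.
have UO : U `<=` Om by move=> x /UE[p /andP[pM _]]; exact: ocorner_Om.
have ON : Om `\` N = U `\` N.
  apply/seteqP; split => x [Ox nN]; split => //; last exact: UO.
  have [K [z [KM zK qx]]] := quad_cover hM (dom_sub_closure Ox).
  apply/UE; exists (K, z); first by rewrite /valid/= KM.
  apply: contrapT => no; apply: nN; rewrite /N -bigcup_seq; exists (K, z) => /=.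
    by rewrite mem_enum.
  by rewrite /G /valid/= KM zK.
have mU : measurable U by apply: bigsetU_measurable => p _.
have mO := dom_measurable hOm.
rewrite /Rintegral (negligible_integral mN mO (bm_integrable_dom hOm bf) N0) ON.
rewrite -(negligible_integral mN mU _ N0); last exact: (bm_integrable hOm).
rewrite integral_bigsetU_EFin//; last 3 first.
- exact: enum_uniq.
- apply/trivIsetP => p q _ _ pq; rewrite /F; case: ifP => [vp|_]; last by rewrite set0I.
  case: ifP => [vq|_]; last by rewrite setI0.
  have /andP[pM pK] := vp; have /andP[qM qK] := vq.
  rewrite -subset0 => x [px qx].
  have [e1 e2] := ocorner_disjoint hM pM pK qM qK px (ocorner_quad hM qM qK qx).
  by case/negP: pq; apply/eqP; rewrite [p]surjective_pairing [q]surjective_pairing e1 e2.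
- by apply/measurable_EFinP; apply: measurable_funS (proj1 bf).
rewrite -sum_fine; last first.
  move=> p _; apply: integrable_fin_num => //; apply: (bm_integrable hOm) => //.
  by rewrite /F; case: ifP => [/andP[pM _]|_]; [exact: ocorner_Om|exact: sub0set].
rewrite /s big_enum/= pair_big_dep/= [RHS]big_mkcond/=; apply: eq_bigr => p _.
rewrite /F -/(valid p); case: ifP => // _; by rewrite integral_set0.
Qed.

Lemma integral_ocorner_P1 K z (u : P -> R) : K \in tri M -> z \in K -> P1_on K u ->
  \int[mu2]_(x in (ocorner K z : set P)) u x =
  area K * (mass_diag * u (vtx z) + mass_off * \sum_(y in K) u (vtx y)).
Proof.
move=> KM zK Pu; have [y [w c]] := tri_corner hM KM zK; have [_ _ _ D0] := c.
pose B := bcoord (vtx z) (vtx y) (vtx w).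
pose l a b e : P -> R := fun x => a * (B x).1 + b * (B x).2 + e.
have oE : (ocorner K z : set P) = B @^-1` ref_corner by rewrite (corner_ocorner c).
have moc := measurable_ocorner KM zK.
have bl a b e : bm Om (l a b e).
  rewrite /l /B /bcoord /affine_map/=.
  set a1 := _ / _; set b1 := _ / tri_det _ _ _; set e1 := - (_ + _).
  set a2 := _ / tri_det _ _ _; set b2 := _ / tri_det _ _ _; set e2 := - (_ + _).
  have := bm_affine (a * a1 + b * a2) (a * b1 + b * b2) (a * e1 + b * e2 + e).
  by congr bm; apply/funext => x; ring.
have il a b e : mu2.-integrable (ocorner K z : set P) (EFin \o l a b e).
  by apply: (bm_integrable hOm) => //; exact: ocorner_Om.
(* Substitution applies to nonnegative integrands, hence to each barycentric coordinate separately
   and not to [u] itself. *)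
have rm a b e : (forall x, ref_corner x -> 0 <= a * x.1 + b * x.2 + e) ->
    \int[mu2]_(x in (ocorner K z : set P)) l a b e x =
    `|tri_det (vtx z) (vtx y) (vtx w)| * ref_moment a b e.
  move=> h; rewrite /Rintegral oE.
  rewrite (@integral_bcoord R _ _ _ ref_corner
     (EFin \o (fun x : P => a * x.1 + b * x.2 + e : R)))//.
  - have fi := integrable_fin_num measurable_ref_corner (integrable_ref_affine a b e).
    by rewrite fineM.
  - exact: measurable_ref_corner.
  - by apply/measurable_EFinP; exact: measurable_funS (measurable_affine_form _ _ _).
pose lz := l (-1) (-1) 1; pose ly := l 1 0 0; pose lw := l 0 1 0.
transitivity (\int[mu2]_(x in (ocorner K z : set P))
    (u (vtx z) * lz x + (u (vtx y) * ly x + u (vtx w) * lw x))).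
  apply: eq_Rintegral => x; rewrite inE => ox.
  have cx : cell K x by apply: icell_cell; exact: ocorner_icell ox.
  have [m [r my mw mz]] := corner_rep_ex x c.
  by rewrite (P1_rep Pu cx r) (corner_sum _ c) mz my mw /lz /ly /lw /l /B; ring.
have iZ (k : R) (g : P -> R) : bm Om g ->
    mu2.-integrable (ocorner K z : set P) (EFin \o (fun x => k * g x)).
  by move=> bg; apply: (bm_integrable hOm) => //; [exact: ocorner_Om|exact: bmZ].
rewrite RintegralD//; last 2 first.
- by apply: iZ; exact: bl.
- apply: (bm_integrable hOm) => //; first exact: ocorner_Om.
  by apply: bmD; apply: bmZ; exact: bl.
rewrite RintegralD//; try by apply: iZ; exact: bl.
rewrite !RintegralZl//; try exact: il.
rewrite !rm; try (by move=> x [h1 h2 h3 h4]; lra).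
rewrite (corner_sum _ c) (corner_areaE c KM) /mass_diag /mass_off.
rewrite (ref_moment_swap 0 1 0).
have -> : ref_moment (-1) (-1) 1 = ref_moment (-2) (-1) 1 + ref_moment 1 0 0 :> R.
  rewrite -[X in X + _]mul1r -[X in _ + X]mul1r -ref_moment_lin.
  by congr ref_moment; ring.
have := @tri_area_gt0 R; set t := tri_area => t0.
by field; rewrite gt_eqF.
Qed.

Lemma mu2_ocorner K z : K \in tri M -> z \in K ->
  fine (mu2 (ocorner K z : set P)) = mass_lump * area K.
Proof.
move=> KM zK; have [y [w c]] := tri_corner hM KM zK; have [_ _ _ D0] := c.
rewrite (corner_ocorner c) mu2_bcoord//; last exact: measurable_ref_corner.
rewrite fineM//; last by rewrite ge0_fin_numE// mu2_ref_corner_lty.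
rewrite (corner_areaE c KM) /mass_lump /corner_area/=.
by have := @tri_area_gt0 R => t0; field; rewrite gt_eqF.
Qed.

Lemma integral_partition_le (f : P -> R) (k : {set node} -> node -> R) : bm Om f ->
  (forall K z x, K \in tri M -> z \in K -> ocorner K z x -> f x <= k K z) ->
  \int[mu2]_(x in Om) f x <=
    mass_lump * \sum_(K in tri M) area K * \sum_(z in K) k K z.
Proof.
move=> bf fk; rewrite (integral_partition bf) mulr_sumr; apply: ler_sum => K KM.
rewrite mulrA mulr_sumr; apply: ler_sum => z zK.
rewrite -(mu2_ocorner KM zK) mulrC -Rintegral_cst; last exact: measurable_ocorner.
apply: le_Rintegral; first exact: measurable_ocorner.
- apply: (bm_integrable hOm) => //; [exact: measurable_ocorner|exact: ocorner_Om].
- apply: (bm_integrable hOm) => //; [exact: measurable_ocorner|exact: ocorner_Om|exact: bm_cst].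
- by move=> x; exact: fk.
Qed.

Lemma measurable_control_volume z : measurable (control_volume z : set P).
Proof.
apply: fin_bigcup_measurable; first exact: finite_finset.
by move=> K /= /andP[KM zK]; exact: measurable_quad.
Qed.

Lemma bm_Ihs v : bm Om (Ihs Om M v).
Proof.
apply: bm_sum => z _; apply: bmZ; split.
  by apply: measurable_indic; exact: measurable_control_volume.
exists 1 => x _; rewrite indicE; case: (_ \in _); rewrite ?normr1 ?normr0//.
Qed.

(** On an open corner all other control volumes are absent. A boundary vertex has no term in the
    sum, and there [v] vanishes by assumption. *)
Lemma Ihs_ocorner v K z x : K \in tri M -> z \in K ->
  (forall z, ~ Om (vtx z) -> v (vtx z) = 0) -> ocorner K z x ->
  Ihs Om M v x = v (vtx z).
Proof.
move=> KM zK v0 ox; rewrite /Ihs.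
have E z' : (\1_(control_volume z') x : R) = (z' == z)%:R.
  rewrite indicE; have [->|zz'] := eqVneq z' z.
    have -> // : x \in control_volume z.
    by apply/mem_set; exists K; [rewrite /= KM zK|exact: (ocorner_quad hM)].
  rewrite memNset// => -[L /= /andP[LM z'L] qx].
  by have [_] := ocorner_disjoint hM KM zK LM z'L ox qx; exact/eqP.
under eq_bigr do rewrite E.
have [zi|zi] := boolP (z \in interior_node Om M).
  rewrite (bigD1 z)//= eqxx mulr1 big1 ?addr0// => z' /andP[_ /negPf->].
  by rewrite mulr0.
rewrite big1 => [|z' z'i]; last first.
  by rewrite (negPf (_ : z' != z)) ?mulr0//; apply: contraNneq zi => <-.
by rewrite v0// => Oz; move: zi; rewrite inE => /negP; apply; exact/mem_set.
Qed.

(** On each triangle the matrix is [mass_diag] times the identity plus [mass_off] times the all-ones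
    matrix, which makes it visibly symmetric and positive definite. The lemma [ip_Ihs] identifies
    the form with the integral of [u] against [Ihs Om M v]. *)
Definition mform (u v : P -> R) : R := \sum_(K in tri M) area K *
  (mass_diag * \sum_(z in K) u (vtx z) * v (vtx z) +
   mass_off * ((\sum_(z in K) u (vtx z)) * (\sum_(z in K) v (vtx z)))).

Definition nodal_energy (u : P -> R) : R :=
  \sum_(K in tri M) area K * \sum_(z in K) u (vtx z) ^+ 2.

(** The consequences of membership in [Vh] used by the estimates: boundedness stands in for the
    Sobolev condition. *)
Definition fe (u : P -> R) : Prop :=
  [/\ bm Om u, forall K, K \in tri M -> P1_on K u & forall x, ~ Om x -> u x = 0].

Lemma mformC u v : mform u v = mform v u.
Proof.
rewrite /mform; apply: eq_bigr => K _; congr (_ * (_ * _ + _ * _)); last exact: mulrC.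
by apply: eq_bigr => z _; rewrite mulrC.
Qed.

Lemma mform_lin (a b : R) u v w :
  mform (fun x => a * u x + b * v x) w = a * mform u w + b * mform v w.
Proof.
rewrite /mform !mulr_sumr -big_split/=; apply: eq_bigr => K _.
have -> : \sum_(z in K) (a * u (vtx z) + b * v (vtx z)) * w (vtx z) =
    a * \sum_(z in K) u (vtx z) * w (vtx z) + b * \sum_(z in K) v (vtx z) * w (vtx z).
  by rewrite !mulr_sumr -big_split/=; apply: eq_bigr => z _; ring.
have -> : \sum_(z in K) (a * u (vtx z) + b * v (vtx z)) =
    a * \sum_(z in K) u (vtx z) + b * \sum_(z in K) v (vtx z).
  by rewrite !mulr_sumr -big_split.
ring.
Qed.

Lemma nodal_energy_ge0 u : 0 <= nodal_energy u.
Proof.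
apply: sumr_ge0 => K KM; rewrite mulr_ge0 ?(ltW (area_gt0 KM))// sumr_ge0// => z _.
exact: sqr_ge0.
Qed.

Lemma mform_ge u : mass_diag * nodal_energy u <= mform u u.
Proof.
rewrite mulr_sumr; apply: ler_sum => K KM; rewrite mulrCA ler_wpM2l ?(ltW (area_gt0 KM))//.
under eq_bigr do rewrite expr2; rewrite lerDl mulr_ge0 ?mass_off_ge0//.
by rewrite -expr2 sqr_ge0.
Qed.

Lemma mform_ge0 u : 0 <= mform u u.
Proof.
by apply: le_trans (mform_ge u); rewrite mulr_ge0 ?(ltW mass_diag_gt0)// nodal_energy_ge0.
Qed.

Lemma mform_cauchy u v : mform u v ^+ 2 <= mform u u * mform v v.
Proof.
apply: sqr_le_mul; rewrite ?mform_ge0// => t.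
pose L := fun x => 1 * u x + t * v x.
suff -> : mform u u + 2 * t * mform u v + t ^+ 2 * mform v v = mform L L by exact: mform_ge0.
have E w : mform L w = 1 * mform u w + t * mform v w by exact: mform_lin.
by rewrite E (mformC u L) (mformC v L) !E (mformC v u); ring.
Qed.

Definition mnorm u : R := Num.sqrt (mform u u).

Lemma mnorm_ge0 u : 0 <= mnorm u. Proof. exact: sqrtr_ge0. Qed.

Lemma mnorm_sqr u : mnorm u ^+ 2 = mform u u.
Proof. by rewrite sqr_sqrtr// mform_ge0. Qed.

Lemma mform_le u v : `|mform u v| <= mnorm u * mnorm v.
Proof.
rewrite -(@ler_pXn2r _ 2)// ?nnegrE ?mulr_ge0 ?mnorm_ge0//.
by rewrite real_normK ?num_real// exprMn !mnorm_sqr; exact: mform_cauchy.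
Qed.

Lemma ip_Ihs u v : bm Om u -> (forall K, K \in tri M -> P1_on K u) ->
  (forall x, ~ Om x -> v x = 0) -> ip Om u (Ihs Om M v) = mform u v.
Proof.
move=> bu Pu v0; rewrite /ip integral_partition; last by apply: bmM => //; exact: bm_Ihs.
apply: eq_bigr => K KM.
transitivity (\sum_(z in K) v (vtx z) * (area K *
    (mass_diag * u (vtx z) + mass_off * \sum_(y in K) u (vtx y)))).
  apply: eq_bigr => z zK; rewrite -integral_ocorner_P1//; last exact: Pu.
  rewrite -RintegralZl; last 2 first.
  - exact: measurable_ocorner.
  - by apply: (bm_integrable hOm) => //; [exact: measurable_ocorner|exact: ocorner_Om].
  apply: eq_Rintegral => x; rewrite inE => ox.
  by rewrite (Ihs_ocorner KM zK _ ox) 1?mulrC// => z' /v0.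
set S := \sum_(y in K) u (vtx y).
transitivity (\sum_(z in K) (area K * mass_diag * (u (vtx z) * v (vtx z)) +
    area K * mass_off * S * v (vtx z))).
  by apply: eq_bigr => z _; ring.
by rewrite big_split/= -!mulr_sumr; ring.
Qed.

Lemma ip_Ihs_Ihs v : (forall x, ~ Om x -> v x = 0) ->
  ip Om (Ihs Om M v) (Ihs Om M v) <= mass_lump * nodal_energy v.
Proof.
move=> v0; apply: (integral_partition_le (k := fun K z => v (vtx z) ^+ 2)).
  by apply: bmM; exact: bm_Ihs.
by move=> K z x KM zK ox; rewrite (Ihs_ocorner KM zK _ ox)// => z' /v0.
Qed.

Lemma ip_fe_le u : bm Om u -> (forall K, K \in tri M -> P1_on K u) ->
  ip Om u u <= 3 * mass_lump * nodal_energy u.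
Proof.
move=> bu Pu; apply: le_trans (integral_partition_le
  (k := fun K _ => \sum_(y in K) u (vtx y) ^+ 2) _ _) _; first exact: bmM.
  move=> K z x KM zK ox; have [y [w c]] := tri_corner hM KM zK.
  have cx : cell K x by apply: icell_cell; exact: ocorner_icell ox.
  have [m r m0] := ocorner_icell ox.
  rewrite (P1_rep (Pu K KM) cx r) !(corner_sum _ c).
  have [_ yK wK _] := corner_mem c.
  have := m0 _ zK; have := m0 _ yK; have := m0 _ wK.
  have [s1 _ _] := r; rewrite (corner_sum _ c) in s1.
  move: s1; set a := m z; set b := m y; set d := m w => s1 d0 b0 a0.
  set p := u _; set q := u (vtx y); set o := u (vtx w).
  (* Convexity of the square, in the form of the variance identity for the weights [a], [b], [d]. *)
  have -> : (a * p + b * q + d * o) * (a * p + b * q + d * o) =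
     a * p ^+ 2 + b * q ^+ 2 + d * o ^+ 2 - (a * b * (p - q) ^+ 2 +
      a * d * (p - o) ^+ 2 + b * d * (q - o) ^+ 2).
    have -> : a = 1 - b - d by lra. ring.
  have h1 : 0 <= a * b * (p - q) ^+ 2 + a * d * (p - o) ^+ 2 + b * d * (q - o) ^+ 2.
    by rewrite !addr_ge0// mulr_ge0 ?sqr_ge0// mulr_ge0// ltW.
  have ha : a * p ^+ 2 <= p ^+ 2 by rewrite ler_piMl ?sqr_ge0//; lra.
  have hb : b * q ^+ 2 <= q ^+ 2 by rewrite ler_piMl ?sqr_ge0//; lra.
  have hd : d * o ^+ 2 <= o ^+ 2 by rewrite ler_piMl ?sqr_ge0//; lra.
  lra.
have -> : \sum_(K in tri M) area K * \sum_(z in K) \sum_(y in K) u (vtx y) ^+ 2 =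
    3 * nodal_energy u.
  rewrite mulr_sumr; apply: eq_bigr => K KM.
  have [_ _ h _ _] := hM; have [K3 _] := h K KM.
  by rewrite sumr_const K3 -mulr_natl; ring.
by rewrite le_eqVlt; apply/orP; left; apply/eqP; ring.
Qed.

(** Young's inequality for [u] against [Ihs Om M u]: with the weight [mass_lump / mass_diag], the
    norm of [Ihs Om M u] costs half of the form itself and is absorbed. *)
Lemma mform_le_ip u : fe u -> mform u u <= mass_lump / mass_diag * ip Om u u.
Proof.
move=> [bu Pu u0]; have l0 := @mass_lump_gt0 R; have d0 := @mass_diag_gt0 R.
have s0 : 0 < mass_lump / mass_diag :> R by rewrite divr_gt0.
have := ip_young hOm s0 bu (bm_Ihs u); rewrite ip_Ihs// ger0_norm ?mform_ge0//.
have h1 : ip Om (Ihs Om M u) (Ihs Om M u) / (mass_lump / mass_diag) <= mform u u.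
  apply: le_trans (mform_ge u); rewrite ler_pdivrMr//.
  apply: le_trans (ip_Ihs_Ihs u0) _; rewrite le_eqVlt; apply/orP; left; apply/eqP; field.
  by rewrite !gt_eqF.
by lra.
Qed.

Lemma ip_le_mform u : fe u -> ip Om u u <= 3 * mass_lump / mass_diag * mform u u.
Proof.
move=> [bu Pu u0]; apply: le_trans (ip_fe_le bu Pu) _.
have := mform_ge u; have := @mass_lump_gt0 R; have := @mass_diag_gt0 R.
move: (@mass_lump R) (@mass_diag R) => l d d0 l0 h.
have -> : 3 * l / d * mform u u = 3 * l * (mform u u / d) by ring.
by rewrite ler_wpM2l ?mulr_ge0 ?(ltW l0)// ler_pdivlMr// mulrC.
Qed.

Lemma ip_Ihs_le_mform v : (forall x, ~ Om x -> v x = 0) ->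
  ip Om (Ihs Om M v) (Ihs Om M v) <= mass_lump / mass_diag * mform v v.
Proof.
move=> v0; apply: le_trans (ip_Ihs_Ihs v0) _.
have := mform_ge v; have := @mass_lump_gt0 R; have := @mass_diag_gt0 R.
move: (@mass_lump R) (@mass_diag R) => l d d0 l0 h.
have -> : l / d * mform v v = l * (mform v v / d) by ring.
by rewrite ler_wpM2l ?(ltW l0)// ler_pdivlMr// mulrC.
Qed.

Definition grad_energy (u : P -> R) : R :=
  \sum_(K in tri M) area K * (d1 u (bary K) ^+ 2 + d2 u (bary K) ^+ 2).

(** On a corner the difference is the gradient applied to a displacement of length at most the mesh
    size; the factor 3 counts the corners of a triangle. *)
Lemma ip_sub_Ihs u : fe u ->
  ip Om (fun x => u x - Ihs Om M u x) (fun x => u x - Ihs Om M u x) <=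
  3 * mass_lump * meshsize M ^+ 2 * grad_energy u.
Proof.
move=> [bu Pu u0]; apply: le_trans (integral_partition_le (k := fun K _ =>
  meshsize M ^+ 2 * (d1 u (bary K) ^+ 2 + d2 u (bary K) ^+ 2)) _ _) _.
- by apply: bmM; apply: bmB => //; exact: bm_Ihs.
- move=> K z x KM zK ox; rewrite (Ihs_ocorner KM zK _ ox) => [|z' /u0//].
  have [a [b [c E]]] := Pu K KM.
  have [-> ->] := d12_icell hM KM (bary_icell hM KM) E.
  have cx : cell K x by apply: icell_cell; exact: ocorner_icell ox.
  have dh := dist_meshsize KM cx (vtx_cell zK).
  have dh2 : (x.1 - (vtx z).1) ^+ 2 + (x.2 - (vtx z).2) ^+ 2 <= meshsize M ^+ 2.
    rewrite -[leLHS]sqr_sqrtr ?addr_ge0 ?sqr_ge0// lerXn2r ?nnegrE ?sqrtr_ge0//.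
    exact: ltW (meshsize_gt0 hOm hM).
  rewrite !E//; last exact: vtx_cell.
  have := sqr_ge0 (b * (x.2 - (vtx z).2) - c * (x.1 - (vtx z).1)).
  have := ler_wpM2r (addr_ge0 (sqr_ge0 b) (sqr_ge0 c)) dh2; lra.
rewrite mulr_sumr mulr_sumr; apply: ler_sum => K KM.
have [_ _ h _ _] := hM; have [K3 _] := h K KM.
rewrite sumr_const K3 -mulr_natl; rewrite le_eqVlt; apply/orP; left; apply/eqP; ring.
Qed.

End MassForm.

(* No measurability is required: the integral of a nonnegative function is the
   supremum over the simple functions below it. *)
Lemma ge0_le_integral_nonmeasurable d (T : measurableType d) (R : realType)
    (mu : {measure set T -> \bar R}) (D : set T) (f g : T -> \bar R) :
  (forall x, D x -> 0 <= f x)%E -> (forall x, D x -> f x <= g x)%E ->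
  (\int[mu]_(x in D) f x <= \int[mu]_(x in D) g x)%E.
Proof.
move=> f0 fg; rewrite !ge0_integralE//; last first.
  by move=> x Dx; apply: le_trans (f0 x Dx) (fg x Dx).
apply: ub_ereal_sup => _ [h hf <-]; apply: ereal_sup_ubound; exists h => // x.
apply: le_trans (hf x) _; rewrite /patch; case: ifPn => //; rewrite inE; exact: fg.
Qed.

(* Where the derivative does not exist, [derive1] is the junk value [point]. *)
Lemma derive1_bounded (R : realType) (g : R -> R) (a B : R) :
  (\forall s \near a, `|g s - g a| <= B * `|s - a|) ->
  `|derive1 g a| <= B + `|point : R|.
Proof.
move=> H; rewrite /derive1; set F := (X in lim X).
have nF : \forall h \near 0^', `|h^-1 *: (g (h + a) - g a)| <= B.
  have [r /= r0 rH] := (iffLR (nbhs_ballP _ _)) H.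
  apply/nbhs_ballP; exists r => //= h h0r hn0.
  have := rH (h + a); rewrite /ball/= opprD addrCA subrr addr0 normrN.
  move: h0r; rewrite /ball/= sub0r normrN => hr /(_ hr).
  rewrite addrK normrM normfV ler_pdivrMl ?normr_gt0//.
  by rewrite mulrC.
have B0 : 0 <= B.
  by have [h hB] := filter_ex nF; apply: le_trans hB.
have [cvF|nc] := pselect (cvg F); last by rewrite dvgP// lerDr.
apply: (@le_trans _ _ B); last by rewrite lerDl.
rewrite ler_norml; apply/andP; split.
  by apply: limr_ge => //; apply: filterS nF => h; rewrite ler_norml => /andP[].
by apply: limr_le => //; apply: filterS nF => h; rewrite ler_norml => /andP[].
Qed.

(** * Classical gradients of finite element functions and the H1 norm *)

Section Gradients.
Context {R : realType}.
Local Notation P := (measurableTypeR R * measurableTypeR R)%type.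
Variables (Om : set P) (M : mesh R).
Local Notation node := 'I_(nv M).
Implicit Types (K L : {set node}) (z : node).
Hypotheses (hOm : convex_polygonal_domain (Om : set (R * R))) (hM : triangulation Om M).

Lemma Vh_fe v : Vh Om M v -> fe Om M v.
Proof.
move=> [[[mv _] _] v0 Pv]; split => //; split => //.
exists (\sum_(z : node) `|v (vtx z)|) => x Ox.
have [K [z [KM zK qx]]] := quad_cover hM (dom_sub_closure Ox).
have cx := quad_cell hM KM zK qx.
have /cellP[m r m0] := cx.
rewrite (P1_rep (Pv K KM) cx r); apply: le_trans (ler_norm_sum _ _ _) _.
rewrite [leRHS](bigID (mem K))/= -[leLHS]addr0 lerD ?sumr_ge0//.
apply: ler_sum => y yK; rewrite normrM (ger0_norm (m0 y yK)) ler_piMl//.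
by have [<- _ _] := r; rewrite (bigD1 y)//= lerDl sumr_ge0// => u /andP[uK _]; exact: m0.
Qed.

Lemma fe_eq0 u : fe Om M u -> (forall z : node, u (vtx z) = 0) -> u = fun=> 0.
Proof.
move=> [_ Pu u0] uz; apply/funext => x; have [Ox|/u0//] := pselect (Om x).
have [K [z [KM zK qx]]] := quad_cover hM (dom_sub_closure Ox).
have cx := quad_cell hM KM zK qx; have /cellP[m r m0] := cx.
by rewrite (P1_rep (Pu K KM) cx r) big1// => y _; rewrite uz mulr0.
Qed.

Lemma closed_cell K : K \in tri M -> closed (cell K).
Proof.
move=> KM; have [z zK] := tri_nonempty hM KM; have [y [w c]] := tri_corner hM KM zK.
have -> : cell K = bcoord (vtx z) (vtx y) (vtx w) @^-1` ref_tri.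
  by apply/seteqP; split => x /(corner_cell x c).
rewrite -[X in closed X]setCK; apply: open_closedC.
rewrite /bcoord /=; set a := _ / _; set b := _ / tri_det _ _ _; set e := - (_ + _).
set a' := _ / tri_det _ _ _; set b' := _ / tri_det _ _ _; set e' := - (_ + _).
have -> : ~` (affine_map a b e a' b' e' @^-1` ref_tri) =
    [set x : R * R | 0 < (- a) * x.1 + (- b) * x.2 + (- e)] `|`
    [set x : R * R | 0 < (- a') * x.1 + (- b') * x.2 + (- e')] `|`
    [set x : R * R | 0 < (a + a') * x.1 + (b + b') * x.2 + (e + e' - 1)].
  apply/seteqP; split => x; rewrite /affine_map/=.
    move=> nx; apply: contrapT => /not_orP[/not_orP[/negP n1 /negP n2] /negP n3].
    by apply: nx; rewrite -!leNgt in n1 n2 n3; split => /=; lra.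
  by move=> h [/= h1 h2 h3]; case: h => [[] h | h]; lra.
by do 2 (apply: openU; last exact: open_affine_gt0); exact: open_affine_gt0.
Qed.

(** The finitely many closed triangles that miss [x] also miss a neighbourhood of it. Hence [x] and
    a nearby [y] lie in a common triangle, which gives a Lipschitz bound across the edges. *)
Lemma near_cells (x : R * R) :
  \forall y \near x, forall K, K \in tri M -> cell K y -> cell K x.
Proof.
have nearT (Q : R * R -> Prop) : (forall y, Q y) -> \forall y \near x, Q y.
  by move=> h; apply: (filterS (P := setT)) => [y _|]; [exact: h|exact: filterT].
have H (s : seq {set node}) :
    \forall y \near x, forall K, K \in s -> K \in tri M -> cell K y -> cell K x.
  elim: s => [|L s IH]; first by apply: nearT => y K.
  have HL : \forall y \near x, L \in tri M -> cell L y -> cell L x.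
    have [cx|nx] := pselect (cell L x); first exact: nearT.
    have [LM|LM] := boolP (L \in tri M); last exact: nearT.
    have /open_nbhs_nbhs : open_nbhs x (~` cell L).
      by split => //; apply: closed_openC; exact: closed_cell.
    by apply: filterS => y.
  apply: filterS (filterI IH HL) => y [h1 h2] K; rewrite inE => /predU1P[->//|].
  exact: h1.
by apply: filterS (H (enum {: {set node}})) => y h K; apply: h; rewrite mem_enum.
Qed.

Lemma fe_near_lipschitz u : fe Om M u -> exists2 B : R, 0 <= B & forall x, Om x ->
  \forall y \near x, `|u y - u x| <= B * (`|y.1 - x.1| + `|y.2 - x.2|).
Proof.
move=> [_ Pu _].
exists (\sum_(K in tri M) (`|d1 u (bary K)| + `|d2 u (bary K)|)).
  by apply: sumr_ge0 => K _; rewrite addr_ge0.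
move=> x Ox.
have nO : \forall y \near x, Om y by apply: open_nbhs_nbhs; split => //; exact: dom_open.
apply: filterS (filterI nO (near_cells x)) => y [Oy cxy].
have [K [z [KM zK qy]]] := quad_cover hM (dom_sub_closure Oy).
have cy := quad_cell hM KM zK qy; have cx := cxy K KM cy.
have [a [b [c E]]] := Pu K KM.
have [eb ec] := d12_icell hM KM (bary_icell hM KM) E.
rewrite (bigD1 K)//= eb ec !E//.
have -> : a + b * y.1 + c * y.2 - (a + b * x.1 + c * x.2) =
    b * (y.1 - x.1) + c * (y.2 - x.2) by ring.
apply: le_trans (ler_normD _ _) _; rewrite !normrM.
set S := \sum_(_ in _ | _) _.
have S0 : 0 <= S by apply: sumr_ge0 => ? _; rewrite addr_ge0.
have := normr_ge0 b; have := normr_ge0 c.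
have := normr_ge0 (y.1 - x.1); have := normr_ge0 (y.2 - x.2).
nra.
Qed.

(** The bound holds on the edges too, where a derivative may be the default value; it keeps the
    integrals of the squares finite. *)
Lemma fe_d12_bounded u : fe Om M u ->
  exists B : R, forall x, Om x -> `|d1 u x| <= B /\ `|d2 u x| <= B.
Proof.
move=> fu; have [B B0 HB] := fe_near_lipschitz fu.
exists (B + `|point : R|) => x Ox.
have [r /= r0 rH] := (iffLR (nbhs_ballP _ _)) (HB x Ox).
split; apply: derive1_bounded; apply/nbhs_ballP; exists r => //= s xs.
  have := rH (s, x.2); rewrite /= subrr normr0 addr0 -surjective_pairing; apply.
  by split => //=; exact: ballxx.
have := rH (x.1, s); rewrite /= subrr normr0 add0r -surjective_pairing; apply.
by split => //=; exact: ballxx.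
Qed.

(** A measurable step function below [g ^ 2] is integrated exactly, so no measurability of [g] is
    involved. The bound [B] excludes an infinite integral, whose real value would be 0. *)
Lemma piecewise_energy_le (g : P -> R) (k : {set node} -> R) (B : R) :
  (forall x, Om x -> `|g x| <= B) ->
  (forall K x, K \in tri M -> icell K x -> g x = k K) ->
  3 * mass_lump * \sum_(K in tri M) area K * k K ^+ 2 <= ip Om g g.
Proof.
move=> gB gk.
pose f (x : P) : R := \sum_(K in tri M) \sum_(z in K) k K ^+ 2 * \1_(ocorner K z) x.
have bf : bm Om f.
  apply: bm_sum => K KM; apply: bm_sum => z zK; apply: bmZ; split.
    by apply: measurable_indic; exact: (measurable_ocorner hM).
  by exists 1 => x _; rewrite indicE; case: (_ \in _); rewrite ?normr1 ?normr0.
have fE K z x : K \in tri M -> z \in K -> ocorner K z x -> f x = k K ^+ 2.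
  move=> KM zK ox; rewrite /f (bigD1 K)//= (bigD1 z)//= indicE mem_set// mulr1.
  have nul L y : L \in tri M -> y \in L -> (L != K) || (y != z) -> \1_(ocorner L y) x = 0 :> R.
    move=> LM yL ne; rewrite indicE memNset// => ox'.
    have [e1 e2] := ocorner_disjoint hM KM zK LM yL ox (ocorner_quad hM LM yL ox').
    by move: ne; rewrite e1 e2 !eqxx.
  rewrite big1 => [|y /andP[yK yz]]; last by rewrite nul ?mulr0// yz orbT.
  rewrite big1 ?addr0// => L /andP[LM LK]; rewrite big1// => y yL.
  by rewrite nul ?mulr0// LK.
have f0 x : 0 <= f x.
  apply: sumr_ge0 => K _; apply: sumr_ge0 => z _.
  by rewrite mulr_ge0 ?sqr_ge0// indicE ler0n.
have fg x : f x <= g x * g x.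
  have [[K [z [KM zK ox]]]|no] := pselect (exists K z, [/\ K \in tri M, z \in K & ocorner K z x]).
    by rewrite (fE K z x)// (gk K x KM (ocorner_icell ox)) expr2.
  rewrite -expr2 /f big1 ?sqr_ge0// => K KM; rewrite big1// => z zK.
  by rewrite indicE memNset ?mulr0// => ox; apply: no; exists K, z.
have -> : 3 * mass_lump * \sum_(K in tri M) area K * k K ^+ 2 = \int[mu2]_(x in Om) f x.
  rewrite (integral_partition hOm hM bf) mulr_sumr; apply: eq_bigr => K KM.
  rewrite (eq_bigr (fun _ => k K ^+ 2 * (mass_lump * area K))) => [|z zK]; last first.
    rewrite -(mu2_ocorner hM KM zK) -Rintegral_cst; last exact: (measurable_ocorner hM).
    by apply: eq_Rintegral => x; rewrite inE => ox; rewrite (fE K z x).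
  have [_ _ h _ _] := hM; have [K3 _] := h K KM.
  by rewrite sumr_const K3 -mulr_natl; ring.
rewrite /ip /Rintegral fine_le//.
- by have := integrable_fin_num (dom_measurable hOm) (bm_integrable_dom hOm bf).
- rewrite ge0_fin_numE; last first.
    by apply: integral_ge0 => x _; rewrite lee_fin -expr2 sqr_ge0.
  apply: (@le_lt_trans _ _ (\int[mu2]_(x in Om) (cst (B ^+ 2)%:E x))%E).
    apply: ge0_le_integral_nonmeasurable => x Ox; first by rewrite lee_fin -expr2 sqr_ge0.
    rewrite lee_fin -expr2 -(real_normK (num_real (g x))) lerXn2r ?nnegrE ?gB//.
    exact: le_trans (gB x Ox).
  rewrite integral_cst; last exact: (dom_measurable hOm).
  by rewrite lte_mul_pinfty ?lee_fin ?sqr_ge0//; exact: (dom_lty hOm).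
- by apply: ge0_le_integral_nonmeasurable => x _; rewrite lee_fin.
Qed.

Lemma H1norm_ge0 (v : P -> R) : 0 <= H1norm Om v.
Proof. exact: sqrtr_ge0. Qed.

Lemma H1norm_sqr (v : P -> R) :
  H1norm Om v ^+ 2 = ip Om v v + ip Om (d1 v) (d1 v) + ip Om (d2 v) (d2 v).
Proof. by rewrite sqr_sqrtr// !addr_ge0 ?ip_ge0. Qed.

Lemma L2norm_le_H1norm (v : P -> R) : L2norm Om v <= H1norm Om v.
Proof.
by rewrite /L2norm /H1norm ler_wsqrtr// -addrA lerDl addr_ge0 ?ip_ge0.
Qed.

Lemma grad_energy_le_H1norm u : fe Om M u ->
  3 * mass_lump * grad_energy M u <= H1norm Om u ^+ 2.
Proof.
move=> fu; have [B HB] := fe_d12_bounded fu; have [bu Pu u0] := fu.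
have dE K x : K \in tri M -> icell K x -> d1 u x = d1 u (bary K) /\ d2 u x = d2 u (bary K).
  move=> KM ix; have [a [b [c E]]] := Pu K KM.
  have [-> ->] := d12_icell hM KM ix E.
  by have [-> ->] := d12_icell hM KM (bary_icell hM KM) E.
have h1 := @piecewise_energy_le (d1 u) (fun K => d1 u (bary K)) B
  (fun x Ox => proj1 (HB x Ox)) (fun K x KM ix => proj1 (dE K x KM ix)).
have h2 := @piecewise_energy_le (d2 u) (fun K => d2 u (bary K)) B
  (fun x Ox => proj2 (HB x Ox)) (fun K x KM ix => proj2 (dE K x KM ix)).
rewrite H1norm_sqr.
have -> : grad_energy M u = \sum_(K in tri M) area K * d1 u (bary K) ^+ 2 +
    \sum_(K in tri M) area K * d2 u (bary K) ^+ 2.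
  by rewrite -big_split/=; apply: eq_bigr => K _; rewrite mulrDr.
by rewrite mulrDr -addrA (le_trans (lerD h1 h2))// lerDr ip_ge0.
Qed.

End Gradients.

(** * The finite volume form *)

Section BilinearForm.
Context {R : realType}.
Local Notation P := (measurableTypeR R * measurableTypeR R)%type.
Variables (Om : set P) (M : mesh R) (A : R * R -> 'M[R]_2).
Local Notation node := 'I_(nv M).
Implicit Types (K L : {set node}) (z : node).
Hypotheses (hOm : convex_polygonal_domain (Om : set (R * R))) (hM : triangulation Om M).

Lemma dotE (a b : 'cV[R]_2) : dot a b = a 0 0 * b 0 0 + a 1 0 * b 1 0.
Proof.
rewrite /dot mxE !big_ord_recl big_ord0 !mxE addr0.
by rewrite (_ : lift 0 0 = 1)//; apply/val_inj.
Qed.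

Lemma dot_mulmx (B : 'M[R]_2) (g n : 'cV[R]_2) : dot (B *m g) n =
  (B 0 0 * g 0 0 + B 0 1 * g 1 0) * n 0 0 + (B 1 0 * g 0 0 + B 1 1 * g 1 0) * n 1 0.
Proof.
rewrite dotE !mxE !big_ord_recl !big_ord0 !addr0.
by rewrite (_ : lift 0 0 = 1)//; apply/val_inj.
Qed.

Lemma grad0 (v : P -> R) x : grad v x 0 0 = d1 v x.
Proof. by rewrite mxE. Qed.

Lemma grad1 (v : P -> R) x : grad v x 1 0 = d2 v x.
Proof. by rewrite mxE. Qed.

Lemma elliptic_bounds (beta0 : R) : symmetric_elliptic Om A beta0 ->
  exists2 b1 : R, 0 < b1 & forall x (g : 'cV[R]_2), closure (Om : set (R * R)) x ->
    beta0 * (g 0 0 ^+ 2 + g 1 0 ^+ 2) <= dot (A x *m g) g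
      <= b1 * (g 0 0 ^+ 2 + g 1 0 ^+ 2).
Proof.
move=> [cA _ eA].
have bA i j := compact_fun_bounded (dom_compact hOm) (cA i j).
have [b00 p00 h00] := bA 0 0; have [b01 p01 h01] := bA 0 1.
have [b10 p10 h10] := bA 1 0; have [b11 p11 h11] := bA 1 1.
exists (b00 + b01 + b10 + b11); first by rewrite !addr_gt0.
move=> x g cx; apply/andP; split.
  have := eA x g cx; rewrite !dotE -!expr2.
  by rewrite [g 0 0 * _]mulrC [g 1 0 * _]mulrC.
have := h00 x cx; have := h01 x cx; have := h10 x cx; have := h11 x cx.
rewrite dot_mulmx; rewrite !ler_norml; set p := g 0 0; set q := g 1 0.
move: (A x 0 0) (A x 0 1) (A x 1 0) (A x 1 1) => a b c d.
move=> /andP[d1' d2'] /andP[c1 c2] /andP[b1 b2] /andP[a1 a2].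
have pq : `|p * q| <= (p ^+ 2 + q ^+ 2) / 2.
  rewrite ler_norml; have := sqr_ge0 (p - q); have := sqr_ge0 (p + q).
  by rewrite !sqrrD sqrrN; lra.
have off (e k : R) : - k <= e <= k -> e * (p * q) <= k * (p ^+ 2 + q ^+ 2).
  move=> ek; have k0 : 0 <= k by lra.
  apply: le_trans (ler_norm _) _; rewrite normrM ler_pM//; first by rewrite ler_norml.
  by apply: le_trans pq _; have := sqr_ge0 p; have := sqr_ge0 q; lra.
have hb : b * (p * q) <= b01 * (p ^+ 2 + q ^+ 2) by apply: off; rewrite b1.
have hc : c * (p * q) <= b10 * (p ^+ 2 + q ^+ 2) by apply: off; rewrite c1.
have ha : a * p ^+ 2 <= b00 * (p ^+ 2 + q ^+ 2).
  apply: le_trans (ler_wpM2r (sqr_ge0 p) a2) _.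
  by rewrite ler_wpM2l ?(ltW p00)// lerDl sqr_ge0.
have hd : d * q ^+ 2 <= b11 * (p ^+ 2 + q ^+ 2).
  apply: le_trans (ler_wpM2r (sqr_ge0 q) d2') _.
  by rewrite ler_wpM2l ?(ltW p11)// lerDr sqr_ge0.
have -> : (a * p + b * q) * p + (c * p + d * q) * q =
    a * p ^+ 2 + b * (p * q) + (c * (p * q) + d * q ^+ 2) by ring.
have -> : (b00 + b01 + b10 + b11) * (p ^+ 2 + q ^+ 2) =
    b00 * (p ^+ 2 + q ^+ 2) + b01 * (p ^+ 2 + q ^+ 2) +
    (b10 * (p ^+ 2 + q ^+ 2) + b11 * (p ^+ 2 + q ^+ 2)) by ring.
by apply: lerD; apply: lerD.
Qed.

Definition discrete_form (v w : P -> R) : R :=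
  \sum_(K in tri M) area K * dot (A (bary K) *m gradK K v) (gradK K w).

Lemma discrete_form_bounds (beta0 b1 : R) v :
  (forall x (g : 'cV[R]_2), closure (Om : set (R * R)) x ->
    beta0 * (g 0 0 ^+ 2 + g 1 0 ^+ 2) <= dot (A x *m g) g
      <= b1 * (g 0 0 ^+ 2 + g 1 0 ^+ 2)) ->
  beta0 * grad_energy M v <= discrete_form v v <= b1 * grad_energy M v.
Proof.
move=> h; have hK K : K \in tri M ->
    beta0 * (d1 v (bary K) ^+ 2 + d2 v (bary K) ^+ 2) <=
    dot (A (bary K) *m gradK K v) (gradK K v) <=
    b1 * (d1 v (bary K) ^+ 2 + d2 v (bary K) ^+ 2).
  move=> KM; have := h (bary K) (gradK K v); rewrite /gradK grad0 grad1; apply.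
  by apply: (cell_closure hM KM); apply: icell_cell; exact: (bary_icell hM).
apply/andP; split; rewrite mulr_sumr; apply: ler_sum => K KM;
  rewrite mulrCA ler_wpM2l ?(ltW (area_gt0 hM KM))//;
  by have /andP[] := hK K KM.
Qed.

Lemma fe_grad_lin (a b : R) v w K : K \in tri M -> P1_on K v -> P1_on K w ->
  d1 (lin a b v w) (bary K) = a * d1 v (bary K) + b * d1 w (bary K) /\
  d2 (lin a b v w) (bary K) = a * d2 v (bary K) + b * d2 w (bary K).
Proof.
move=> KM [p [q [r E]]] [p' [q' [r' E']]].
have iK := bary_icell hM KM.
have [-> ->] := d12_icell hM KM iK E; have [-> ->] := d12_icell hM KM iK E'.
apply: (d12_icell hM KM iK (a := a * p + b * p')) => x cx.
by rewrite /lin E// E'//; ring.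
Qed.

Definition seg_flux (g : 'cV[R]_2) x y p : R :=
  segment_integral x y (fun s => dot (A s *m g) (normal_away x y p)).

Lemma cell_segment K x y (t : R) : cell K x -> cell K y -> 0 <= t <= 1 ->
  cell K (x.1 + t * (y.1 - x.1), x.2 + t * (y.2 - x.2)).
Proof.
move=> /cellP[m [s1 x1 x2] m0] /cellP[n [t1 y1 y2] n0] t01.
have E (F : node -> R) : \sum_(v in K) (m v + t * (n v - m v)) * F v =
    \sum_(v in K) m v * F v + t * (\sum_(v in K) n v * F v - \sum_(v in K) m v * F v).
  by rewrite -sumrB mulr_sumr -big_split/=; apply: eq_bigr => v _; ring.
apply/cellP; exists (fun v => m v + t * (n v - m v)).
  split; rewrite /= ?E ?x1 ?x2 ?y1 ?y2//.
  have -> : \sum_(v in K) (m v + t * (n v - m v)) =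
      \sum_(v in K) m v + t * (\sum_(v in K) n v - \sum_(v in K) m v).
    by rewrite -sumrB mulr_sumr -big_split.
  by rewrite s1 t1; ring.
by move=> v vK; have := m0 v vK; have := n0 v vK; move: t01 => /andP[? ?]; nra.
Qed.

(** Linearity of the integral needs integrability, which comes from the continuity of [A] along a
    segment that stays in the closed triangle. *)
Lemma seg_flux_lin (beta0 : R) (g : 'cV[R]_2) K x y p : symmetric_elliptic Om A beta0 ->
  K \in tri M -> cell K x -> cell K y ->
  seg_flux g x y p = g 0 0 * seg_flux (col2 1 0) x y p + g 1 0 * seg_flux (col2 0 1) x y p.
Proof.
move=> [cA _ _] KM cx cy.
pose pt (t : R) : R * R := (x.1 + t * (y.1 - x.1), x.2 + t * (y.2 - x.2)).
have ptc t : 0 <= t <= 1 -> closure (Om : set (R * R)) (pt t).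
  by move=> t01; apply: (cell_closure hM KM); exact: cell_segment.
have cpt : continuous pt.
  have cpt1 (p0 q0 : R) : continuous (fun s : R => p0 + s * q0 : R).
    move=> t; apply: cvgD; first exact: cvg_cst.
    by apply: cvgM; [exact: cvg_id|exact: cvg_cst].
  by move=> t; exact: (cvg_pair (cpt1 _ _ t) (cpt1 _ _ t)).
have cAp i j : {within `[0, 1], continuous (fun t : R => A (pt t) i j)}.
  apply/subspace_continuousP => t t01.
  have t01' : 0 <= t <= 1 by move: t01; rewrite /= in_itv.
  apply/(@cvgrPdist_lt R R^o) => e e0.
  have /subspace_continuousP/(_ _ (ptc t t01'))/(@cvgrPdist_lt R R^o)/(_ e e0) := cA i j.
  rewrite /within/= => h; have nh : nbhs (t : R) (fun s : R => closure (Om : set (R * R)) (pt s) ->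
      `|A (pt t) i j - A (pt s) i j| < e) := cpt t _ h.
  suff : nbhs (t : R) (fun s : R => `[0, 1]%classic s ->
      `|A (pt t) i j - A (pt s) i j| < e) by [].
  apply: filterS nh => s hs s01; apply: hs; apply: ptc.
  by move: s01; rewrite /= in_itv.
have iA i j (c : R) : (@lebesgue_measure R).-integrable `[0, 1]
    (EFin \o (fun t => c * A (pt t) i j)).
  apply: continuous_compact_integrable; first exact: segment_compact.
  by move=> t; apply: cvgM; [exact: cvg_cst|exact: cAp].
pose n := normal_away x y p.
pose I i j : R := \int[lebesgue_measure]_(t in `[0, 1]) A (pt t) i j.
have iA1 i j : (@lebesgue_measure R).-integrable `[0, 1]
    (EFin \o (fun t => A (pt t) i j)).
  by have := iA i j 1; congr integrable; apply/funext => t /=; rewrite mul1r.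
have E (h : 'cV[R]_2) : seg_flux h x y p = eucl_dist x y *
    ((n 0 0 * h 0 0) * I 0 0 + ((n 0 0 * h 1 0) * I 0 1 +
     ((n 1 0 * h 0 0) * I 1 0 + (n 1 0 * h 1 0) * I 1 1))).
  rewrite /seg_flux /segment_integral; congr (_ * _).
  transitivity (\int[lebesgue_measure]_(t in `[0, 1])
    ((n 0 0 * h 0 0) * A (pt t) 0 0 + ((n 0 0 * h 1 0) * A (pt t) 0 1 +
     ((n 1 0 * h 0 0) * A (pt t) 1 0 + (n 1 0 * h 1 0) * A (pt t) 1 1)))).
    by apply: eq_Rintegral => t _; rewrite dot_mulmx -/(pt t) -/n; ring.
  have D2 : (@lebesgue_measure R).-integrable `[0, 1] (EFin \o (fun t =>
      (n 1 0 * h 0 0) * A (pt t) 1 0 + (n 1 0 * h 1 0) * A (pt t) 1 1)).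
    exact: (@integrableD _ _ _ _ _ _ _ _ (iA 1 0 _) (iA 1 1 _)).
  have D3 : (@lebesgue_measure R).-integrable `[0, 1] (EFin \o (fun t =>
      (n 0 0 * h 1 0) * A (pt t) 0 1 + ((n 1 0 * h 0 0) * A (pt t) 1 0 +
       (n 1 0 * h 1 0) * A (pt t) 1 1))).
    exact: (@integrableD _ _ _ _ _ _ _ _ (iA 0 1 _) D2).
  rewrite RintegralD; [|exact: measurable_itv|exact: iA|exact: D3].
  rewrite RintegralD; [|exact: measurable_itv|exact: iA|exact: D2].
  rewrite RintegralD; [|exact: measurable_itv|exact: iA|exact: iA].
  by rewrite !RintegralZl.
rewrite !E !mxE/=; ring.
Qed.

Definition flux_coef (g : 'cV[R]_2) z K : R :=
  \sum_(y in (K :\ z)%SET)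
    let m := midpoint (vtx z) (vtx y) in
    (seg_flux g m (bary K) (vtx z) +
     (if boundary_edge z y then seg_flux g (vtx z) m (bary K) else 0)).

(** The coefficients depend on the mesh and on [A] only, so linearity and boundedness of the flux
    reduce to those of the gradients. *)
Lemma fluxE (beta0 : R) z v : symmetric_elliptic Om A beta0 ->
  flux A z v = \sum_(K in tri M | z \in K)
    (d1 v (bary K) * flux_coef (col2 1 0) z K + d2 v (bary K) * flux_coef (col2 0 1) z K).
Proof.
move=> eA; apply: eq_bigr => K /andP[KM zK].
rewrite !mulr_sumr -big_split/=; apply: eq_bigr => y; rewrite !inE => /andP[yz yK].
have cz := vtx_cell zK; have cy := vtx_cell yK.
have cb : cell K (bary K) by apply: icell_cell; exact: (bary_icell hM).
have cm : cell K (midpoint (vtx z) (vtx y)).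
  have -> : midpoint (vtx z) (vtx y) = ((vtx z).1 + 2^-1 * ((vtx y).1 - (vtx z).1),
      (vtx z).2 + 2^-1 * ((vtx y).2 - (vtx z).2)).
    by rewrite /midpoint; congr pair; field.
  by apply: cell_segment => //; rewrite invr_ge0 ler0n invf_le1// ler1n.
rewrite -!/(seg_flux _ _ _ _) /flux_on_segment -!/(seg_flux _ _ _ _).
rewrite (seg_flux_lin (gradK K v) _ eA KM cm cb) /gradK grad0 grad1.
have distr (p q a b c d : R) :
    (p * a + q * b) + (p * c + q * d) = p * (a + c) + q * (b + d) by ring.
case: ifP => _; last by rewrite !addr0.
by rewrite (seg_flux_lin (grad v (bary K)) _ eA KM cz cm) grad0 grad1; exact: distr.
Qed.

Lemma flux_lin (beta0 : R) (a b : R) z v w : symmetric_elliptic Om A beta0 ->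
  fe Om M v -> fe Om M w -> flux A z (lin a b v w) = a * flux A z v + b * flux A z w.
Proof.
move=> eA [_ Pv _] [_ Pw _]; rewrite !(fluxE _ _ eA) !mulr_sumr -big_split/=.
apply: eq_bigr => K /andP[KM _]; have [-> ->] := fe_grad_lin a b KM (Pv K KM) (Pw K KM).
by move: (flux_coef _ _ _) (flux_coef _ _ _) => p q; ring.
Qed.

Lemma Ihs_lin (a b : R) v w x :
  Ihs Om M (lin a b v w) x = a * Ihs Om M v x + b * Ihs Om M w x.
Proof.
by rewrite /Ihs !mulr_sumr -big_split/=; apply: eq_bigr => z _; rewrite /lin; ring.
Qed.

Lemma bilin_linr (a b : R) u v w :
  bilin M A u (Ihs Om M (lin a b v w)) =
  a * bilin M A u (Ihs Om M v) + b * bilin M A u (Ihs Om M w).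
Proof.
rewrite /bilin !mulrN -opprD; congr (- _); rewrite !mulr_sumr -big_split/=; apply: eq_bigr => z _.
by rewrite Ihs_lin; ring.
Qed.

Lemma bilin_linl (beta0 : R) (a b : R) u v w : symmetric_elliptic Om A beta0 ->
  fe Om M u -> fe Om M v ->
  bilin M A (lin a b u v) w = a * bilin M A u w + b * bilin M A v w.
Proof.
move=> eA fu fv; rewrite /bilin !mulrN -opprD; congr (- _).
rewrite !mulr_sumr -big_split/=; apply: eq_bigr => z _.
by rewrite (flux_lin a b z eA fu fv); move: (flux A z u) (flux A z v) => p q; ring.
Qed.

(** The constant may depend on the mesh; this is affordable because only finitely many meshes are
    treated in this way. *)
Definition mbounded (F : (P -> R) -> R) : Prop :=
  exists C : R, forall v, fe Om M v -> `|F v| <= C * mnorm M v.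

Lemma mbounded0 : mbounded (fun=> 0).
Proof. by exists 0 => v _; rewrite normr0 mul0r. Qed.

Lemma mboundedD F G : mbounded F -> mbounded G -> mbounded (fun v => F v + G v).
Proof.
move=> [C HC] [D HD]; exists (C + D) => v fv; apply: le_trans (ler_normD _ _) _.
by rewrite mulrDl lerD ?HC ?HD.
Qed.

Lemma mboundedZ (a : R) F : mbounded F -> mbounded (fun v => a * F v).
Proof.
move=> [C HC]; exists (`|a| * C) => v fv; rewrite normrM -mulrA.
by rewrite ler_wpM2l// HC.
Qed.

Lemma mbounded_sum (I : Type) (s : seq I) (Q : pred I) (F : I -> (P -> R) -> R) :
  (forall i, Q i -> mbounded (F i)) -> mbounded (fun v => \sum_(i <- s | Q i) F i v).
Proof.
move=> bF; elim: s => [|i s IH].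
  by have := mbounded0; congr mbounded; apply/funext => v; rewrite big_nil.
have [Qi|Qi] := boolP (Q i).
  have := mboundedD (bF i Qi) IH; congr mbounded.
  by apply/funext => v; rewrite big_cons Qi.
by move: IH; congr mbounded; apply/funext => v; rewrite big_cons (negPf Qi).
Qed.

(** Every vertex belongs to some triangle, whose summand in the nodal energy controls the nodal
    value. *)
Lemma mbounded_vtx z : mbounded (fun v => v (vtx z)).
Proof.
have [_ hz _ _ _] := hM; have [K KM zK] := hz z.
have a0 := area_gt0 hM KM; have d0 := @mass_diag_gt0 R.
have C0 : 0 < mass_diag * area K by rewrite mulr_gt0.
exists (Num.sqrt (mass_diag * area K)^-1) => v _.
rewrite -sqrtrM ?invr_ge0 ?(ltW C0)// -[leLHS]ger0_norm// -sqrtr_sqr ler_wsqrtr//.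
rewrite real_normK ?num_real// ler_pdivlMl//.
apply: le_trans (mform_ge hM v); rewrite -mulrA ler_wpM2l ?(ltW d0)//.
rewrite /nodal_energy (bigD1 K)//= -[leLHS]addr0 lerD//.
  by rewrite ler_wpM2l ?(ltW a0)// (bigD1 z)//= lerDl sumr_ge0// => y _; rewrite sqr_ge0.
apply: sumr_ge0 => L /andP[LM _]; rewrite mulr_ge0 ?(ltW (area_gt0 hM LM))//.
by apply: sumr_ge0 => y _; rewrite sqr_ge0.
Qed.

Lemma mbounded_grad K : K \in tri M ->
  mbounded (fun v => d1 v (bary K)) /\ mbounded (fun v => d2 v (bary K)).
Proof.
move=> KM; have [z zK] := tri_nonempty hM KM; have [y [w c]] := tri_corner hM KM zK.
have [_ yK wK _] := corner_mem c; have [_ _ _ D0] := c.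
pose D := tri_det (vtx z) (vtx y) (vtx w).
(* Cramer's rule: the gradient is a fixed linear combination of differences of nodal values. *)
have E v : fe Om M v ->
  d1 v (bary K) = ((vtx w).2 - (vtx z).2) / D * (1 * v (vtx y) + -1 * v (vtx z)) +
    - ((vtx y).2 - (vtx z).2) / D * (1 * v (vtx w) + -1 * v (vtx z)) /\
  d2 v (bary K) = - ((vtx w).1 - (vtx z).1) / D * (1 * v (vtx y) + -1 * v (vtx z)) +
    ((vtx y).1 - (vtx z).1) / D * (1 * v (vtx w) + -1 * v (vtx z)).
  move=> [_ Pv _]; have [p [q [r H]]] := Pv K KM.
  have [-> ->] := d12_icell hM KM (bary_icell hM KM) H.
  rewrite !H; try exact: vtx_cell.
  by rewrite /D; move: D0; rewrite /tri_det => D0; split; field.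
have bd (x : node) : mbounded (fun v => 1 * v (vtx x) + -1 * v (vtx z)).
  by apply: mboundedD; apply: mboundedZ; exact: mbounded_vtx.
split.
  have [C HC] := mboundedD (mboundedZ (((vtx w).2 - (vtx z).2) / D) (bd y))
    (mboundedZ (- ((vtx y).2 - (vtx z).2) / D) (bd w)).
  by exists C => v fv; have [-> _] := E v fv; exact: HC.
have [C HC] := mboundedD (mboundedZ (- ((vtx w).1 - (vtx z).1) / D) (bd y))
  (mboundedZ (((vtx y).1 - (vtx z).1) / D) (bd w)).
by exists C => v fv; have [_ ->] := E v fv; exact: HC.
Qed.

Lemma mbounded_flux (beta0 : R) z : symmetric_elliptic Om A beta0 ->
  mbounded (fun v => flux A z v).
Proof.
move=> eA; have := @mbounded_sum _ (index_enum _) (fun K => (K \in tri M) && (z \in K))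
  (fun K v => flux_coef (col2 1 0) z K * d1 v (bary K) +
     flux_coef (col2 0 1) z K * d2 v (bary K)).
case=> [K /andP[KM _]|C HC].
  by have [h1 h2] := mbounded_grad KM; apply: mboundedD; exact: mboundedZ.
exists C => v fv; rewrite (fluxE _ _ eA); apply: le_trans (HC v fv).
by rewrite le_eqVlt; apply/orP; left; apply/eqP; congr (`|_|); apply: eq_bigr => K _; ring.
Qed.

Lemma mbounded_Ihs x : mbounded (fun v => Ihs Om M v x).
Proof.
have [z|C HC] := @mbounded_sum _ (index_enum _) (fun z => z \in interior_node Om M)
  (fun z v => \1_(control_volume z) x * v (vtx z)).
  by move=> _; apply: mboundedZ; exact: mbounded_vtx.
exists C => v fv; apply: le_trans (HC v fv).
by rewrite le_eqVlt; apply/orP; left; apply/eqP; congr (`|_|); apply: eq_bigr => z _; ring.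
Qed.

Lemma bilin_le_mform (beta0 : R) : symmetric_elliptic Om A beta0 ->
  exists2 C : R, 0 <= C & forall v, fe Om M v ->
    `|bilin M A v (Ihs Om M v)| <= C * mform M v v.
Proof.
move=> eA.
have H (s : seq node) : exists2 C : R, 0 <= C & forall v, fe Om M v ->
    `|\sum_(z <- s) Ihs Om M v (vtx z) * flux A z v| <= C * mnorm M v ^+ 2.
  elim: s => [|z s [C C0 HC]].
    by exists 0 => // v _; rewrite big_nil normr0 mul0r.
  have [B1 H1] := mbounded_Ihs (vtx z); have [B2 H2] := mbounded_flux z eA.
  exists (`|B1| * `|B2| + C); first by rewrite addr_ge0 ?mulr_ge0.
  move=> v fv; rewrite big_cons mulrDl; apply: le_trans (ler_normD _ _) _.
  rewrite lerD ?HC// normrM expr2 mulrACA ler_pM//.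
    by apply: le_trans (H1 v fv) _; rewrite ler_wpM2r ?mnorm_ge0 ?ler_norm.
  by apply: le_trans (H2 v fv) _; rewrite ler_wpM2r ?mnorm_ge0 ?ler_norm.
have [C C0 HC] := H (index_enum _).
by exists C => // v fv; rewrite -(mnorm_sqr hM) /bilin normrN; exact: HC.
Qed.

End BilinearForm.

(** Division of the energy inequality by [phi] makes it linear in the norms, the form to which the
    Gronwall lemmas apply. *)
Lemma step_sqrt (R : realFieldType) (c lam G phi W S : R) : 0 < c -> 0 <= phi -> 0 <= W ->
  0 <= G -> S <= phi * W -> c * (phi ^+ 2 - S) <= lam * phi ^+ 2 + G * phi ->
  phi <= W + (lam * phi + G) / c.
Proof.
move=> c0 p0 W0 G0 SW H.
move: p0; rewrite le_eqVlt => /predU1P[<-|p0].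
  by rewrite mulr0 add0r addr_ge0// divr_ge0// ltW.
rewrite -lerBlDl ler_pdivlMr// -(ler_pM2r p0).
have : c * (phi ^+ 2 - phi * W) <= lam * phi ^+ 2 + G * phi.
  by apply: le_trans H; rewrite ler_wpM2l ?(ltW c0)// lerD2l lerN2.
by rewrite !expr2; lra.
Qed.

(** * Energy inequality for one time step *)

Section SchemeOnMesh.
Context {R : realType}.
Local Notation P := (measurableTypeR R * measurableTypeR R)%type.
Variables (Om : set P) (M : mesh R) (A : R * R -> 'M[R]_2) (q : P -> R).
Variables (alpha beta0 Q : R).
Hypotheses (hOm : convex_polygonal_domain (Om : set (R * R))) (hM : triangulation Om M).
Hypotheses (halpha : 0 < alpha < 1) (eA : symmetric_elliptic Om A beta0).
Hypotheses (bq : bm Om q) (q0 : forall x, Om x -> 0 <= q x) (Q0 : 0 < Q).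
Hypothesis (qQ : forall x, Om x -> `|q x| <= Q).
Implicit Types (u v w : P -> R).

Definition lump_cst : R := Num.sqrt (mass_lump / mass_diag).
Definition equiv_cst : R := Num.sqrt (3 * mass_lump / mass_diag).

Lemma lump_cst_gt0 : 0 < lump_cst.
Proof. by rewrite sqrtr_gt0 divr_gt0 ?mass_lump_gt0 ?mass_diag_gt0. Qed.

Lemma equiv_cst_gt0 : 0 < equiv_cst.
Proof. by rewrite sqrtr_gt0 divr_gt0 ?mass_diag_gt0// mulr_gt0 ?mass_lump_gt0. Qed.

Lemma L2norm_Ihs v : (forall x, ~ Om x -> v x = 0) ->
  L2norm Om (Ihs Om M v) <= lump_cst * mnorm M v.
Proof.
move=> v0; rewrite /L2norm /lump_cst /mnorm -sqrtrM; last first.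
  by rewrite divr_ge0 ?(ltW mass_lump_gt0) ?(ltW mass_diag_gt0).
by rewrite ler_wsqrtr//; exact: (ip_Ihs_le_mform hOm hM).
Qed.

Lemma L2norm_le_mnorm u : fe Om M u -> L2norm Om u <= equiv_cst * mnorm M u.
Proof.
move=> fu; rewrite /L2norm /equiv_cst /mnorm -sqrtrM; last first.
  apply: divr_ge0; last exact: ltW mass_diag_gt0.
  by apply: mulr_ge0 => //; exact: ltW mass_lump_gt0.
by rewrite ler_wsqrtr//; exact: (ip_le_mform hOm hM).
Qed.

Lemma mnorm_le_L2norm u : fe Om M u -> mnorm M u <= lump_cst * L2norm Om u.
Proof.
move=> fu; rewrite /L2norm /lump_cst /mnorm -sqrtrM; last first.
  by rewrite divr_ge0 ?(ltW mass_lump_gt0) ?(ltW mass_diag_gt0).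
by rewrite ler_wsqrtr//; exact: (mform_le_ip hOm hM).
Qed.

Lemma ip_qu u : bm Om u ->
  ip Om (fun x => q x * u x) (fun x => q x * u x) <= Q ^+ 2 * ip Om u u.
Proof.
move=> bu; have bQ := bmZ Q bu.
apply: (@le_trans _ _ (ip Om (fun x => Q * u x) (fun x => Q * u x))).
  apply: (le_ip_sqr hOm) => //; first exact: bmM.
  by move=> x Ox; rewrite !normrM (gtr0_norm Q0) ler_wpM2r// qQ.
have E w : bm Om w -> ip Om (fun x => Q * u x) w = Q * ip Om u w.
  move=> bw; rewrite -[RHS]addr0 -[X in _ + X](mul0r (ip Om u w)) -(ip_lin hOm)//.
  by congr ip; apply/funext => x; rewrite mul0r addr0.
by rewrite E// ipC E// expr2 mulrA.
Qed.

Lemma L2norm_qu u : bm Om u -> L2norm Om (fun x => q x * u x) <= Q * L2norm Om u.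
Proof.
move=> bu; rewrite -[Q in leRHS]gtr0_norm// -sqrtr_sqr /L2norm -sqrtrM ?sqr_ge0//.
by rewrite ler_wsqrtr// ip_qu.
Qed.

Lemma ip_Ihs_le g v : bm Om g -> (forall x, ~ Om x -> v x = 0) ->
  `|ip Om g (Ihs Om M v)| <= lump_cst * L2norm Om g * mnorm M v.
Proof.
move=> bg v0; apply: le_trans (ip_le_L2norm hOm bg (bm_Ihs hM v)) _.
by rewrite (mulrC lump_cst) -mulrA ler_wpM2l ?L2norm_ge0// L2norm_Ihs.
Qed.

Lemma reaction_le u : fe Om M u ->
  `|ip Om (fun x => q x * u x) (Ihs Om M u)| <= lump_cst * Q * equiv_cst * mform M u u.
Proof.
move=> fu; have [bu _ u0] := fu.
apply: le_trans (ip_Ihs_le (bmM bq bu) u0) _.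
rewrite -(mnorm_sqr hM) expr2 -!mulrA ler_wpM2l ?(ltW lump_cst_gt0)// !mulrA.
rewrite ler_wpM2r ?mnorm_ge0//; apply: le_trans (L2norm_qu bu) _.
by rewrite -mulrA ler_wpM2l ?(ltW Q0)// L2norm_le_mnorm.
Qed.

(** For this mesh size the consistency defect is at most [mu6] times the squared H1 norm, hence at
    most the form itself; this gives the factor 2. *)
Lemma grad_energy_coercive (mu5 mu6 : R) u : Vh Om M u -> 0 < mu5 -> 0 < mu6 ->
  0 < beta0 -> bilin_consistency_bound Om M A mu5 -> bilin_coercive Om M A mu6 ->
  meshsize M <= mu6 / mu5 ->
  beta0 * grad_energy M u <= 2 * bilin M A u (Ihs Om M u).
Proof.
move=> Vu mu50 mu60 b0 cons coer hh; have [b1 _ eb] := elliptic_bounds hOm eA.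
have /andP[h1 _] := discrete_form_bounds hM u eb.
apply: le_trans h1 _; have := cons u u Vu Vu; have := coer u Vu.
rewrite -/(discrete_form M A u u); set a := bilin _ _ _ _; set H := H1norm Om u.
move=> h2; rewrite ler_norml => /andP[h3 _].
have h4 : mu5 * meshsize M * H * H <= a.
  apply: le_trans h2; rewrite -mulrA -expr2 ler_wpM2r ?sqr_ge0//.
  by rewrite mulrC -ler_pdivlMr.
lra.
Qed.

(** Pairing [q u] with [u] gives a nonnegative term. The remainder is split by Young's inequality
    with weight the mesh size: coercivity controls [q u], the gradient energy controls
    [u - Ihs Om M u], and the two costs form the smallness condition. *)
Lemma reaction_ge (mu5 mu6 : R) u : Vh Om M u -> 0 < mu5 -> 0 < mu6 ->
  0 < beta0 -> bilin_consistency_bound Om M A mu5 -> bilin_coercive Om M A mu6 ->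
  meshsize M <= mu6 / mu5 ->
  meshsize M * (Q ^+ 2 / mu6 + 6 * mass_lump / beta0) <= 2 ->
  0 <= bilin M A u (Ihs Om M u) + ip Om (fun x => q x * u x) (Ihs Om M u).
Proof.
move=> Vu mu50 mu60 b0 cons coer hh hs.
have h0 := meshsize_gt0 hOm hM.
have fu := Vh_fe hM Vu; have [bu Pu u0] := fu.
have bqu := bmM bq bu; have bI := bm_Ihs hM u; have bd := bmB bu bI.
have g := grad_energy_coercive Vu mu50 mu60 b0 cons coer hh.
have c := coer u Vu; move: g c; set a := bilin _ _ _ _ => g c.
have uu : mu6 * ip Om u u <= a.
  apply: le_trans c; rewrite ler_wpM2l ?(ltW mu60)// -L2norm_sqr.
  by rewrite lerXn2r ?nnegrE ?L2norm_ge0 ?H1norm_ge0 ?L2norm_le_H1norm.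
have E : ip Om (fun x => q x * u x) (Ihs Om M u) = ip Om (fun x => q x * u x) u -
    ip Om (fun x => q x * u x) (fun x => u x - Ihs Om M u x).
  have -> : (fun x => u x - Ihs Om M u x) = (fun x => 1 * u x + -1 * Ihs Om M u x).
    by apply/funext => x; ring.
  by rewrite (ip_linr hOm)//; ring.
have qu0 : 0 <= ip Om (fun x => q x * u x) u.
  by apply: Rintegral_ge0 => x Ox; rewrite -mulrA mulr_ge0 ?q0// -expr2 sqr_ge0.
have Y := ip_young hOm h0 bqu bd.
have dd := ip_sub_Ihs hOm hM fu; have qq := ip_qu bu.
have {}Y : `|ip Om (fun x => q x * u x) (fun x => u x - Ihs Om M u x)| <= a.
  apply: le_trans Y _; rewrite ler_pdivrMr//.
  have a0 : 0 <= a by apply: le_trans uu; rewrite mulr_ge0 ?ip_ge0 ?(ltW mu60).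
  have l0 := @mass_lump_gt0 R.
  have t1 : meshsize M * ip Om (fun x => q x * u x) (fun x => q x * u x) <=
      meshsize M * (Q ^+ 2 / mu6) * a.
    rewrite -mulrA ler_wpM2l ?(ltW h0)//; apply: le_trans qq _.
    by rewrite -mulrA ler_wpM2l ?sqr_ge0// ler_pdivlMl.
  have t2 : ip Om (fun x => u x - Ihs Om M u x) (fun x => u x - Ihs Om M u x) / meshsize M <=
      meshsize M * (6 * mass_lump / beta0) * a.
    rewrite ler_pdivrMr//; apply: le_trans dd _.
    have -> : meshsize M * (6 * mass_lump / beta0) * a * meshsize M =
        3 * mass_lump * meshsize M ^+ 2 * (2 * a / beta0).
      by move: mass_lump => l; ring.
    apply: ler_wpM2l; last by rewrite ler_pdivlMr// mulrC.
    by apply: mulr_ge0; [apply: mulr_ge0 => //; exact: ltW|exact: sqr_ge0].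
  apply: le_trans (lerD t1 t2) _; rewrite -mulrDl -mulrDr mulrC.
  by rewrite ler_wpM2l.
have := ler_norm (ip Om (fun x => q x * u x) (fun x => u x - Ihs Om M u x)).
rewrite E; lra.
Qed.

Section Solution.
Variables (tau T : R) (N : nat) (f : R -> P -> R) (u : nat -> P -> R).
Hypothesis tau0 : 0 < tau.
Let c := tau `^ (- alpha) / Gamma (2 - alpha).

Lemma dtau_cst_gt0 : 0 < c.
Proof. by rewrite divr_gt0 ?powR_gt0 ?Gamma_gt0. Qed.

Lemma DtauE n : Dtau alpha tau u n = fun x => \sum_(k < n.+1) (c * btilde alpha n k) * u k x.
Proof.
by apply/funext => x; rewrite /Dtau big_mkord mulr_sumr; apply: eq_bigr => k _; rewrite mulrA.
Qed.

Lemma btilde_split n (F : nat -> R) : \sum_(k < n.+1) btilde alpha n k * F k =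
  F n - \sum_(k < n) l1weight alpha n k * F k.
Proof.
rewrite big_ord_recr/= /btilde eqxx mul1r addrC -sumrN; congr (_ + _).
by apply: eq_bigr => k _; rewrite /l1weight mulNr opprK.
Qed.

Lemma ip_Dtau n v : (forall k, (k <= n)%N -> Vh Om M (u k)) ->
  (forall x, ~ Om x -> v x = 0) -> ip Om (Dtau alpha tau u n) (Ihs Om M v) =
  c * (mform M (u n) v - \sum_(k < n) l1weight alpha n k * mform M (u k) v).
Proof.
move=> Vu v0; rewrite DtauE (ip_sum hOm (fun k => c * btilde alpha n k)); last 2 first.
- by move=> k kn; have [] := Vh_fe hM (Vu k kn).
- exact: bm_Ihs.
rewrite -(btilde_split n (fun k => mform M (u k) v)) mulr_sumr; apply: eq_bigr => k _.
by have [bk Pk _] := Vh_fe hM (Vu k (ltn_ord k)); rewrite (ip_Ihs hOm hM)// mulrA.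
Qed.

Hypothesis sol : scheme alpha tau Om M A q f N u.
Variable F : R.
Hypothesis hf : forall n, (0 < n <= N)%N ->
  bm Om (f (n%:R * tau)) /\ L2norm Om (f (n%:R * tau)) <= F.

Let Vu n : (n <= N)%N -> Vh Om M (u n).
Proof. by case: sol => h _; exact: h. Qed.

Lemma load_le n v : (0 < n <= N)%N -> (forall x, ~ Om x -> v x = 0) ->
  `|ip Om (f (n%:R * tau)) (Ihs Om M v)| <= lump_cst * F * mnorm M v.
Proof.
move=> hn v0; have [bf fF] := hf hn; apply: le_trans (ip_Ihs_le bf v0) _.
by rewrite ler_wpM2r ?mnorm_ge0// ler_wpM2l ?(ltW lump_cst_gt0).
Qed.

Lemma sum_weight_le (n : nat) (v : P -> R) :
  `|\sum_(k < n) l1weight alpha n k * mform M (u k) v| <=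
  (\sum_(k < n) l1weight alpha n k * mnorm M (u k)) * mnorm M v.
Proof.
apply: le_trans (ler_norm_sum _ _ _) _; rewrite mulr_suml.
apply: ler_sum => k _; have w0 := l1weight_ge0 halpha (ltn_ord k).
by rewrite normrM (ger0_norm w0) -mulrA ler_wpM2l// (mform_le hM).
Qed.

Lemma step_eq n v : (0 < n <= N)%N -> Vh Om M v ->
  c * (mform M (u n) v - \sum_(k < n) l1weight alpha n k * mform M (u k) v) +
  bilin M A (u n) (Ihs Om M v) + ip Om (fun x => q x * u n x) (Ihs Om M v) =
  ip Om (f (n%:R * tau)) (Ihs Om M v).
Proof.
move=> hn Vv; have /andP[_ nN] := hn; have [_ v0 _] := Vv.
case: sol => _ /(_ n hn v Vv) <-; rewrite ip_Dtau// => k kn.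
by apply: Vu; exact: leq_trans nN.
Qed.

(** The number [lam] measures how negative the elliptic and reaction part may be: 0 on fine meshes,
    a mesh-dependent constant on coarse ones. *)
Lemma step_mnorm (lam : R) n : (0 < n <= N)%N -> 0 <= F ->
  - (lam * mform M (u n) (u n)) <=
    bilin M A (u n) (Ihs Om M (u n)) + ip Om (fun x => q x * u n x) (Ihs Om M (u n)) ->
  mnorm M (u n) <= \sum_(k < n) l1weight alpha n k * mnorm M (u k) +
    (lam * mnorm M (u n) + lump_cst * F) / c.
Proof.
move=> hn F0 H; have /andP[_ nN] := hn; have Vn := Vu nN.
have [_ v0 _] := Vn.
apply: (step_sqrt (S := \sum_(k < n) l1weight alpha n k * mform M (u k) (u n))).
- exact: dtau_cst_gt0.
- exact: mnorm_ge0.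
- by apply: sumr_ge0 => k _; rewrite mulr_ge0 ?mnorm_ge0// l1weight_ge0.
- by rewrite mulr_ge0// ltW// lump_cst_gt0.
- rewrite mulrC; apply: le_trans (ler_norm _) _; exact: sum_weight_le.
rewrite (mnorm_sqr hM); have E := step_eq hn Vn; have := load_le hn v0.
rewrite -E ler_norml => /andP[_ h]; lra.
Qed.

End Solution.

End SchemeOnMesh.

(** * Stability on a fixed mesh *)

Section FiniteDimension.
Context {R : realType}.
Local Notation P := (measurableTypeR R * measurableTypeR R)%type.
Variables (Om : set P) (M : mesh R).
Hypotheses (hOm : convex_polygonal_domain (Om : set (R * R))) (hM : triangulation Om M).
Local Notation V := (Vh Om M).

Definition comb (I : Type) (s : seq I) (x : I -> R) (e : I -> P -> R) : P -> R :=
  fun y => \sum_(i <- s) x i * e i y.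

Lemma comb_cons (I : Type) (i : I) s x (e : I -> P -> R) :
  comb (i :: s) x e = lin (x i) 1 (e i) (comb s x e).
Proof. by apply/funext => y; rewrite /comb /lin big_cons mul1r. Qed.

Lemma Vh_comb (I : Type) (s : seq I) x (e : I -> P -> R) : V (fun=> 0) ->
  (forall i, V (e i)) -> V (comb s x e).
Proof.
move=> V0 Ve; elim: s => [|i s IH].
  by move: V0; congr Vh; apply/funext => y; rewrite /comb big_nil.
by rewrite comb_cons; apply: Vh_lin => //; exact: (dom_open hOm).
Qed.

Lemma mnorm_lin (a b : R) (u v : P -> R) :
  mnorm M (lin a b u v) <= `|a| * mnorm M u + `|b| * mnorm M v.
Proof.
have m0 w : 0 <= mnorm M w by exact: mnorm_ge0.
have p0 : 0 <= `|a| * mnorm M u + `|b| * mnorm M v by rewrite addr_ge0 ?mulr_ge0 ?mnorm_ge0.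
rewrite -(@ler_pXn2r _ 2)// ?nnegrE ?mnorm_ge0// (mnorm_sqr hM).
have L w : mform M (lin a b u v) w = a * mform M u w + b * mform M v w by exact: mform_lin.
rewrite L (mformC M u (lin a b u v)) (mformC M v (lin a b u v)) !L (mformC M v u).
rewrite -!(mnorm_sqr hM).
have := mform_le hM u v; move: (mform M u v) (mnorm M u) (mnorm M v) => p m n hp.
have -> : (`|a| * m + `|b| * n) ^+ 2 =
    (a * m) ^+ 2 + 2 * (`|a * b| * (m * n)) + (b * n) ^+ 2.
  rewrite normrM sqrrD !exprMn !real_normK ?num_real// mulr_natl.
  by rewrite -!mulrA (mulrCA m `|b| n).
have : a * b * p <= `|a * b| * (m * n).
  by apply: le_trans (ler_norm _) _; rewrite normrM ler_wpM2l.
nra.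
Qed.

Lemma mnorm_comb (I : Type) (s : seq I) x (e : I -> P -> R) :
  mnorm M (comb s x e) <= \sum_(i <- s) `|x i| * mnorm M (e i).
Proof.
elim: s => [|i s IH].
  rewrite big_nil /mnorm /mform big1 ?sqrtr0// => K _.
  have z (y : 'I_(nv M)) : comb [::] x e (vtx y) = 0 by rewrite /comb big_nil.
  under eq_bigr do rewrite z mul0r.
  under [X in _ * (_ + _ * (X * _))]eq_bigr do rewrite z.
  by rewrite !sumr_const !mul0rn mul0r !mulr0 addr0 mulr0.
rewrite comb_cons big_cons; apply: le_trans (mnorm_lin _ _ _ _) _.
by rewrite normr1 mul1r lerD2l.
Qed.

Definition nodal (w : P -> R) : 'rV[R]_(nv M) := \row_z w (vtx z).

Lemma nodal_comb m (x : 'rV[R]_m) (e : 'I_m -> P -> R) :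
  nodal (comb (index_enum _) (x 0) e) = x *m \matrix_i nodal (e i).
Proof.
apply/rowP => z; rewrite !mxE /comb; apply: eq_bigr => i _.
by rewrite !mxE.
Qed.

(** No explicit nodal basis is constructed: a family of maximal size with independent nodal vectors
    exists since its size is bounded by the number of vertices, and adjoining a nodal vector outside
    its span would contradict maximality. *)
Lemma Vh_basis : exists m (e : 'I_m -> P -> R), [/\ forall i, V (e i),
  row_free (\matrix_i nodal (e i)) &
  forall w, V w -> (nodal w <= \matrix_i nodal (e i))%MS].
Proof.
pose p m := `[< exists e : 'I_m -> P -> R, (forall i, V (e i)) /\
  row_free (\matrix_i nodal (e i)) >].
have p0 : exists m, p m.
  exists 0%N; apply/asboolP; exists (fun _ _ => 0); split; first by case.
  by rewrite /row_free eqn_leq rank_leq_row leq0n.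
have pM m : p m -> (m <= nv M)%N.
  by move=> /asboolP[e [_ /eqP<-]]; exact: rank_leq_col.
case: (ex_maxnP p0 pM) => m /asboolP[e [Ve fe]] mmax; exists m, e; split=> // w Vw.
set E := \matrix_i nodal (e i) in fe *; apply: contrapT => /negP nw.
have w0 : nodal w != 0 by apply: contraNneq nw => ->; exact: sub0mx.
have cap0 : \rank (E :&: nodal w)%MS = 0%N.
  have [le eq] := mxrank_leqif_sup (capmxSr E (nodal w)).
  rewrite rank_rV w0 in le eq.
  case r : (\rank (E :&: nodal w)%MS) le eq => [//|[|//]] _; rewrite eqxx => h.
  by case/negP: nw; apply: submx_trans (capmxSl E (nodal w)); rewrite -h.
pose e' (i : 'I_(m + 1)) := match fintype.split i with inl j => e j | inr _ => w end.
have E'E : \matrix_i nodal (e' i) = col_mx E (nodal w).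
  apply/row_matrixP => i; rewrite rowK /e'; case: fintype.splitP => j ij.
    have -> : i = lshift 1 j by exact/val_inj.
    by apply/rowP => z; rewrite [RHS]mxE col_mxEu !mxE.
  have -> : i = rshift m j by exact/val_inj.
  by apply/rowP => z; rewrite [RHS]mxE col_mxEd !mxE.
suff : p (m + 1)%N by move=> /mmax; rewrite addn1 ltnn.
apply/asboolP; exists e'; split.
  by move=> i; rewrite /e'; case: fintype.split.
rewrite E'E /row_free -addsmxE; have := mxrank_sum_cap E (nodal w).
by rewrite cap0 addn0 => ->; rewrite rank_rV w0 (eqP fe).
Qed.

(** Nondegeneracy makes the Gram matrix on a basis invertible. The coordinates of [w] are the values
    [B w (e j)] times the inverse matrix, and these values are bounded by hypothesis. *)
Lemma form_bounded_below (B : (P -> R) -> (P -> R) -> R) : V (fun=> 0) ->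
  (forall a b u v w, V u -> V v -> V w -> B (lin a b u v) w = a * B u w + b * B v w) ->
  (forall a b u v w, V u -> V v -> V w -> B w (lin a b u v) = a * B w u + b * B w v) ->
  (forall w, V w -> (forall v, V v -> B w v = 0) -> w = fun=> 0) ->
  exists2 K : R, 0 <= K & forall w G, V w -> 0 <= G ->
    (forall v, V v -> `|B w v| <= G * mnorm M v) -> mnorm M w <= K * G.
Proof.
move=> V0 Bl Br nd; have [m [e [Ve fE sE]]] := Vh_basis.
set E := \matrix_i nodal (e i) in fE sE.
have lin0 : lin 0 0 (fun=> 0) (fun=> 0) = (fun=> 0) :> (P -> R).
  by apply/funext => y; rewrite /lin !mul0r addr0.
have Bl0 w : V w -> B (fun=> 0) w = 0.
  move=> Vw; have := Bl 0 0 (fun=> 0) (fun=> 0) w V0 V0 Vw.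
  by rewrite lin0 !mul0r addr0.
have Br0 w : V w -> B w (fun=> 0) = 0.
  move=> Vw; have := Br 0 0 (fun=> 0) (fun=> 0) w V0 V0 Vw.
  by rewrite lin0 !mul0r addr0.
have nilE (x : 'I_m -> R) : comb [::] x e = fun=> 0.
  by apply/funext => y; rewrite /comb big_nil.
have Blc (s : seq 'I_m) x w : V w -> B (comb s x e) w = \sum_(i <- s) x i * B (e i) w.
  move=> Vw; elim: s => [|i s IH]; first by rewrite nilE big_nil Bl0.
  by rewrite comb_cons Bl ?IH ?big_cons ?mul1r//; exact: Vh_comb.
have Brc (s : seq 'I_m) x w : V w -> B w (comb s x e) = \sum_(i <- s) x i * B w (e i).
  move=> Vw; elim: s => [|i s IH]; first by rewrite nilE big_nil Br0.
  by rewrite comb_cons Br ?IH ?big_cons ?mul1r//; exact: Vh_comb.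
pose S (x : 'rV[R]_m) := comb (index_enum _) (x 0) e.
have VS x : V (S x) by exact: Vh_comb.
have rep w : V w -> exists x, w = S x.
  move=> Vw; have /submxP[x wx] := sE w Vw; exists x.
  have Vd := Vh_lin 1 (-1) (dom_open hOm) Vw (VS x).
  have d0 := fe_eq0 hM (Vh_fe hM Vd).
  apply/funext => y; have /(congr1 (fun g => g y)) : lin 1 (-1) w (S x) = fun=> 0.
    apply: d0 => z; have := congr1 (fun r : 'rV_(nv M) => r 0 z) wx.
    by rewrite -nodal_comb !mxE /lin -/(S x) => ->; rewrite mul1r mulN1r subrr.
  by rewrite /lin mul1r mulN1r => /eqP; rewrite subr_eq0 => /eqP.
pose G := \matrix_(i, j) B (e i) (e j).
have xG (x : 'rV[R]_m) j : (x *m G) 0 j = B (S x) (e j).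
  by rewrite mxE Blc//; apply: eq_bigr => i _; rewrite mxE.
have uG : G \in unitmx.
  rewrite -row_free_unit -kermx_eq0; apply/rowV0P => x /sub_kermxP x0.
  have Sx0 : S x = fun=> 0.
    apply: nd => // v /rep[y ->]; rewrite Brc// big1// => j _.
    by rewrite -xG x0 mxE mulr0.
  apply/eqP; rewrite -(mulmx_free_eq0 x fE) -nodal_comb -/(S x) Sx0.
  by apply/eqP/rowP => z; rewrite !mxE.
pose K := \sum_i (\sum_j mnorm M (e j) * `|invmx G j i|) * mnorm M (e i).
have m0 w : 0 <= mnorm M w by exact: mnorm_ge0.
exists K.
  apply: sumr_ge0 => i _; rewrite mulr_ge0 ?mnorm_ge0//.
  by apply: sumr_ge0 => j _; rewrite mulr_ge0 ?mnorm_ge0.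
move=> w H Vw H0 HB; have [x wx] := rep w Vw; rewrite {1}wx.
apply: le_trans (mnorm_comb _ _ _) _; rewrite /K mulr_suml; apply: ler_sum => i _.
rewrite mulrAC ler_wpM2r ?mnorm_ge0//.
have -> : x 0 i = \sum_j (x *m G) 0 j * invmx G j i.
  by rewrite -[in LHS](mulmxK uG x) [in LHS]mxE.
apply: le_trans (ler_norm_sum _ _ _) _; rewrite mulr_suml; apply: ler_sum => j _.
rewrite normrM mulrAC ler_wpM2r// xG -wx; apply: le_trans (HB _ (Ve j)) _.
by rewrite mulrC.
Qed.

End FiniteDimension.

Section MeshStability.
Context {R : realType}.
Local Notation P := (measurableTypeR R * measurableTypeR R)%type.
Variables (Om : set P) (M : mesh R) (A : R * R -> 'M[R]_2) (q : P -> R).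
Variables (alpha beta0 Q : R).
Hypotheses (hOm : convex_polygonal_domain (Om : set (R * R))) (hM : triangulation Om M).
Hypotheses (halpha : 0 < alpha < 1) (eA : symmetric_elliptic Om A beta0).
Hypotheses (bq : bm Om q) (q0 : forall x, Om x -> 0 <= q x) (Q0 : 0 < Q).
Hypothesis (qQ : forall x, Om x -> `|q x| <= Q).

Definition load_bounded (tau F : R) (N : nat) (f : R -> P -> R) : Prop :=
  forall n, (0 < n <= N)%N -> bm Om (f (n%:R * tau)) /\ L2norm Om (f (n%:R * tau)) <= F.

Section OneTimeStep.
Variables (tau : R) (N : nat).
Hypotheses (tau0 : 0 < tau) (N0 : (0 < N)%N).
Let c := tau `^ (- alpha) / Gamma (2 - alpha).
Let B (w v : P -> R) : R := c * mform M w v + bilin M A w (Ihs Om M v) +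
  ip Om (fun x => q x * w x) (Ihs Om M v).

(* Adding a kernel element to the last time level preserves the scheme, so the
   uniqueness of the solution forbids such elements. *)
Lemma step_form_nondegenerate (f : R -> P -> R) (u : nat -> P -> R) :
  is_the_solution alpha tau Om M A q f N u ->
  forall w, Vh Om M w -> (forall v, Vh Om M v -> B w v = 0) -> w = fun=> 0.
Proof.
move=> [sol uniq] w Vw Bw; have [Vu eq] := sol.
pose u' n := if n == N then lin 1 1 (u n) w else u n.
have Vu' n : (n <= N)%N -> Vh Om M (u' n).
  move=> nN; rewrite /u'; case: ifP => _; last exact: Vu.
  by apply: Vh_lin => //; [exact: (dom_open hOm)|exact: Vu].
have u'E n : (n < N)%N -> u' n = u n by move=> nN; rewrite /u' ltn_eqF.
have sol' : scheme alpha tau Om M A q f N u'.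
  split=> // n /andP[n0 nN] v Vv; have [_ v0 _] := Vv.
  have Vk k : (k <= n)%N -> Vh Om M (u k) by move=> kn; apply: Vu; exact: leq_trans nN.
  have Vk' k : (k <= n)%N -> Vh Om M (u' k) by move=> kn; apply: Vu'; exact: leq_trans nN.
  rewrite -(eq n _ v Vv) ?n0// (ip_Dtau alpha hOm hM tau Vk v0) (ip_Dtau alpha hOm hM tau Vk' v0).
  have -> : \sum_(k < n) l1weight alpha n k * mform M (u' k) v =
      \sum_(k < n) l1weight alpha n k * mform M (u k) v.
    by apply: eq_bigr => k _; rewrite u'E// (leq_trans (ltn_ord k)).
  move: nN; rewrite leq_eqVlt => /predU1P[nN|/u'E->//].
  rewrite {1 2 3}/u' nN eqxx.
  have fu := Vh_fe hM (Vu N (leqnn N)); have fw := Vh_fe hM Vw.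
  have [bu _ _] := fu; have [bw _ _] := fw.
  have mE : mform M (lin 1 1 (u N) w) v = 1 * mform M (u N) v + 1 * mform M w v.
    exact: mform_lin.
  rewrite mE (bilin_linl hM 1 1 _ eA fu fw).
  have -> : (fun x => q x * lin 1 1 (u N) w x) =
      (fun x => 1 * (q x * u N x) + 1 * (q x * w x)).
    by apply/funext => x; rewrite /lin; ring.
  rewrite (ip_lin hOm); [|exact: bmM|exact: bmM|exact: bm_Ihs].
  have add_kernel (k p s r a1 a2 i1 i2 : R) : k * p + a2 + i2 = 0 ->
      k * (1 * r + 1 * p - s) + (1 * a1 + 1 * a2) + (1 * i1 + 1 * i2) = k * (r - s) + a1 + i1.
    by move=> h; rewrite -[RHS]addr0 -h; ring.
  by apply: add_kernel; exact: Bw.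
have := uniq u' sol' (u'E 0%N N0) N (leqnn N).
rewrite /u' eqxx => /(congr1 (fun g => g _)) H; apply/funext => x.
by have := H x; rewrite /lin !mul1r => /eqP; rewrite -subr_eq0 addrAC subrr add0r => /eqP.
Qed.

Lemma one_step_stability : exists2 D : R, 0 <= D &
  forall (F : R) (f : R -> P -> R) (u : nat -> P -> R), 0 <= F ->
  is_the_solution alpha tau Om M A q f N u -> load_bounded tau F N f ->
  forall n, (n <= N)%N -> mnorm M (u n) <= D * (mnorm M (u 0%N) + F).
Proof.
have c0 : 0 < c by exact: dtau_cst_gt0.
have l0 := @lump_cst_gt0 R.
have m0 w : 0 <= mnorm M w by exact: mnorm_ge0.
(* If no data admit a unique solution, there is nothing to prove. Otherwise one instance shows that
   the form of a time step is nondegenerate, a property independent of the data. *)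
have [[f1 [u1 s1]]|no] := pselect (exists f u, is_the_solution alpha tau Om M A q f N u);
  last by exists 0 => // F f u _ s; exfalso; apply: no; exists f, u.
have nd := step_form_nondegenerate s1.
have distr (k a b m1 m2 a1 a2 i1 i2 : R) :
    k * (a * m1 + b * m2) + (a * a1 + b * a2) + (a * i1 + b * i2) =
    a * (k * m1 + a1 + i1) + b * (k * m2 + a2 + i2) by ring.
have V0 : Vh Om M (fun=> 0).
  have V1 := proj1 (proj1 s1) 0%N (leq0n N).
  have := Vh_lin 0 0 (dom_open hOm) V1 V1; congr Vh.
  by apply/funext => y; rewrite /lin !mul0r addr0.
have Bl a b u v w : Vh Om M u -> Vh Om M v -> Vh Om M w ->
    B (lin a b u v) w = a * B u w + b * B v w.
  move=> /(Vh_fe hM) fu /(Vh_fe hM) fv _; have [bu _ _] := fu; have [bv _ _] := fv.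
  rewrite /B (bilin_linl hM a b _ eA fu fv).
  have -> : mform M (lin a b u v) w = a * mform M u w + b * mform M v w.
    exact: mform_lin.
  have -> : (fun x => q x * lin a b u v x) = (fun x => a * (q x * u x) + b * (q x * v x)).
    by apply/funext => x; rewrite /lin; ring.
  by rewrite (ip_lin hOm); [exact: distr|exact: bmM|exact: bmM|exact: bm_Ihs].
have Br a b u v w : Vh Om M u -> Vh Om M v -> Vh Om M w ->
    B w (lin a b u v) = a * B w u + b * B w v.
  move=> _ _ /(Vh_fe hM)[bw _ _]; rewrite /B bilin_linr.
  rewrite mformC (mformC M w u) (mformC M w v).
  have -> : mform M (lin a b u v) w = a * mform M u w + b * mform M v w.
    exact: mform_lin.
  have -> : Ihs Om M (lin a b u v) = fun x => a * Ihs Om M u x + b * Ihs Om M v x.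
    by apply/funext => x; rewrite Ihs_lin.
  by rewrite (ip_linr hOm); [exact: distr|exact: bm_Ihs|exact: bm_Ihs|exact: bmM].
have [K K0 HK] := form_bounded_below hOm hM V0 Bl Br nd.
(* A growth factor per step; the power [D ^+ N] is acceptable because [N] is fixed here. *)
pose D := 1 + K * (c + lump_cst).
have D1 : 1 <= D by rewrite lerDl mulr_ge0// addr_ge0 ?(ltW l0) ?(ltW c0).
exists (D ^+ N); first by rewrite exprn_ge0// (le_trans ler01).
move=> F f u F0 [sol _] hf.
set X := mnorm M (u 0%N) + F; have X0 : 0 <= X by rewrite addr_ge0 ?mnorm_ge0.
have H n : (n <= N)%N -> mnorm M (u n) <= D ^+ n * X.
  elim/ltn_ind: n => n IH nN; case: n IH nN => [_ _|n IH nN].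
    by rewrite expr0 mul1r lerDl.
  have Y0 : 0 <= D ^+ n * X by rewrite mulr_ge0// exprn_ge0// (le_trans ler01).
  have W : \sum_(k < n.+1) l1weight alpha n.+1 k * mnorm M (u k) <= D ^+ n * X.
    have -> : D ^+ n * X = \sum_(k < n.+1) l1weight alpha n.+1 k * (D ^+ n * X).
      by rewrite -mulr_suml sum_l1weight_all ?mul1r//; case/andP: halpha.
    apply: ler_sum => k _; rewrite ler_wpM2l ?l1weight_ge0//.
    apply: le_trans (IH k (ltn_ord k) (leq_trans (ltnW (ltn_ord k)) nN)) _.
    by rewrite ler_wpM2r// ler_weXn2l// -ltnS.
  apply: le_trans (HK (u n.+1) (c * (D ^+ n * X) + lump_cst * F) _ _ _) _.
  - by case: sol => Vu _; exact: Vu.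
  - by apply: addr_ge0; apply: mulr_ge0 => //; exact: ltW.
  - move=> v Vv; have [_ v0 _] := Vv.
    have E := step_eq hOm hM (tau := tau) sol (n := n.+1) nN Vv; rewrite -/c in E.
    have -> : B (u n.+1) v = c * \sum_(k < n.+1) l1weight alpha n.+1 k * mform M (u k) v +
        ip Om (f (n.+1%:R * tau)) (Ihs Om M v).
      by rewrite -E /B; ring.
    apply: le_trans (ler_normD _ _) _; rewrite mulrDl lerD//; last first.
      exact: (load_le hOm hM hf (n := n.+1) nN v0).
    rewrite normrM (gtr0_norm c0) -(mulrA c) ler_wpM2l ?(ltW c0)//.
    apply: le_trans (@sum_weight_le R Om M alpha hM halpha u n.+1 v) _.
    by rewrite ler_wpM2r.
  have FX : F <= D ^+ n * X.
    apply: le_trans (_ : X <= _); first by rewrite lerDr.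
    by rewrite ler_peMl// exprn_ege1.
  rewrite exprS -mulrA.
  have : K * (c * (D ^+ n * X) + lump_cst * F) <= K * ((c + lump_cst) * (D ^+ n * X)).
    by rewrite ler_wpM2l// mulrDl lerD2l ler_wpM2l// ltW.
  move=> h; apply: le_trans h _; rewrite mulrA ler_wpM2r//.
  by rewrite /D lerDr.
move=> n nN; apply: le_trans (H n nN) _.
by rewrite ler_wpM2r// ler_weXn2l.
Qed.

End OneTimeStep.

Lemma mesh_stability (T : R) : 0 < T -> exists2 C : R, 0 < C &
  forall (N : nat) (F : R) (f : R -> P -> R) (u : nat -> P -> R), (0 < N)%N -> 0 <= F ->
  is_the_solution alpha (T / N%:R) Om M A q f N u -> load_bounded (T / N%:R) F N f ->
  forall n, (n <= N)%N -> mnorm M (u n) <= C * (mnorm M (u 0%N) + F).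
Proof.
move=> T0; have l0 := @lump_cst_gt0 R; have e0 := @equiv_cst_gt0 R.
have m0 w : 0 <= mnorm M w by exact: mnorm_ge0.
have [Ca Ca0 HCa] := bilin_le_mform hM eA.
(* Bounds the elliptic and reaction forms in absolute value, so their sign does not matter on this
   mesh. *)
pose lam := Ca + lump_cst * Q * equiv_cst.
have lam0 : 0 < lam by rewrite ltr_wpDl// !mulr_gt0.
have [C [ts [C0 ts0 HC]]] := l1_gronwall_uniform halpha (Gamma_gt0 halpha) T0 lam0.
have HD N : exists D : R, 0 <= D /\ ((0 < N)%N ->
    forall (F : R) (f : R -> P -> R) (u : nat -> P -> R), 0 <= F ->
    is_the_solution alpha (T / N%:R) Om M A q f N u -> load_bounded (T / N%:R) F N f ->
    forall n, (n <= N)%N -> mnorm M (u n) <= D * (mnorm M (u 0%N) + F)).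
  have [N0|] := ltnP 0 N; last by exists 0.
  have tau0 : 0 < T / N%:R by rewrite divr_gt0// ltr0n.
  by have [D D0 HD] := one_step_stability tau0 N0; exists D; split => // _; exact: HD.
have [Df HDf] := choice HD.
(* Time steps longer than [ts] occur for [N < N1] only; the sum of the constants for these [N] is
   added to the Gronwall constant. *)
pose N1 := (Num.truncn (T / ts)).+1.
exists (C * (1 + lump_cst) + \sum_(k < N1) Df k).
  by rewrite ltr_wpDr ?sumr_ge0// => [k _|]; [have [] := HDf k|rewrite mulr_gt0// addr_gt0].
move=> N F f u N0 F0 sol hf n nN.
have X0 : 0 <= mnorm M (u 0%N) + F by rewrite addr_ge0.
have N0' : 0 < N%:R :> R by rewrite ltr0n.
have [small|large] := leP (T / N%:R) ts; last first.
  have NN1 : (N < N1)%N.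
    have /andP[_] : ((Num.truncn (T / ts))%:R <= T / ts < N1%:R).
      by apply: truncn_itv; rewrite divr_ge0// ltW.
    move=> h; rewrite -(@ltr_nat R); apply: le_lt_trans h.
    by rewrite ler_pdivlMr// mulrC -ler_pdivlMr// ltW.
  have [Dn0 HN] := HDf N; apply: le_trans (HN N0 F f u F0 sol hf n nN) _.
  rewrite ler_wpM2r// (bigD1 (Ordinal NN1))//= addrCA lerDl addr_ge0//.
    by rewrite ltW// mulr_gt0// addr_gt0.
  by apply: sumr_ge0 => k _; have [] := HDf k.
have tau0 : 0 < T / N%:R by rewrite divr_gt0.
have := HC N (lump_cst * F) (fun k => mnorm M (u k)) N0 small _ _ _ n nN.
move=> /(_ (mulr_ge0 (ltW l0) F0)) /(_ (fun k => m0 (u k))) h.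
apply: le_trans (h _) _.
  move=> k Z kN hZ; have [sol1 _] := sol.
  have /andP[_ kN'] := kN; have fk := Vh_fe hM (proj1 sol1 k kN').
  apply: le_trans (step_mnorm hOm hM halpha tau0 sol1 hf (lam := lam) kN F0 _) _.
    have h1 := HCa _ fk; have h2 := reaction_le hOm hM bq Q0 qQ fk.
    rewrite ler_norml in h1; rewrite ler_norml in h2.
    by rewrite /lam; move: h1 h2 => /andP[h1 _] /andP[h2 _]; lra.
  rewrite lerD2l ler_wpM2r ?invr_ge0 ?(ltW (dtau_cst_gt0 halpha tau0))//.
  by rewrite lerD2r ler_wpM2l ?(ltW lam0) ?hZ.
have S0 : 0 <= \sum_(k < N1) Df k by apply: sumr_ge0 => k _; have [] := HDf k.
apply: le_trans (_ : C * (1 + lump_cst) * (mnorm M (u 0%N) + F) <= _); last first.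
  by rewrite ler_wpM2r// lerDl.
rewrite -mulrA ler_wpM2l ?(ltW C0)//; have := m0 (u 0%N); nra.
Qed.

End MeshStability.

Lemma absorb_half (R : realFieldType) (s s' t d g : R) :
  t - s <= g -> s <= t / 2 + d + s' / 2 -> t <= s' + (2 * d + 2 * g).
Proof. lra. Qed.

(** * Stability on fine meshes *)

Section Stability.
Context {R : realType}.
Local Notation P := (measurableTypeR R * measurableTypeR R)%type.
Variables (Om : set P) (M : mesh R) (A : R * R -> 'M[R]_2) (q : P -> R).
Variables (alpha beta0 Q mu5 mu6 T : R).
Hypotheses (hOm : convex_polygonal_domain (Om : set (R * R))) (hM : triangulation Om M).
Hypotheses (halpha : 0 < alpha < 1) (eA : symmetric_elliptic Om A beta0).
Hypotheses (bq : bm Om q) (q0 : forall x, Om x -> 0 <= q x) (Q0 : 0 < Q).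
Hypothesis (qQ : forall x, Om x -> `|q x| <= Q).
Hypotheses (hmu5 : 0 < mu5) (hmu6 : 0 < mu6) (hbeta0 : 0 < beta0) (hT : 0 < T).

Lemma L2norm_of_mnorm (C F : R) (u v : P -> R) : 0 <= C -> 0 <= F -> Vh Om M u -> Vh Om M v ->
  mnorm M u <= C * (mnorm M v + F) ->
  L2norm Om u <= equiv_cst * C * (lump_cst + 1) * (L2norm Om v + F).
Proof.
move=> C0 F0 Vu Vv h; have l0 := @lump_cst_gt0 R; have e0 := @equiv_cst_gt0 R.
have h1 := L2norm_le_mnorm hOm hM (Vh_fe hM Vu).
have h2 := mnorm_le_L2norm hOm hM (Vh_fe hM Vv).
have n0 := L2norm_ge0 Om v.
apply: le_trans h1 _; rewrite -!mulrA ler_wpM2l ?(ltW e0)//.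
apply: le_trans h _; rewrite ler_wpM2l//.
apply: le_trans (_ : lump_cst * L2norm Om v + F <= _); first by rewrite lerD2r.
have : 0 <= lump_cst * F by rewrite mulr_ge0// ltW.
by move: (lump_cst) (L2norm Om v) l0 n0 => l n l0 n0; nra.
Qed.

Lemma bilin_comb (I : Type) (s : seq I) (x : I -> R) (e : I -> P -> R) (u : P -> R) :
  bilin M A u (Ihs Om M (comb s x e)) = \sum_(i <- s) x i * bilin M A u (Ihs Om M (e i)).
Proof.
elim: s => [|i s IH].
  have -> : comb [::] x e = lin 0 0 u u.
    by apply/funext => y; rewrite /comb big_nil /lin !mul0r addr0.
  by rewrite bilin_linr !mul0r addr0 big_nil.
by rewrite comb_cons bilin_linr big_cons IH mul1r.
Qed.

Section SmallMesh.
Hypotheses (sym : bilin_symmetry_bound Om M A mu5)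
  (cons : bilin_consistency_bound Om M A mu5) (coer : bilin_coercive Om M A mu6).
Hypothesis (hh : meshsize M <= mu6 / mu5).
Hypothesis (hs : meshsize M * (Q ^+ 2 / mu6 + 6 * mass_lump / beta0) <= 2).
Variables (N : nat) (f : R -> P -> R) (u : nat -> P -> R) (F : R).
Let tau := T / N%:R.
Hypotheses (N0 : (0 < N)%N) (F0 : 0 <= F) (sol : scheme alpha tau Om M A q f N u)
  (hf : load_bounded Om tau F N f).

Let tau0 : 0 < tau. Proof. by rewrite divr_gt0// ltr0n. Qed.

Let Vu n : (n <= N)%N -> Vh Om M (u n).
Proof. by case: sol => h _; exact: h. Qed.

Lemma small_mesh_stability n : (n <= N)%N -> mnorm M (u n) <=
  4 * (1 + lump_cst * (Gamma (2 - alpha) * T `^ alpha / (1 - alpha))) *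
  (mnorm M (u 0%N) + F).
Proof.
move=> nN; have l0 := @lump_cst_gt0 R.
have m0 w : 0 <= mnorm M w by exact: mnorm_ge0.
have G0 := Gamma_gt0 halpha; have /andP[a0 a1] := halpha.
set K := Gamma (2 - alpha) * _ / _.
have K0 : 0 <= K by rewrite divr_ge0 ?mulr_ge0 ?powR_ge0 ?(ltW G0)// subr_ge0 ltW.
have h := l1_stability (phi := fun k => mnorm M (u k)) (F := lump_cst * F) halpha G0 hT N0 _ _ _ nN.
apply: le_trans (h _ _ _) _.
- by rewrite mulr_ge0// ltW.
- by move=> k; exact: m0.
- move=> k kN; have /andP[_ kN'] := kN.
  have := step_mnorm hOm hM halpha tau0 sol hf (lam := 0) kN F0.
  rewrite !mul0r oppr0 add0r; apply.
  exact: reaction_ge (Vu kN') hmu5 hmu6 hbeta0 cons coer hh hs.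
rewrite -[leRHS]mulrA ler_pM2l// -/K.
have := m0 (u 0%N); have : 0 <= lump_cst * K by rewrite mulr_ge0// ltW.
have -> : lump_cst * F * K = lump_cst * K * F by ring.
move: (lump_cst * K) (mnorm M _) => p m {h} p0 hm.
have -> : (1 + p) * (m + F) = m + p * F + (F + p * m) by ring.
by rewrite lerDl addr_ge0// mulr_ge0.
Qed.

Let a k := bilin M A (u k) (Ihs Om M (u k)).
Let c := tau `^ (- alpha) / Gamma (2 - alpha).

Let a_ge k : (k <= N)%N -> mu6 * H1norm Om (u k) ^+ 2 <= a k.
Proof. by move=> kN; exact: coer (Vu kN). Qed.

(* Testing with the discrete fractional derivative of the solution itself. *)
Lemma derivative_test (L : R) n : (0 < n <= N)%N -> L2norm Om (u n) <= L ->
  c * (a n - \sum_(k < n) l1weight alpha n k * bilin M A (u n) (Ihs Om M (u k))) <=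
  (lump_cst * (F + Q * L)) ^+ 2.
Proof.
move=> hn hL; have /andP[n0 nN] := hn.
have l0 := @lump_cst_gt0 R.
pose d := Dtau alpha tau u n.
have dE : d = comb (index_enum _) (fun k : 'I_n.+1 => c * btilde alpha n k) (fun k => u k).
  exact: DtauE.
have Vk (k : 'I_n.+1) : Vh Om M (u k) by apply: Vu; apply: leq_trans nN; rewrite -ltnS.
have V0 : Vh Om M (fun=> 0).
  have := Vh_lin 0 0 (dom_open hOm) (Vk ord0) (Vk ord0); congr Vh.
  by apply/funext => y; rewrite /lin !mul0r addr0.
have Vd : Vh Om M d by rewrite dE; exact: Vh_comb.
have [bd Pd d0] := Vh_fe hM Vd; have [bu _ _] := Vh_fe hM (Vu nN).
have -> : c * (a n - \sum_(k < n) l1weight alpha n k * bilin M A (u n) (Ihs Om M (u k))) =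
    bilin M A (u n) (Ihs Om M d).
  rewrite dE bilin_comb -(btilde_split alpha n (fun k => bilin M A (u n) (Ihs Om M (u k)))).
  by rewrite mulr_sumr; apply: eq_bigr => k _; rewrite mulrA.
have E := proj2 sol n hn d Vd; rewrite -/d (ip_Ihs hOm hM bd Pd d0) -(mnorm_sqr hM) in E.
have h1 := load_le hOm hM hf hn d0.
have h2 := ip_Ihs_le hOm hM (bmM bq bu) d0.
have m0 : 0 <= mnorm M d by exact: mnorm_ge0.
have h3 : lump_cst * L2norm Om (fun x => q x * u n x) * mnorm M d <=
    lump_cst * (Q * L) * mnorm M d.
  rewrite ler_wpM2r// ler_wpM2l ?(ltW l0)//; apply: le_trans (L2norm_qu hOm bq Q0 qQ bu) _.
  by rewrite ler_wpM2l// ltW.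
have {}h2 := le_trans h2 h3.
move: h1 h2 E; rewrite !ler_norml => /andP[_ h1] /andP[h2 _].
move: (ip _ _ _) (ip _ _ _) h1 h2 => r1 r2 h1 h2.
move: (bilin _ _ _ _) (mnorm M d) m0 h1 h2 => b X m0 h1 h2 E.
have -> : b = r2 - r1 - X ^+ 2 by rewrite -E; ring.
have EX : lump_cst * (F + Q * L) * X = lump_cst * F * X + lump_cst * (Q * L) * X by ring.
(* Completing the square: [k * X - X ^+ 2 <= k ^+ 2 / 4], where [X] is the mass norm of the
   fractional derivative and [k] collects load and reaction. *)
have := sqr_ge0 (X - lump_cst * (F + Q * L) / 2).
have := sqr_ge0 (lump_cst * (F + Q * L)).
move: EX h1 h2; move: (lump_cst * F * X) (lump_cst * (Q * L) * X) (lump_cst * (F + Q * L)).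
move=> p1 p2 k EX h1 h2 k2; rewrite sqrrB => h5.
have E3 : X * (k / 2) *+ 2 = p1 + p2 by rewrite -EX; field.
have E4 : (k / 2) ^+ 2 = k ^+ 2 / 4 by field.
by rewrite E3 E4 in h5; lra.
Qed.

Lemma cross_term (Z : R) n k : (n <= N)%N -> (k <= N)%N -> a n <= Z -> a k <= Z ->
  bilin M A (u n) (Ihs Om M (u k)) <= (a n + a k) / 2 + mu5 * meshsize M / (2 * mu6) * Z.
Proof.
move=> nN kN nZ kZ; have Vn := Vu nN; have Vk := Vu kN.
have fn := Vh_fe hM Vn; have fk := Vh_fe hM Vk.
have := coer (Vh_lin 1 (-1) (dom_open hOm) Vn Vk).
rewrite (bilin_linl hM _ _ _ eA fn fk) !bilin_linr -/(a n) -/(a k) => h1.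
have {}h1 := le_trans (mulr_ge0 (ltW hmu6) (sqr_ge0 _)) h1.
have := sym Vn Vk; rewrite ler_norml => /andP[_].
have := a_ge nN; have := a_ge kN; have h0 := meshsize_gt0 hOm hM.
move: h1; move: (bilin _ _ _ _) (bilin _ _ _ _) => b1 b2 h1.
move: (H1norm _ _) (H1norm _ _) (a n) (a k) nZ kZ h1 => x y an ak nZ kZ h1 hy hx h2.
(* The product is at most the mean of the squares, each bounded by [Z / mu6] through coercivity. *)
have xy : x * y <= Z / mu6.
  rewrite ler_pdivlMr//; have := mulr_ge0 (ltW hmu6) (sqr_ge0 (x - y)).
  have -> : mu6 * (x - y) ^+ 2 = mu6 * x ^+ 2 + mu6 * y ^+ 2 - 2 * (x * y * mu6) by ring.
  by lra.
have h3 : mu5 * meshsize M * x * y <= mu5 * meshsize M * (Z / mu6).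
  by rewrite -mulrA ler_wpM2l// mulr_ge0 ?ltW.
have -> : mu5 * meshsize M / (2 * mu6) * Z = mu5 * meshsize M * (Z / mu6) / 2.
  by field; rewrite gt_eqF.
lra.
Qed.

(** The symmetry defect is multiplied and divided by [c] to fit the Gronwall recursion, where
    [mu5 * meshsize M / mu6 * c] plays the role of [lam]. *)
Lemma energy_step (L Z : R) n : (0 < n <= N)%N -> L2norm Om (u n) <= L ->
  (forall k, (k <= n)%N -> a k <= Z) ->
  a n <= \sum_(k < n) l1weight alpha n k * a k +
    (mu5 * meshsize M / mu6 * c * Z + 2 * (lump_cst * (F + Q * L)) ^+ 2) / c.
Proof.
move=> hn hL hZ; have /andP[n0 nN] := hn; have /andP[_ a1] := halpha.
have c0 : 0 < c by exact: dtau_cst_gt0.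
have := derivative_test hn hL; set G := (_ * (F + _)) ^+ 2 => h1.
pose e := mu5 * meshsize M / (2 * mu6) * Z.
have h2 : \sum_(k < n) l1weight alpha n k * bilin M A (u n) (Ihs Om M (u k)) <=
    a n / 2 + e + (\sum_(k < n) l1weight alpha n k * a k) / 2.
  have -> : a n / 2 + e + (\sum_(k < n) l1weight alpha n k * a k) / 2 =
      \sum_(k < n) l1weight alpha n k * ((a n + a k) / 2 + e).
    have idw (w x y z : R) : w * (x / 2 + z) + w * y / 2 = w * ((x + y) / 2 + z) by field.
    transitivity (\sum_(k < n) (l1weight alpha n k * (a n / 2 + e) +
        l1weight alpha n k * a k / 2)); last by apply: eq_bigr => k _; exact: idw.
    by rewrite big_split/= -!mulr_suml (sum_l1weight_all a1 n0) mul1r.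
  apply: ler_sum => k _; rewrite ler_wpM2l ?l1weight_ge0//.
  apply: cross_term => //; [exact: leq_trans (ltnW (ltn_ord k)) nN|exact: hZ|].
  by apply: hZ; exact: ltnW.
move: h1; rewrite mulrC -ler_pdivlMr// => h1.
have -> : (mu5 * meshsize M / mu6 * c * Z + 2 * G) / c = 2 * e + 2 * (G / c).
  by rewrite /e; move: c c0 G {h1} => c' c0 G; field; rewrite !gt_eqF.
exact: absorb_half h1 h2.
Qed.

(** The Gronwall conclusion is a hypothesis here, with its constants [C2] and [ts], so that these
    are fixed before the mesh and the solution. *)
Lemma H1_stability (c0 b1 C1 C2 ts : R) : 0 < c0 -> 0 < b1 -> 0 <= C1 -> 0 < C2 ->
  (forall x (g : 'cV[R]_2), closure (Om : set (R * R)) x ->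
    beta0 * (g 0 0 ^+ 2 + g 1 0 ^+ 2) <= dot (A x *m g) g
      <= b1 * (g 0 0 ^+ 2 + g 1 0 ^+ 2)) ->
  (forall (N : nat) (F : R) (phi : nat -> R),
    (0 < N)%N -> T / N%:R <= ts -> 0 <= F -> (forall n, 0 <= phi n) ->
    (forall n Q, (0 < n <= N)%N -> (forall k, (k <= n)%N -> phi k <= Q) ->
      phi n <= \sum_(k < n) l1weight alpha n k * phi k +
        (mu5 * c0 / (mu6 * Gamma (2 - alpha)) * Q + F) /
        ((T / N%:R) `^ (- alpha) / Gamma (2 - alpha))) ->
    forall n, (n <= N)%N -> phi n <= C2 * (phi 0%N + F)) ->
  tau <= ts -> tau <= 1 -> meshsize M <= c0 * tau ->
  (forall n, (n <= N)%N -> L2norm Om (u n) <= C1 * (L2norm Om (u 0%N) + F)) ->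
  forall n, (n <= N)%N -> H1norm Om (u n) ^+ 2 <=
    C2 * (b1 / (3 * mass_lump) + mu5 * c0 + 2 * (lump_cst * (1 + Q * C1)) ^+ 2) / mu6 *
    (H1norm Om (u 0%N) + F) ^+ 2.
Proof.
move=> c00 b10 C10 C20 eb gr tts t1 hc hL n nN.
have l0 := @lump_cst_gt0 R; have G0 := Gamma_gt0 halpha; have /andP[a0 a1] := halpha.
have k0 : 0 < c by exact: dtau_cst_gt0.
have h0 := meshsize_gt0 hOm hM.
have H0 w := @H1norm_ge0 R Om w.
pose L := C1 * (L2norm Om (u 0%N) + F).
pose Y := 2 * (lump_cst * (F + Q * L)) ^+ 2.
have Y0 : 0 <= Y by rewrite mulr_ge0// sqr_ge0.
(* The Gronwall lemma asks for nonnegativity at every index, whereas coercivity is known only for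
   the levels up to [N]. *)
pose phi k := if (k <= N)%N then a k else 0.
have phi0 k : 0 <= phi k.
  rewrite /phi; case: ifP => // kN; apply: le_trans (a_ge kN).
  by rewrite mulr_ge0 ?sqr_ge0// ltW.
have ck : mu5 * meshsize M / mu6 * c <= mu5 * c0 / (mu6 * Gamma (2 - alpha)).
  have tt : tau * tau `^ (- alpha) <= 1.
    have -> : tau * tau `^ (- alpha) = tau `^ (1 - alpha).
      rewrite powRD; last by apply/implyP => _; rewrite gt_eqF.
      by rewrite powRr1// ltW.
    rewrite -[leRHS](powRr0 tau); apply: ger_powR; last by rewrite subr_ge0 ltW.
    by rewrite tau0.
  have -> : mu5 * meshsize M / mu6 * c =
      mu5 / (mu6 * Gamma (2 - alpha)) * (meshsize M * tau `^ (- alpha)).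
    by rewrite /c; field; rewrite !gt_eqF.
  have -> : mu5 * c0 / (mu6 * Gamma (2 - alpha)) = mu5 / (mu6 * Gamma (2 - alpha)) * c0.
    by field; rewrite !gt_eqF.
  rewrite ler_wpM2l ?divr_ge0 ?mulr_ge0 ?(ltW hmu5) ?(ltW hmu6) ?(ltW G0)//.
  apply: le_trans (_ : c0 * tau * tau `^ (- alpha) <= _).
    by rewrite ler_wpM2r ?powR_ge0.
  by rewrite -mulrA ler_piMr// ltW.
have phiE k : (k <= N)%N -> phi k = a k by rewrite /phi => ->.
have := gr N Y phi N0 tts Y0 phi0 _ n nN; rewrite (phiE n nN) (phiE 0%N)// => h.
have {}h : a n <= C2 * (a 0%N + Y).
  apply: h => k Z kN hZ; have /andP[k1 kN'] := kN.
  have aZ j : (j <= k)%N -> a j <= Z.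
    by move=> jk; have := hZ j jk; rewrite /phi (leq_trans jk kN').
  have Z0 : 0 <= Z by apply: le_trans (phi0 k) (hZ k (leqnn k)).
  rewrite {1}/phi kN'; apply: le_trans (energy_step kN (hL k kN') aZ) _.
  rewrite lerD//.
    apply: ler_sum => j _; rewrite /phi (leq_trans (ltnW (ltn_ord j)) kN')//.
  rewrite ler_wpM2r ?invr_ge0 ?(ltW k0)// lerD2r.
  by rewrite ler_wpM2r.
have V0 := Vu (leq0n N).
(* The initial energy is bounded through the discrete form at the barycenters: the consistency bound
   and the upper ellipticity bound replace continuity of the form in the H1 norm. *)
have ha0 : a 0%N <= (b1 / (3 * mass_lump) + mu5 * c0) * H1norm Om (u 0%N) ^+ 2.
  have := cons V0 V0; rewrite -/(discrete_form M A _ _) -/(a 0%N) ler_norml => /andP[_ h1].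
  have /andP[_ h2] := discrete_form_bounds hM (u 0%N) eb.
  have h3 := grad_energy_le_H1norm hOm hM (Vh_fe hM V0).
  have m0 := @mass_lump_gt0 R; move: h1 h2 h3.
  move: (mass_lump) m0 => l m0 h1 h2 h3.
  have {}h3 : b1 * grad_energy M (u 0%N) <= b1 / (3 * l) * H1norm Om (u 0%N) ^+ 2.
    have l3 : 0 < 3 * l by rewrite mulr_gt0.
    by rewrite -mulrA ler_wpM2l ?(ltW b10)// ler_pdivlMl.
  have h4 : mu5 * meshsize M * H1norm Om (u 0%N) * H1norm Om (u 0%N) <=
      mu5 * c0 * H1norm Om (u 0%N) ^+ 2.
    rewrite -mulrA -expr2 ler_wpM2r ?sqr_ge0// ler_wpM2l ?(ltW hmu5)//.
    by apply: le_trans hc _; rewrite ler_piMr// ltW.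
  rewrite lerBlDr in h1; apply: le_trans h1 _; rewrite addrC mulrDl lerD//.
  exact: le_trans h2 h3.
pose W := H1norm Om (u 0%N) + F.
have W0 : 0 <= W by rewrite addr_ge0.
have hW : H1norm Om (u 0%N) ^+ 2 <= W ^+ 2.
  by rewrite lerXn2r ?nnegrE// lerDl.
have YW : Y <= 2 * (lump_cst * (1 + Q * C1)) ^+ 2 * W ^+ 2.
  rewrite /Y -mulrA ler_wpM2l// -exprMn lerXn2r ?nnegrE//.
  - rewrite mulr_ge0 ?(ltW l0)// addr_ge0// mulr_ge0 ?(ltW Q0)// mulr_ge0//.
    by rewrite addr_ge0 ?L2norm_ge0.
  - by rewrite mulr_ge0// mulr_ge0 ?(ltW l0)// addr_ge0// mulr_ge0// ltW.
  rewrite -mulrA ler_wpM2l ?(ltW l0)// mulrDl mul1r lerD//; first by rewrite /W lerDr.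
  rewrite -mulrA ler_wpM2l ?(ltW Q0)// ler_wpM2l// lerD2r.
  exact: L2norm_le_H1norm.
rewrite -(ler_pM2l hmu6); apply: le_trans (a_ge nN) _; apply: le_trans h _.
have p0 : 0 <= b1 / (3 * mass_lump) + mu5 * c0.
  apply: addr_ge0; last by rewrite mulr_ge0 ?ltW.
  by apply: divr_ge0; [exact: ltW|apply: mulr_ge0 => //; exact: ltW mass_lump_gt0].
have h5 : a 0%N <= (b1 / (3 * mass_lump) + mu5 * c0) * W ^+ 2.
  by apply: le_trans ha0 _; rewrite ler_wpM2l.
move: p0 h5 YW; move: (b1 / (3 * mass_lump) + mu5 * c0) (2 * _ ^+ 2) => p r p0 h5 YW.
have -> : mu6 * (C2 * (p + r) / mu6 * W ^+ 2) = C2 * (p * W ^+ 2 + r * W ^+ 2).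
  by field; rewrite gt_eqF.
by rewrite ler_wpM2l ?(ltW C20)// lerD.
Qed.

End SmallMesh.

End Stability.

(** * Constants uniform over the mesh family *)

Lemma uniform_constant (R : realType) (p : nat -> R -> Prop) (c : R) (i0 : nat) :
  (forall i x y, x <= y -> p i x -> p i y) -> (forall i, exists x, p i x) ->
  (forall i, (i0 <= i)%N -> p i c) -> exists2 x, 0 < x & forall i, p i x.
Proof.
move=> mono ex; elim: i0 c => [|i0 IH] c hc.
  exists (Num.max c 1); first by rewrite lt_max ltr01 orbT.
  by move=> i; apply: mono (hc i _) => //; rewrite le_max lexx.
(* The last exceptional mesh is absorbed by taking a maximum, which leaves one exception fewer. *)
have [x px] := ex i0; apply: (IH (Num.max c x)) => i; rewrite leq_eqVlt => /predU1P[<-|ii].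
  by apply: mono px; rewrite le_max lexx orbT.
by apply: mono (hc i ii); rewrite le_max lexx.
Qed.

Lemma load_bounded_sup (R : realType) (Om : set (R * R)) (T : R) (f : R -> R * R -> R) (N : nat) :
  convex_polygonal_domain Om -> 0 < T -> (0 < N)%N ->
  {within `[0, T] `*` closure Om, continuous (fun p => f p.1 p.2)} ->
  0 <= supL2 Om T f /\ load_bounded Om (T / N%:R) (supL2 Om T f) N f.
Proof.
move=> hOm T0 N0 cf; split.
  have [|_] := L2norm_le_sup (t := 0) hOm (ltW T0) _ cf; first by rewrite lexx ltW.
  exact/le_trans/L2norm_ge0.
have n0 : 0 < N%:R :> R by rewrite ltr0n.
move=> n /andP[_ nN]; apply: L2norm_le_sup => //; first exact: ltW.
rewrite mulr_ge0 ?divr_ge0 ?(ltW T0)//= mulrCA ler_piMr ?(ltW T0)//.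
by rewrite ler_pdivrMr// mul1r ler_nat.
Qed.

Theorem theorem4p2 (R : realType) (Om : set (R * R)) (T alpha beta0 : R)
  (q : R * R -> R) (A : R * R -> 'M[R]_2) (Th : nat -> mesh R) (mu5 mu6 : R)
  (hOm : convex_polygonal_domain Om)
  (hT : 0 < T) (halpha : 0 < alpha < 1)
  (hq : {within closure Om, continuous q})
  (hq0 : forall x, closure Om x -> 0 <= q x)
  (hbeta0 : 0 < beta0) (hA : symmetric_elliptic Om A beta0)
  (hTh : forall i, triangulation Om (Th i))
  (hqu : quasi_uniform Th)
  (hh : meshsize (Th i) @[i --> \oo] --> 0)
  (hmu5 : 0 < mu5) (hmu6 : 0 < mu6)
  (hi : forall i, bilin_symmetry_bound Om (Th i) A mu5 /\
                  bilin_consistency_bound Om (Th i) A mu5)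
  (hii : exists2 h0 : R, 0 < h0 & forall i,
           0 < meshsize (Th i) <= h0 -> bilin_coercive Om (Th i) A mu6) :
  (exists2 C : R, 0 < C &
    forall (f : R -> R * R -> R) (i N : nat) (u : nat -> R * R -> R),
      {within `[0, T] `*` closure Om, continuous (fun p => f p.1 p.2)} ->
      (0 < N)%N ->
      is_the_solution alpha (T / N%:R) Om (Th i) A q f N u ->
      forall n, (0 < n <= N)%N ->
        L2norm Om (u n) <= C * (L2norm Om (u 0%N) + supL2 Om T f))
  /\
  (forall c0 : R, 0 < c0 ->
    exists C tau0 : R, [/\ 0 < C, 0 < tau0 < 1 &
    forall (f : R -> R * R -> R) (i N : nat) (u : nat -> R * R -> R),
      {within `[0, T] `*` closure Om, continuous (fun p => f p.1 p.2)} ->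
      (0 < N)%N ->
      is_the_solution alpha (T / N%:R) Om (Th i) A q f N u ->
      meshsize (Th i) <= c0 * (T / N%:R) <= c0 * tau0 ->
      meshsize (Th i) <= Num.min (mu6 / mu5) 1 ->
      forall n, (0 < n <= N)%N ->
        H1norm Om (u n)
          <= C * expR (c0 * T * mu5 / (2 * mu6))
             * (H1norm Om (u 0%N) + supL2 Om T f)]).
Proof.
have [h0 h0_gt0 coer] := hii.
have [Q Q0 qQ] := compact_fun_bounded (dom_compact hOm) hq.
have qQ' x (Ox : Om x) : `|q x| <= Q by apply: qQ; exact: subset_closure.
have q0 x (Ox : Om x) : 0 <= q x by apply: hq0; exact: subset_closure.
have bq := bm_within hOm hq.
have m0 := @mass_lump_gt0 R; have l0 := @lump_cst_gt0 R; have e0 := @equiv_cst_gt0 R.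
have G0 := Gamma_gt0 halpha; have /andP[a0 a1] := halpha.
pose S := Q ^+ 2 / mu6 + 6 * mass_lump / beta0.
have S0 : 0 < S by rewrite addr_gt0// divr_gt0// ?exprn_gt0// mulr_gt0.
(* The three thresholds ensure coercivity, absorption of the consistency defect, and domination of
   the reaction term. *)
pose h2 := Num.min h0 (Num.min (mu6 / mu5) (2 / S)).
have h20 : 0 < h2 by rewrite !lt_min h0_gt0 !divr_gt0.
have small i : meshsize (Th i) <= h2 ->
    [/\ bilin_coercive Om (Th i) A mu6, meshsize (Th i) <= mu6 / mu5 & meshsize (Th i) * S <= 2].
  rewrite !le_min => /and3P[s1 s2 s3]; split=> //; last by rewrite -ler_pdivlMr.
  by apply: coer; rewrite s1 (meshsize_gt0 hOm (hTh i)).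
pose p i C := forall (N : nat) (F : R) (f : R -> R * R -> R) (u : nat -> R * R -> R),
  (0 < N)%N -> 0 <= F -> is_the_solution alpha (T / N%:R) Om (Th i) A q f N u ->
  load_bounded Om (T / N%:R) F N f ->
  forall n, (n <= N)%N -> mnorm (Th i) (u n) <= C * (mnorm (Th i) (u 0%N) + F).
have [Cm Cm0 hCm] : exists2 C, 0 < C & forall i, p i C.
  have /cvgrPdist_le/(_ _ h20)[i0 _ hi0] := hh.
  apply: (@uniform_constant _ p
    (4 * (1 + lump_cst * (Gamma (2 - alpha) * T `^ alpha / (1 - alpha)))) i0).
  - move=> i x y xy px N F f u N0 F0 sol hf n nN.
    apply: le_trans (px N F f u N0 F0 sol hf n nN) _.
    by rewrite ler_wpM2r// addr_ge0// mnorm_ge0.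
  - move=> i; have [C _ HC] := mesh_stability hOm (hTh i) halpha hA bq Q0 qQ' hT.
    by exists C; exact: HC.
  - move=> i ii N F f u N0 F0 [sol _] hf n nN.
    have ih : meshsize (Th i) <= h2.
      have := hi0 i ii; rewrite sub0r normrN; exact/le_trans/ler_norm.
    have [ci h1 hs] := small i ih.
    exact: (small_mesh_stability hOm (hTh i) halpha hA bq q0 Q0 qQ' hmu5 hmu6 hbeta0 hT
      (proj2 (hi i)) ci h1 hs N0 F0 sol hf nN).
pose C1 := equiv_cst * Cm * (lump_cst + 1).
have C10 : 0 < C1 by rewrite mulr_gt0 ?mulr_gt0// addr_gt0.
have part1 (f : R -> R * R -> R) i N u :
    {within `[0, T] `*` closure Om, continuous (fun p => f p.1 p.2)} -> (0 < N)%N ->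
    is_the_solution alpha (T / N%:R) Om (Th i) A q f N u -> forall n, (n <= N)%N ->
    L2norm Om (u n) <= C1 * (L2norm Om (u 0%N) + supL2 Om T f).
  move=> cf N0 sol n nN; have [F0 hf] := load_bounded_sup hOm hT N0 cf.
  have Vu k : (k <= N)%N -> Vh Om (Th i) (u k) by case: sol => -[h _] _; exact: h.
  apply: (L2norm_of_mnorm hOm (hTh i) (ltW Cm0) F0 (Vu n nN) (Vu 0%N (leq0n N))).
  exact: (hCm i N _ f u).
split.
  by exists C1 => // f i N u cf N0 sol n /andP[_ nN]; exact: (part1 f i N u).
move=> c0 c00.
have lam0 : 0 < mu5 * c0 / (mu6 * Gamma (2 - alpha)) by rewrite divr_gt0 ?mulr_gt0.
have [C2 [ts [C20 ts0 gr]]] := l1_gronwall_uniform halpha G0 hT lam0.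
have [b1 b10 eb] := elliptic_bounds hOm hA.
pose K := C2 * (b1 / (3 * mass_lump) + mu5 * c0 + 2 * (lump_cst * (1 + Q * C1)) ^+ 2) / mu6.
(* The bound 1/2 gives [tau0 < 1]; [h2 / c0] turns [h <= c0 * tau] into [h <= h2], hence coercivity;
   [ts] is the Gronwall threshold. The summand 1 keeps the constant positive. *)
exists (Num.sqrt K + 1), (Num.min (2^-1) (Num.min (h2 / c0) ts)); split.
- by rewrite ltr_wpDl ?sqrtr_ge0.
- by rewrite !lt_min ts0 divr_gt0//= invr_gt0 ltr0n/= gt_min invf_lt1 ?ltr1n.
move=> f i N u cf N0 sol /andP[hc]; rewrite ler_pM2l// !le_min => /and3P[t1 t2 t3] _.
move=> n /andP[_ nN]; have [F0 hf] := load_bounded_sup hOm hT N0 cf.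
have ih : meshsize (Th i) <= h2.
  by apply: le_trans hc _; rewrite mulrC -ler_pdivlMr.
have [ci _ _] := small i ih; have [si ki] := hi i.
have t1' : T / N%:R <= 1 by apply: le_trans t1 _; rewrite invf_le1 ?ler1n.
have W0 : 0 <= H1norm Om (u 0%N) + supL2 Om T f by rewrite addr_ge0// H1norm_ge0.
have /ler_wsqrtr := H1_stability hOm (hTh i) halpha hA bq Q0 qQ' hmu5 hmu6 hT si ki ci N0 F0
  (proj1 sol) hf c00 b10 (ltW C10) C20 eb gr t3 t1' hc (part1 f i N u cf N0 sol) nN.
rewrite -/K sqrtr_sqr ger0_norm ?H1norm_ge0// => h.
apply: le_trans h _; rewrite (mulrC K) sqrtrM ?sqr_ge0// sqrtr_sqr ger0_norm// mulrC.
rewrite ler_wpM2r//; apply: le_trans (_ : Num.sqrt K + 1 <= _); first by rewrite lerDl.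
(* The exponent is nonnegative, so the exponential factor is at least 1 and only enlarges the
   bound. *)
rewrite ler_peMr ?addr_ge0 ?sqrtr_ge0// -expR0 ler_expR.
by rewrite divr_ge0 ?mulr_ge0 ?ltW.
Qed.
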